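(* For every $p\in[1,2]$ there exists a constant $c=c(p)>0$, depending only on $p$, such that the following holds. Let $(\Omega,\mathcal F,\mu)$ be a probability space, let $m\in\mathbb N$, and let $\xi^1,\ldots,\xi^m$ be independent random points in $\Omega$ (not necessarily identically distributed) satisfying \[ \mu(E)=\frac1m\sum_{j=1}^m\mathbb P\{\xi^j\in E\},\qquad E\in\mathcal F. \] Let $N\ge4$ and $s\in[4,N]$ be integers, and let $\mathcal D_N=\{\varphi_1,\dots,\varphi_N\}\subset B(\Omega)$ be a uniformly bounded one-sided $4s$-sparse Riesz system in $L_2(\Omega,\mu)$ with constant $K\ge16$. Let $\lambda\ge e$ and $\varepsilon\in(0,\tfrac12]$. If \[ m\ge(\lambda\varepsilon^{-1})^2(\log\varepsilon^{-1})\,Ks\,\log N\,\log s\,\log(Ks)\,\log\log(Ks), \] then with probability at least $1-2e^{-c\lambda(\log\lambda)^{1/2}}$ one has \[ (1-\varepsilon)\|f\|_{L_p(\mu)}^p\le\frac1m\sum_{j=1}^m|f(\xi^j)|^p\le(1+\varepsilon)\|f\|_{L_p(\mu)}^p\qquad\text{for all } f\in\Sigma_s(\mathcal D_N). \]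
   Context: $B(\Omega)$ is the space of bounded functions $f\colon\Omega\to\mathbb C$ with $\|f\|_\infty=\sup_{x\in\Omega}|f(x)|$; $\|f\|_{L_p(\mu)}=(\int_\Omega|f|^p\,d\mu)^{1/p}$, and the functions $\varphi_j$ are $\mathcal F$-measurable. $\log$ is the natural logarithm. For an integer $v\ge1$, a system $\mathcal D_N=\{\varphi_1,\dots,\varphi_N\}\subset B(\Omega)$ is a uniformly bounded one-sided $v$-sparse Riesz system with constant $K\ge1$ if $\|\varphi_j\|_\infty\le1$ for $j=1,\dots,N$ and \[ \sum_{j=1}^N|a_j|^2\le K\Bigl\|\sum_{j=1}^Na_j\varphi_j\Bigr\|_{L_2(\mu)}^2 \] for every $(a_1,\dots,a_N)\in\mathbb C^N$ with at most $v$ nonzero coordinates. $\Sigma_s(\mathcal D_N):=\bigcup_{J\subset\{1,\dots,N\},\,|J|=s}\operatorname{span}\{\varphi_j\colon j\in J\}$ (complex linear spans). *)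

(* Defs.v *)
From HB Require Import structures.
From mathcomp Require Import all_boot all_order all_algebra.
From mathcomp Require Import all_classical all_reals all_analysis.
From mathcomp Require Import complex.

Set Implicit Arguments.
Unset Strict Implicit.
Unset Printing Implicit Defensive.

Import Order.TTheory GRing.Theory Num.Theory.
Import numFieldNormedType.Exports.

Local Open Scope classical_set_scope.
Local Open Scope ring_scope.

(* The norm `|z| of z : R[i] lives in R[i]; this is the modulus as a real. *)
Definition cmod (R : realType) (z : R[i]) : R := ComplexField.Normc.normc z.

(* Equivalent to Borel measurability for the identification of R[i] with R^2,
   since the Borel sigma-algebra of R^2 is the product one. *)
Definition cmeasurable (R : realType) d (T : measurableType d) (f : T -> R[i]) :=
  measurable_fun setT (fun x => complex.Re (f x)) /\
  measurable_fun setT (fun x => complex.Im (f x)).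

Definition cbounded (R : realType) (T : Type) (f : T -> R[i]) :=
  exists M : R, forall x, cmod (f x) <= M.

Definition supnorm (R : realType) (T : Type) (f : T -> R[i]) : \bar R :=
  ereal_sup [set (cmod (f x))%:E | x in [set: T]].

Definition cLnorm (R : realType) d (T : measurableType d)
    (mu : {measure set T -> \bar R}) (p : R) (f : T -> R[i]) : \bar R :=
  Lnorm mu p%:E (fun x => (cmod (f x))%:E).

Definition lin_comb (R : realType) (T : Type) (N : nat) (phi : 'I_N -> T -> R[i])
    (a : 'I_N -> R[i]) : T -> R[i] :=
  fun x => \sum_(j < N) a j * phi j x.

Definition one_sided_sparse_Riesz (R : realType) d (T : measurableType d)
    (mu : {measure set T -> \bar R}) (N : nat) (phi : 'I_N -> T -> R[i])
    (v : nat) (K : R) : Prop :=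
  [/\ forall j, cmeasurable (phi j),
      forall j, cbounded (phi j),
      forall j, (supnorm (phi j) <= 1)%E &
      forall a : 'I_N -> R[i], (#|[pred j | a j != 0%R]| <= v)%N ->
        ((\sum_(j < N) cmod (a j) ^+ 2)%:E
           <= K%:E * cLnorm mu 2 (lin_comb phi a) ^+ 2)%E].

Definition span_on (R : realType) (T : Type) (N : nat) (phi : 'I_N -> T -> R[i])
    (J : {set 'I_N}) : set (T -> R[i]) :=
  [set f | exists a : 'I_N -> R[i], f = fun x => \sum_(j in J) a j * phi j x].

Definition Sigma_sparse (R : realType) (T : Type) (N : nat)
    (phi : 'I_N -> T -> R[i]) (s : nat) : set (T -> R[i]) :=
  \bigcup_(J in [set J : {set 'I_N} | #|J| = s]) span_on phi J.

Definition mutually_independent (R : realType) d d' (W : measurableType d)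
    (T : measurableType d') (P : probability W R) (I : finType)
    (X : I -> {RV P >-> T}) : Prop :=
  forall (J : {set I}) (E : I -> set T),
    (forall i, i \in J -> measurable (E i)) ->
    (P (\bigcap_(i in [set` J]) (X i @^-1` E i))
       = \prod_(i in J) P (X i @^-1` E i))%E.

Definition discretizes (R : realType) d (T : measurableType d)
    (mu : {measure set T -> \bar R}) (p eps : R) (m : nat) (x : 'I_m -> T)
    (F : set (T -> R[i])) : Prop :=
  forall f, F f ->
    ((1 - eps)%:E * cLnorm mu p f `^ p
       <= (m%:R^-1 * \sum_(j < m) cmod (f (x j)) `^ p)%:E
       <= (1 + eps)%:E * cLnorm mu p f `^ p)%E.

(* Main.v *)
(* Chaining along nets that do not depend on the sample.  Put [Q = K * s] and
   [lev i = (Q / 2 ^ i) ^ (1 / p)].  The Riesz condition bounds the sup norm and the l1 norm of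
   the coefficients of every [f] in the L_p unit ball of Sigma_s by [lev 0].  Maurey's empirical
   method produces, by induction on [i], a family of at most [(4 N + 1) ^ (k 2 ^ i)] functions
   which approximates every such [f] within [lev i] outside a set of measure [eta], for any given
   probability measure; used for the average of mu and of an empirical measure, one member of
   the family is good for both, so that no symmetrization is needed.  Telescoping [|f| ^ p] along
   the levels leaves increments whose squares, divided by [lev i ^ p], sum to at most
   [O(min(log (1 / eps), log Q) |f| ^ p)], and Bernstein's inequality with a union bound over
   pairs of consecutive net points controls all increments simultaneously. *)

Require Import Defs.
From HB Require Import structures.
From mathcomp Require Import all_boot all_order all_algebra.
From mathcomp Require Import all_classical all_reals all_analysis measurable_realfun.
From mathcomp Require Import complex ring lra.

Set Implicit Arguments.
Unset Strict Implicit.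
Unset Printing Implicit Defensive.

Import Order.TTheory GRing.Theory Num.Theory.
Import numFieldNormedType.Exports.

Local Open Scope classical_set_scope.
Local Open Scope ring_scope.

(** The exceptional sets are harmless because all functions involved are polynomially bounded in
    [Q / eps]: the choice [eta = (eps / Q) ^+ 8] makes their contribution negligible, at the price
    of a factor [ln (Q / eps)] in the number of atoms per step. Halving [lev i ^ p] balances the
    levels: the entropy at level [i] is proportional to [2 ^ i], Bernstein's inequality is used with
    the parameter [kap / lev i ^ p], and the resulting deviation, of order
    [2 ^ i * lev i ^ p / (kap * m)], is the same at every level. The doubling of the entropy stops
    once [2 ^ I] reaches [s]; there a grid on the coefficients gives a uniform approximation with
    entropy of order [s] up to a logarithm, and closes the chain. With [a = ln (1 / eps)] and
    [q = ln Q], the entropy carries the factor [a + q] and the variance the factor [min (a, q)].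
    Their product is at most [2 * a * q]: this is how the two logarithms enter the sample size, next
    to [ln N] from the choice of atoms and [ln s] from the number of levels. *)

Section bounded_measurable.
Context (R : realType) d (T : measurableType d).
Implicit Types f g : T -> R.

(** All integration takes place in this class: it is closed under the operations below, and
    integrals are finite on it, so that inequalities live in [R] and not in the extended reals. *)
Definition bm f := measurable_fun setT f /\ exists M : R, forall x, `|f x| <= M.

Lemma bm_cst (c : R) : bm (fun=> c).
Proof. by split; [exact: measurable_cst|exists `|c|]. Qed.

Lemma bmD f g : bm f -> bm g -> bm (fun x => f x + g x).
Proof.
move=> [mf [M fM]] [mg [N gN]]; split; first exact: measurable_funD.
by exists (M + N) => x; rewrite (le_trans (ler_normD _ _))// lerD.
Qed.

Lemma bmM f g : bm f -> bm g -> bm (fun x => f x * g x).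
Proof.
move=> [mf [M fM]] [mg [N gN]]; split; first exact: measurable_funM.
by exists (M * N) => x; rewrite normrM ler_pM.
Qed.

Lemma bmZ (c : R) f : bm f -> bm (fun x => c * f x).
Proof. by move=> mf; apply: bmM => //; exact: bm_cst. Qed.

Lemma bmN f : bm f -> bm (fun x => - f x).
Proof. by move=> /(bmZ (-1)); under eq_fun do rewrite mulN1r. Qed.

Lemma bmB f g : bm f -> bm g -> bm (fun x => f x - g x).
Proof. by move=> mf mg; apply: bmD => //; exact: bmN. Qed.

Lemma bm_sum (I : Type) (r : seq I) (P : pred I) (F : I -> T -> R) :
  (forall i, P i -> bm (F i)) -> bm (fun x => \sum_(i <- r | P i) F i x).
Proof.
move=> mF; elim: r => [|i r IHr].
  by under eq_fun do rewrite big_nil; exact: bm_cst.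
under eq_fun do rewrite big_cons; case Pi: (P i) => //.
exact: bmD (mF _ Pi) IHr.
Qed.

Lemma bm_prod (I : Type) (r : seq I) (P : pred I) (F : I -> T -> R) :
  (forall i, P i -> bm (F i)) -> bm (fun x => \prod_(i <- r | P i) F i x).
Proof.
move=> mF; elim: r => [|i r IHr].
  by under eq_fun do rewrite big_nil; exact: bm_cst.
under eq_fun do rewrite big_cons; case Pi: (P i) => //.
exact: bmM (mF _ Pi) IHr.
Qed.

Lemma bm_bool (b : T -> bool) : measurable_fun setT b -> bm (fun x => (b x)%:R).
Proof.
move=> mb; split; last first.
  by exists 1 => x; case: (b x); rewrite ?normr1// normr0.
rewrite (_ : (fun _ => _) = fun x => if b x then 1 else 0); last first.
  by apply/funext => x; case: (b x).
by apply: measurable_fun_ifT => //; exact: measurable_cst.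
Qed.

Lemma bm_indic (A : set T) : measurable A -> bm (\1_A : T -> R).
Proof.
move=> mA; split; first exact: measurable_indic.
by exists 1 => x; rewrite indicE; case: (_ \in _); rewrite ?normr1// normr0.
Qed.

Lemma bm_expR f : bm f -> bm (fun x => expR (f x)).
Proof.
move=> [mf [M fM]]; split; first exact: measurableT_comp.
exists (expR M) => x; rewrite ger0_norm ?expR_ge0// ler_expR.
exact: le_trans (ler_norm _) (fM x).
Qed.

Lemma bm_powR f (p : R) : 0 <= p -> bm f -> (forall x, 0 <= f x) ->
  bm (fun x => f x `^ p).
Proof.
move=> p0 [mf [M fM]] f0; split.
  by apply: (measurableT_comp (measurable_powR _)).
exists (M `^ p) => x; rewrite ger0_norm ?powR_ge0//.
apply: ge0_ler_powR; rewrite ?nnegrE//.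
  exact: le_trans (normr_ge0 _) (fM x).
exact: le_trans (ler_norm _) (fM x).
Qed.

Lemma bm_max f g : bm f -> bm g -> bm (fun x => Num.max (f x) (g x)).
Proof.
move=> [mf [M fM]] [mg [N gN]]; split; first exact: measurable_maxr.
exists (Num.max M N) => x; rewrite maxEle; case: ifP => _.
  by rewrite (le_trans (gN x))// le_max lexx orbT.
by rewrite (le_trans (fM x))// le_max lexx.
Qed.

Lemma bm_sqrt f : bm f -> (forall x, 0 <= f x) -> bm (fun x => Num.sqrt (f x)).
Proof.
move=> mf f0; under eq_fun do rewrite -powR12_sqrt//.
by apply: bm_powR => //; rewrite invr_ge0.
Qed.

Lemma bm_norm f : bm f -> bm (fun x => `|f x|).
Proof.
move=> [mf [M fM]]; split; first exact: measurableT_comp.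
by exists M => x; rewrite normr_id.
Qed.

(* Stands for the integrals against mu, the law of the sample and the empirical measures alike. *)
Record poslin (L : (T -> R) -> R) : Prop := Poslin {
  poslinD : forall f g, bm f -> bm g -> L (fun x => f x + g x) = L f + L g ;
  poslinZ : forall c f, bm f -> L (fun x => c * f x) = c * L f ;
  poslin_le : forall f g, bm f -> bm g -> (forall x, f x <= g x) -> L f <= L g }.

Section poslin_theory.
Context (L : (T -> R) -> R) (HL : poslin L).

Lemma poslin0 : L (fun=> 0) = 0.
Proof.
rewrite (_ : (fun=> 0) = fun x : T => 0 * (fun=> 0 : R) x); last first.
  by apply/funext => x; rewrite mul0r.
by rewrite (poslinZ HL) ?mul0r//; exact: bm_cst.
Qed.

Lemma poslin_ge0 f : bm f -> (forall x, 0 <= f x) -> 0 <= L f.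
Proof. by move=> mf f0; rewrite -poslin0 (poslin_le HL)//; exact: bm_cst. Qed.

Lemma poslinN f : bm f -> L (fun x => - f x) = - L f.
Proof.
by move=> mf; rewrite -mulN1r -(poslinZ HL)//; under eq_fun do rewrite -mulN1r.
Qed.

Lemma poslinB f g : bm f -> bm g -> L (fun x => f x - g x) = L f - L g.
Proof.
by move=> mf mg; rewrite (poslinD HL)// ?poslinN//; exact: bmN.
Qed.

Lemma poslin_sum (I : Type) (r : seq I) (P : pred I) (F : I -> T -> R) :
  (forall i, P i -> bm (F i)) ->
  L (fun x => \sum_(i <- r | P i) F i x) = \sum_(i <- r | P i) L (F i).
Proof.
move=> mF; elim: r => [|i r IHr].
  by under eq_fun do rewrite big_nil; rewrite big_nil poslin0.
under eq_fun do rewrite big_cons; rewrite big_cons; case Pi: (P i) => //.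
by rewrite (poslinD HL) ?IHr//; [exact: mF|exact: bm_sum].
Qed.

Lemma poslin_norm f g : bm f -> bm g -> (forall x, `|f x| <= g x) -> `|L f| <= L g.
Proof.
move=> mf mg fg; rewrite ler_norml -poslinN// !(poslin_le HL)//.
- by move=> x; rewrite (le_trans (ler_norm _)).
- exact: bmN.
- by move=> x; rewrite lerNl (le_trans _ (fg x))// -normrN ler_norm.
Qed.

End poslin_theory.

End bounded_measurable.

(** * Positive functionals are determined by indicators *)

Lemma layer_cake (R : realDomainType) (t y : R) (n : nat) :
  0 < t -> 0 <= y < t * n.+1%:R ->
  0 <= y - \sum_(k < n) t * (t * k.+1%:R <= y)%R%:R <= t.
Proof.
move=> t0; elim: n => [|n IHn] /andP[y0 yn].
  by rewrite big_ord0 subr0 y0/= ltW// -[ltRHS]mulr1.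
rewrite big_ord_recr/=; have [ny|] := leP (t * n.+1%:R) y; last first.
  by move=> yn'; rewrite mulr0 addr0 IHn// y0.
rewrite (eq_bigr (fun=> t)) => [|i _]; last first.
  rewrite (le_trans _ ny) ?mulr1// ler_pM2l// ler_nat.
  exact: leq_trans (ltn_ord i) _.
rewrite mulr1 sumr_const card_ord -mulrSr -mulr_natr subr_ge0 ny/= lerBlDl.
by rewrite (le_trans (ltW yn))// -[in leLHS]natr1 mulrDr mulr1.
Qed.

Section poslin_extensionality.
Context (R : realType) d (T : measurableType d).

(** Staircase approximation with step [e]: the sum is [e] times the integer part of [f x / e], and
    [n] thresholds suffice as soon as [f] stays below [e * n.+1]. *)
Lemma bm_approx (f : T -> R) (e : R) : bm f -> (forall x, 0 <= f x) -> 0 < e ->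
  exists (n : nat) (t : R) (E : 'I_n -> set T), [/\ 0 < t,
    forall k, measurable (E k) &
    forall x, `|f x - \sum_(k < n) t * \1_(E k) x| <= e].
Proof.
move=> [mf [M fM]] f0 e0.
have [n nM] : exists n : nat, M < e * n.+1%:R.
  exists (Num.truncn (M / e)); rewrite mulrC -ltr_pdivrMr//.
  exact: truncnS_gt.
exists n, e, (fun k : 'I_n => [set x | e * k.+1%:R <= f x]); split => //.
  move=> k; rewrite -[X in measurable X]setTI.
  rewrite (_ : [set x | _] = f @^-1` `[e * k.+1%:R, +oo[).
    by apply: mf => //; exact: measurable_itv.
  by apply/seteqP; split => x /=; rewrite in_itv/= andbT.
move=> x; have := @layer_cake _ e (f x) n e0.
rewrite f0 (le_lt_trans (le_trans (ler_norm _) (fM x)) nM) => /(_ isT).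
rewrite (eq_bigr (fun k : 'I_n => e * \1_[set x | e * k.+1%:R <= f x] x)).
  by move=> /andP[? ?]; rewrite ger0_norm.
move=> k _; rewrite indicE; congr (_ * _%:R); congr nat_of_bool.
by apply/idP/idP => [h|]; rewrite ?inE//=.
Qed.

(** Stands in for the monotone class theorem. By positivity a uniform error [e] in [f] costs at most
    [e * L (fun=> 1)], so the staircase approximation carries equality from indicators to
    nonnegative [f], and then to differences. *)
Lemma poslin_ext (L1 L2 : (T -> R) -> R) : poslin L1 -> poslin L2 ->
  (forall A, measurable A -> L1 (\1_A) = L2 (\1_A)) ->
  forall f, bm f -> L1 f = L2 f.
Proof.
move=> H1 H2 H12.
have pos f : bm f -> (forall x, 0 <= f x) -> L1 f = L2 f.
  move=> mf f0; apply/eqP; rewrite -subr_eq0 -normr_le0.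
  set K := L1 (fun=> 1) + L2 (fun=> 1).
  have K0 : 0 <= K by rewrite addr_ge0// poslin_ge0//; exact: bm_cst.
  apply/ler_addgt0Pr => e e0; rewrite add0r.
  (* The [+ 1] avoids a division by 0 when both functionals vanish on constants. *)
  have e1 : 0 < e / (K + 1) by rewrite divr_gt0// ltr_wpDl.
  have [n [t [E [t0 mE fE]]]] := bm_approx mf f0 e1.
  pose g x := \sum_(k < n) t * \1_(E k) x.
  have mg : bm g by apply: bm_sum => k _; apply/bmZ/bm_indic/mE.
  have g12 : L1 g = L2 g.
    rewrite /g !poslin_sum//; try by move=> k _; apply/bmZ/bm_indic/mE.
    apply: eq_bigr => k _; rewrite !poslinZ ?H12//; exact/bm_indic/mE.
  have H L : poslin L -> `|L f - L g| <= e / (K + 1) * L (fun=> 1).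
    move=> HL; rewrite -poslinB// -(poslinZ HL); last exact: bm_cst.
    apply: poslin_norm => //; [exact: bmB|apply/bmZ/bm_cst|].
    by move=> x; rewrite mulr1 fE.
  rewrite (_ : L1 f - L2 f = (L1 f - L1 g) - (L2 f - L2 g)); last first.
    by rewrite g12; ring.
  rewrite (le_trans (ler_normB _ _))// (le_trans (lerD (H _ H1) (H _ H2)))//.
  rewrite -mulrDr -/K mulrAC ler_pdivrMr ?ltr_wpDl// ler_pM2l//.
  by rewrite lerDl.
move=> f mf.
have -> : f = fun x => Num.max (f x) 0 - Num.max (- f x) 0.
  apply/funext => x; rewrite !maxEle.
  by case: (leP (f x) 0) => ?; case: (leP (- f x) 0) => ?; lra.
have m1 : bm (fun x => Num.max (f x) 0) by apply: bm_max => //; exact: bm_cst.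
have m2 : bm (fun x => Num.max (- f x) 0).
  by apply: bm_max; [exact: bmN|exact: bm_cst].
by rewrite !poslinB// !pos// => x; rewrite le_max lexx orbT.
Qed.

End poslin_extensionality.

(** * Real-valued expectation *)

Section expectation.
Context (R : realType) d (T : measurableType d) (mu : probability T R).
Implicit Types f g : T -> R.

Lemma bm_integrable f : bm f -> mu.-integrable setT (EFin \o f).
Proof.
move=> [mf [M fM]]; apply: measurable_bounded_integrable => //.
  by rewrite (le_lt_trans (probability_le1 _ _))// ltry.
exists M; split; first exact: num_real.
by move=> N MN x _ /=; rewrite (le_trans (fM x))// ltW.
Qed.

Definition mean f : R := Rintegral mu setT f.

Lemma EFin_mean f : bm f -> (mean f)%:E = (\int[mu]_x (f x)%:E)%E.
Proof.
move=> mf; rewrite /mean /Rintegral fineK//.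
by apply: integrable_fin_num => //; exact: bm_integrable.
Qed.

Lemma poslin_mean : poslin mean.
Proof.
split => [f g mf mg|c f mf|f g mf mg fg]; rewrite /mean.
- by rewrite RintegralD//; exact: bm_integrable.
- by rewrite RintegralZl//; exact: bm_integrable.
- by apply: le_Rintegral => //; exact: bm_integrable.
Qed.

Lemma mean1 : mean (fun=> 1) = 1.
Proof. by rewrite /mean Rintegral_cst//= mul1r probability_setT. Qed.

Lemma mean_indic A : measurable A -> (mean \1_A)%:E = mu A.
Proof.
by move=> mA; rewrite EFin_mean ?integral_indic ?setIT//; exact: bm_indic.
Qed.

End expectation.

(** From [1 - x / 2 <= expR (- (x / 2))] one gets [expR x <= (1 - x / 2) ^- 2], and
    [(1 - x / 2) ^+ 2 * (1 + x + 2 * x ^+ 2)] exceeds 1 by [x ^+ 2 * (1 - x) * (5 / 2 - x) / 2],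
    which is nonnegative for [x <= 1]. *)
Lemma expR_le1Dx2 (R : realType) (x : R) : x <= 1 -> expR x <= 1 + x + 2 * x ^+ 2.
Proof.
move=> x1; have h : 1 - x / 2 <= expR (- (x / 2)) by exact: expR_ge1Dx.
have h0 : 0 < 1 - x / 2 by lra.
have q0 : 0 < 1 + x + 2 * x ^+ 2 by nra.
rewrite -[x in expR x]opprK expRN (_ : - x = - (x / 2) + - (x / 2)); last by lra.
rewrite expRD -[leRHS]invrK lef_pV2 ?posrE ?invr_gt0 ?mulr_gt0 ?expR_gt0//.
apply: le_trans (_ : (1 - x / 2) * (1 - x / 2) <= _); last by rewrite ler_pM// ltW.
rewrite -div1r ler_pdivrMr//.
have : 0 <= x ^+ 2 * ((1 - x) * (5 / 2 - x)).
  by rewrite mulr_ge0 ?sqr_ge0// mulr_ge0; lra.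
nra.
Qed.

(** * Independence for products of functions *)

Section independence.
Context (R : realType) d d' (W : measurableType d') (T : measurableType d)
  (P : probability W R).

Lemma bm_RV (X : {RV P >-> T}) (g : T -> R) : bm g -> bm (fun w => g (X w)).
Proof.
move=> [mg [M gM]]; split; last by exists M.
by apply: measurableT_comp => //; exact: measurable_funP.
Qed.

Lemma mean_RV_indic (X : {RV P >-> T}) (A : set T) : measurable A ->
  (mean P (fun w => \1_A (X w)))%:E = P (X @^-1` A).
Proof.
move=> mA; rewrite -mean_indic; last first.
  by rewrite -[X in measurable X]setTI; exact: measurable_funP.
by congr (_%:E); congr (mean P _); apply/funext => w; rewrite !indicE.
Qed.

(** Indicators are traded for general functions one index at a time; outside the list [s] the
    functions are still indicators. With the other factors fixed, both sides are functionals of the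
    [i]-th function that agree on indicators by induction, hence everywhere by [poslin_ext].
    Nonnegativity of the other factors makes these functionals positive. *)
Lemma independent_mean_prod (I : finType) (X : I -> {RV P >-> T}) (g : I -> T -> R) :
  mutually_independent X -> (forall i, bm (g i)) -> (forall i x, 0 <= g i x) ->
  mean P (fun w => \prod_i g i (X i w)) = \prod_i mean P (fun w => g i (X i w)).
Proof.
move=> indX.
suff H (s : seq I) : (forall i, bm (g i)) -> (forall i x, 0 <= g i x) ->
    (forall i, i \notin s -> exists2 A, measurable A & g i = \1_A) ->
    mean P (fun w => \prod_i g i (X i w)) = \prod_i mean P (fun w => g i (X i w)).
  by move=> mg g0; apply: (H (enum I)) => // i; rewrite mem_enum.
elim: s g => [|i s IHs] g mg g0 gs.
  have /choice[A HA] i : exists A, measurable A /\ g i = \1_A.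
    by have [|A mA gA] := gs i; [rewrite in_nil|exists A].
  apply: EFin_inj; rewrite -prodEFin.
  rewrite (eq_bigr (fun i => P (X i @^-1` A i))) => [|i _]; last first.
    by have [mA ->] := HA i; rewrite mean_RV_indic.
  have := indX [set: I]%SET A (fun i _ => (HA i).1).
  under [X in _ = X -> _]eq_bigl do rewrite finset.in_setT.
  move=> <-; rewrite -mean_indic; last first.
    apply: fin_bigcap_measurable => // i _.
    by rewrite -[X in measurable X]setTI; apply: measurable_funP => //; exact: (HA i).1.
  congr (_%:E); congr (mean P _); apply/funext => w; rewrite indicE.
  have [wA|wA] := boolP (w \in _).
    rewrite big1// => j _; rewrite (HA j).2 indicE mem_set//.
    by move: wA; rewrite inE => /(_ j); apply; rewrite /= finset.in_setT.
  have [j jA] : exists j, ~ A j (X j w).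
    apply/existsNP => wAj; move/negP: wA; apply; rewrite inE => j _; exact: wAj.
  by rewrite (bigD1 j)//= (HA j).2 indicE memNset// mul0r.
(* [h u] has [u] in place [i]; when [u] is an indicator, the induction hypothesis applies to it. *)
pose h (u : T -> R) j := if j == i then u else g j.
have hb u : bm u -> forall j, bm (h u j) by move=> mu j; rewrite /h; case: eqP.
pose B w := \prod_(j | j != i) g j (X j w).
have B0 w : 0 <= B w by exact: prodr_ge0.
have mB : bm B by apply: bm_prod => j _; exact: bm_RV.
pose b := \prod_(j | j != i) mean P (fun w => g j (X j w)).
have b0 : 0 <= b.
  by apply: prodr_ge0 => j _; apply: (poslin_ge0 (poslin_mean P)) => //; exact: bm_RV.
have HP := poslin_mean P.
rewrite (bigD1 i)//= -/b.
under eq_fun do rewrite (bigD1 i)//= -/(B _).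
apply: (@poslin_ext _ _ _ (fun u => mean P (fun w => u (X i w) * B w))
  (fun u => mean P (fun w => u (X i w)) * b)) => //.
- split.
  + move=> u v mu mv; rewrite -(poslinD HP); [|exact/bmM/mB/bm_RV..].
    by congr (mean P _); apply/funext => w; rewrite mulrDl.
  + move=> c u mu; rewrite -(poslinZ HP); last exact/bmM/mB/bm_RV.
    by congr (mean P _); apply/funext => w; rewrite mulrA.
  + move=> u v mu mv uv; apply: (poslin_le HP); [exact/bmM/mB/bm_RV..|].
    by move=> w; rewrite ler_wpM2r.
- split.
  + by move=> u v mu mv; rewrite -mulrDl -(poslinD HP)//; exact: bm_RV.
  + by move=> c u mu; rewrite mulrA -(poslinZ HP)//; exact: bm_RV.
  + move=> u v mu mv uv; rewrite ler_wpM2r//; apply: (poslin_le HP) => //; exact: bm_RV.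
move=> A mA; have mA1 : bm (\1_A : T -> R) by exact: bm_indic.
have E : mean P (fun w => \prod_j h \1_A j (X j w)) =
         \prod_j mean P (fun w => h \1_A j (X j w)).
  apply: IHs => [|j x|j js]; first exact: hb.
    by rewrite /h; case: eqP => // _; rewrite indicE.
  rewrite /h; case: eqP => [_|/eqP ji]; first by exists A.
  by apply: gs; rewrite inE negb_or ji.
rewrite [RHS](bigD1 i)//= [h _ i]/h eqxx in E.
rewrite [X in _ = _ * X](eq_bigr (fun j => mean P (fun w => g j (X j w)))) in E; last first.
  by move=> j /negbTE ji; rewrite /h ji.
rewrite -{}E.
congr (mean P _); apply/funext => w; rewrite (bigD1 i)//= /h eqxx; congr (_ * _).
by apply: eq_bigr => j /negbTE ->.
Qed.

End independence.

(** * Exponential moments and Bernstein's inequality *)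

Section Bernstein.
Context (R : realType) d d' (T : measurableType d) (mu : probability T R)
  (W : measurableType d') (P : probability W R) (m : nat) (xi : 'I_m -> {RV P >-> T}).
Hypothesis m0 : (0 < m)%N.
Hypothesis indxi : mutually_independent xi.
Hypothesis muxi : forall E : set T, measurable E ->
  mu E = ((m%:R^-1)%:E * \sum_(j < m) P (xi j @^-1` E))%E.

(** The averaging hypothesis on [mu], extended from events to functions. Bernstein's inequality sees
    the laws of the points only through such sums of first and second moments, so they may differ
    from one another. *)
Lemma sum_mean_RV (g : T -> R) : bm g ->
  \sum_(j < m) mean P (fun w => g (xi j w)) = m%:R * mean mu g.
Proof.
have HP := poslin_mean P.
apply: (@poslin_ext _ _ _ (fun u => \sum_(j < m) mean P (fun w => u (xi j w)))
  (fun u => m%:R * mean mu u)) => //.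
- split.
  + move=> u v mu' mv; rewrite -big_split/=; apply: eq_bigr => j _.
    by rewrite (poslinD HP)//; exact: bm_RV.
  + move=> c u mu'; rewrite mulr_sumr; apply: eq_bigr => j _.
    by rewrite (poslinZ HP)//; exact: bm_RV.
  + move=> u v mu' mv uv; apply: ler_sum => j _; apply: (poslin_le HP) => //; exact: bm_RV.
- have Hm := poslin_mean mu; split.
  + by move=> u v mu' mv; rewrite (poslinD Hm)// mulrDr.
  + by move=> c u mu'; rewrite (poslinZ Hm)// mulrCA.
  + by move=> u v mu' mv uv; rewrite ler_wpM2l// (poslin_le Hm).
move=> A mA; apply: EFin_inj; rewrite EFinM mean_indic// muxi// muleA -EFinM.
rewrite mulfV ?pnatr_eq0 -?lt0n// mul1e -sumEFin; apply: eq_bigr => j _.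
exact: mean_RV_indic.
Qed.

(** Independence factors the expectation. Each factor is at most [1 + x <= expR x], where [x]
    collects a first and a second moment, and [sum_mean_RV] turns the sums of these moments into
    integrals against [mu]. *)
Lemma mean_expR_sum_le (h : T -> R) (k : R) : bm h -> (forall x, k * h x <= 1) ->
  mean P (fun w => expR (k * \sum_(j < m) h (xi j w))) <=
  expR (k * (m%:R * mean mu h) + 2 * k ^+ 2 * (m%:R * mean mu (fun x => h x ^+ 2))).
Proof.
move=> mh kh; have HP := poslin_mean P.
have mh2 : bm (fun x => h x ^+ 2) by under eq_fun do rewrite expr2; exact: bmM.
have -> : (fun w => expR (k * \sum_(j < m) h (xi j w))) =
          (fun w => \prod_(j < m) expR (k * h (xi j w))).
  by apply/funext => w; rewrite mulr_sumr expR_sum.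
rewrite (independent_mean_prod (g := fun _ x => expR (k * h x)))//; last first.
  by move=> _; exact/bm_expR/bmZ.
rewrite -!sum_mean_RV// !mulr_sumr -big_split/= expR_sum.
apply: ler_prod => j _; apply/andP; split.
  apply: (poslin_ge0 HP) => [|w]; last exact: expR_ge0.
  by apply: (@bm_RV _ _ _ _ _ _ _ (fun x => expR (k * h x))); exact/bm_expR/bmZ.
have mhj := bm_RV (xi j) mh; have mh2j := bm_RV (xi j) mh2.
apply: le_trans (expR_ge1Dx _).
have m1 := bm_cst W (1 : R).
rewrite -[X in X + _](mean1 P) -!(poslinZ HP)// -!(poslinD HP)//; try by do ?[apply: bmD|apply: bmZ].
apply: (poslin_le HP) => [||w].
- by apply: (@bm_RV _ _ _ _ _ _ _ (fun x => expR (k * h x))); exact/bm_expR/bmZ.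
- by do ?[apply: bmD|apply: bmZ].
by rewrite (le_trans (expR_le1Dx2 (kh _)))// exprMn addrA mulrA.
Qed.

(* Linear in the variance: the free parameter [k] replaces the usual square root. *)
Lemma Bernstein (h : T -> R) (k t : R) : bm h -> 0 < k -> (forall x, k * h x <= 1) ->
  let A := [set w | \sum_(j < m) h (xi j w) > m%:R * mean mu h
     + 2 * k * (m%:R * mean mu (fun x => h x ^+ 2)) + t / k] in
  measurable A /\ (P A <= (expR (- t))%:E)%E.
Proof.
move=> mh k0 kh; set c := _ + _ + _; move=> A; have HP := poslin_mean P.
have mS : bm (fun w => \sum_(j < m) h (xi j w)) by apply: bm_sum => j _; exact: bm_RV.
have mA : measurable A.
  rewrite -[A]setTI (_ : A = (fun w => \sum_(j < m) h (xi j w)) @^-1` `]c, +oo[).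
    by apply: mS.1 => //; exact: measurable_itv.
  by apply/seteqP; split => w; rewrite /A/= in_itv/= andbT.
split => //; rewrite -mean_indic// lee_fin.
have mE : bm (fun w => expR (k * \sum_(j < m) h (xi j w))) by exact/bm_expR/bmZ.
(* Markov's inequality: the indicator of [A] is at most [expR (k * (S - c))], with [S] the sum over
   the sample. *)
apply: (@le_trans _ _ (mean P (fun w => expR (- (k * c)) *
   expR (k * \sum_(j < m) h (xi j w))))).
  apply: (poslin_le HP); [exact: bm_indic|exact: bmZ|move=> w].
  rewrite indicE; case: (boolP (w \in A)) => [|_]; last by rewrite mulr_ge0// expR_ge0.
  rewrite inE/= => wA; rewrite -expRD -expR0 ler_expR addrC subr_ge0.
  by rewrite ler_pM2l// ltW.
rewrite (poslinZ HP)//; apply: le_trans (ler_wpM2l (expR_ge0 _) (mean_expR_sum_le mh kh)) _.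
rewrite -expRD ler_expR /c !mulrDr; have -> : k * (t / k) = t by field; rewrite gt_eqF.
lra.
Qed.

End Bernstein.

(** * Modulus and integrals of complex functions *)

Section complex_functions.
Context (R : realType).
Implicit Types z w : R[i].

Lemma cmodE z : cmod z = Num.sqrt (complex.Re z ^+ 2 + complex.Im z ^+ 2).
Proof. by case: z. Qed.

Lemma cmod_ge0 z : 0 <= cmod z.
Proof. by rewrite cmodE sqrtr_ge0. Qed.

Lemma cmod0 : cmod (0 : R[i]) = 0.
Proof. exact: ComplexField.Normc.normc0. Qed.

Lemma cmodD z w : cmod (z + w) <= cmod z + cmod w.
Proof. exact: le_normcD. Qed.

Lemma cmodN z : cmod (- z) = cmod z.
Proof. exact: normcN. Qed.

Lemma cmodM z w : cmod (z * w) = cmod z * cmod w.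
Proof. exact: ComplexField.Normc.normcM. Qed.

Lemma cmod_distC z w : cmod (z - w) = cmod (w - z).
Proof. by rewrite -cmodN opprB. Qed.

Lemma cmod_dist z w : `|cmod z - cmod w| <= cmod (z - w).
Proof.
rewrite ler_norml; apply/andP; split.
  by rewrite lerBrDl lerBlDr -{1}(subrK z w) cmod_distC addrC cmodD.
by rewrite lerBlDr -{1}(subrK w z) cmodD.
Qed.

Lemma cmod_sum (I : Type) (r : seq I) (P : pred I) (F : I -> R[i]) :
  cmod (\sum_(i <- r | P i) F i) <= \sum_(i <- r | P i) cmod (F i).
Proof.
elim/big_rec2: _ => [|i y z _ h]; first by rewrite cmod0.
by rewrite (le_trans (cmodD _ _))// lerD2l.
Qed.

Lemma cmod_real (x : R) : cmod (x%:C)%C = `|x|.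
Proof. by rewrite cmodE/= expr0n addr0 sqrtr_sqr. Qed.

Lemma ReD z w : complex.Re (z + w) = complex.Re z + complex.Re w.
Proof. by case: z; case: w. Qed.

Lemma ImD z w : complex.Im (z + w) = complex.Im z + complex.Im w.
Proof. by case: z; case: w. Qed.

Lemma ReN z : complex.Re (- z) = - complex.Re z.
Proof. by case: z. Qed.

Lemma ImN z : complex.Im (- z) = - complex.Im z.
Proof. by case: z. Qed.

Lemma ReM z w : complex.Re (z * w) =
  complex.Re z * complex.Re w - complex.Im z * complex.Im w.
Proof. by case: z; case: w. Qed.

Lemma ImM z w : complex.Im (z * w) =
  complex.Re z * complex.Im w + complex.Im z * complex.Re w.
Proof. by case: z; case: w => ? ? ? ? /=; rewrite addrC. Qed.

Lemma Re_sum (I : Type) (r : seq I) (P : pred I) (F : I -> R[i]) :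
  complex.Re (\sum_(i <- r | P i) F i) = \sum_(i <- r | P i) complex.Re (F i).
Proof. by elim/big_rec2: _ => // i y z _ <-; rewrite ReD. Qed.

Lemma Im_sum (I : Type) (r : seq I) (P : pred I) (F : I -> R[i]) :
  complex.Im (\sum_(i <- r | P i) F i) = \sum_(i <- r | P i) complex.Im (F i).
Proof. by elim/big_rec2: _ => // i y z _ <-; rewrite ImD. Qed.

Lemma normRe_le z : `|complex.Re z| <= cmod z.
Proof. by rewrite cmodE -sqrtr_sqr ler_wsqrtr// lerDl sqr_ge0. Qed.

Lemma normIm_le z : `|complex.Im z| <= cmod z.
Proof. by rewrite cmodE -sqrtr_sqr ler_wsqrtr// lerDr sqr_ge0. Qed.

Lemma cmod_le z : cmod z <= `|complex.Re z| + `|complex.Im z|.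
Proof.
rewrite cmodE -[leRHS]ger0_norm ?addr_ge0// -sqrtr_sqr ler_wsqrtr//.
rewrite sqrrD !real_normK ?num_real// addrAC lerDl.
by rewrite mulrn_wge0// mulr_ge0.
Qed.

Context d (T : measurableType d).
Implicit Types f g : T -> R[i].

Definition cbm f := bm (fun x => complex.Re (f x)) /\ bm (fun x => complex.Im (f x)).

Lemma cbmP f : cmeasurable f -> cbounded f -> cbm f.
Proof.
move=> [mr mi] [M fM]; split; split => //; exists M => x.
  exact: le_trans (normRe_le _) (fM x).
exact: le_trans (normIm_le _) (fM x).
Qed.

Lemma cbm_cst (c : R[i]) : cbm (fun=> c).
Proof. by split; exact: bm_cst. Qed.

Lemma cbmD f g : cbm f -> cbm g -> cbm (fun x => f x + g x).
Proof.
move=> [? ?] [? ?]; split.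
  by under eq_fun do rewrite ReD; exact: bmD.
by under eq_fun do rewrite ImD; exact: bmD.
Qed.

Lemma cbmM f g : cbm f -> cbm g -> cbm (fun x => f x * g x).
Proof.
move=> [? ?] [? ?]; split.
  by under eq_fun do rewrite ReM; apply: bmB; exact: bmM.
by under eq_fun do rewrite ImM; apply: bmD; exact: bmM.
Qed.

Lemma cbmZ (c : R[i]) f : cbm f -> cbm (fun x => c * f x).
Proof. by apply: cbmM; exact: cbm_cst. Qed.

Lemma cbmB f g : cbm f -> cbm g -> cbm (fun x => f x - g x).
Proof.
move=> mf /(cbmZ (-1)); under eq_fun do rewrite mulN1r; exact: cbmD.
Qed.

Lemma cbm_sum (I : Type) (r : seq I) (P : pred I) (F : I -> T -> R[i]) :
  (forall i, P i -> cbm (F i)) -> cbm (fun x => \sum_(i <- r | P i) F i x).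
Proof.
move=> mF; split.
  by under eq_fun do rewrite Re_sum; apply: bm_sum => i Pi; exact: (mF i Pi).1.
by under eq_fun do rewrite Im_sum; apply: bm_sum => i Pi; exact: (mF i Pi).2.
Qed.

Lemma bm_cmod f : cbm f -> bm (fun x => cmod (f x)).
Proof.
move=> [mr mi]; under eq_fun do rewrite cmodE !expr2.
by apply: bm_sqrt => [|x]; [apply: bmD; exact: bmM|rewrite addr_ge0// -expr2 sqr_ge0].
Qed.

Lemma bm_cmod_powR f (p : R) : 0 <= p -> cbm f -> bm (fun x => cmod (f x) `^ p).
Proof. by move=> p0 mf; apply: bm_powR => // [|x]; [exact: bm_cmod|exact: cmod_ge0]. Qed.

Lemma bm_cmod_gt f (t : R) : cbm f -> bm (fun x => (t < cmod (f x))%R%:R : R).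
Proof.
move=> mf; apply: bm_bool; apply: measurable_fun_ltr => //.
by have [] := bm_cmod mf.
Qed.

Lemma cLnorm_powR (mu : probability T R) (p : R) f : 0 < p -> cbm f ->
  (cLnorm mu p f `^ p)%E = (mean mu (fun x => cmod (f x) `^ p))%:E.
Proof.
move=> p0 mf; rewrite /cLnorm poweR_Lnorm ?gt_eqF// EFin_mean; last first.
  exact: bm_cmod_powR (ltW p0) mf.
by apply: eq_integral => x _; rewrite /= ger0_norm ?cmod_ge0// poweR_EFin.
Qed.

Lemma cLnorm2_sqr (mu : probability T R) f : cbm f ->
  (cLnorm mu 2 f ^+ 2)%E = (mean mu (fun x => cmod (f x) ^+ 2))%:E.
Proof.
move=> mf; have := @cLnorm_powR mu 2 f (ltr0n _ _) mf.
have -> : mean mu (fun x => cmod (f x) `^ 2) = mean mu (fun x => cmod (f x) ^+ 2).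
  by congr (mean mu _); apply/funext => x; rewrite powR_mulrn// cmod_ge0.
have := @Lnorm_ge0 _ _ _ mu 2%:E (fun x => (cmod (f x))%:E); rewrite -/(cLnorm mu 2 f).
case: (cLnorm mu 2 f) => [r r0| |] //.
- by rewrite poweR_EFin powR_mulrn// => <-.
- by rewrite poweRyr.
Qed.

End complex_functions.

(** * Maurey's empirical method *)

Section Maurey.
Context (R : realType) d (T : measurableType d) (L : (T -> R) -> R).
Hypothesis HL : poslin L.
Hypothesis L1 : L (fun=> 1) = 1.

(* The terms of [w] are chosen greedily: in [q]-average over the next term, the sum of exponential
   moments grows by at most the factor [1 + 8 * th ^+ 2 * A ^+ 2]. *)
Lemma Maurey (D I : finType) (e : D -> I -> T -> R) (q : I -> R) (A th : R) :
  (forall d i, bm (e d i)) -> (forall d i x, `|e d i x| <= A) ->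
  (forall i, 0 <= q i) -> \sum_i q i = 1 -> 0 <= th -> 2 * A * th <= 1 ->
  forall k, exists w : k.-tuple I,
    L (fun x => \sum_d expR (th * \sum_(i <- w) (e d i x - \sum_j q j * e d j x)))
    <= #|D|%:R * (1 + 8 * th ^+ 2 * A ^+ 2) ^+ k.
Proof.
move=> me eA q0 q1 th0 Ath; pose y d x := \sum_j q j * e d j x.
have my d' : bm (y d') by apply: bm_sum => j _; exact: bmZ.
pose F (w : seq I) d x := expR (th * \sum_(i <- w) (e d i x - y d x)).
have mF w d' : bm (F w d').
  by apply/bm_expR/bmZ; apply: bm_sum => i _; exact: bmB.
have yA d' x : `|y d' x| <= A.
  rewrite (le_trans (ler_norm_sum _ _ _))// -[leRHS]mul1r -q1 mulr_suml.
  by apply: ler_sum => j _; rewrite normrM ger0_norm// ler_wpM2l.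
(* The linear term has [q]-average 0, and [|e - y| <= 2 * A] bounds the quadratic one by
   [2 * (2 * A * th) ^+ 2]. *)
have step d' x : \sum_i q i * expR (th * (e d' i x - y d' x)) <= 1 + 8 * th ^+ 2 * A ^+ 2.
  have A0 : 0 <= A by exact: le_trans (normr_ge0 _) (yA d' x).
  apply: (@le_trans _ _ (\sum_i q i * (1 + th * (e d' i x - y d' x) + 8 * th ^+ 2 * A ^+ 2))).
    apply: ler_sum => i _; rewrite ler_wpM2l//.
    have h : `|e d' i x - y d' x| <= 2 * A.
      by rewrite (le_trans (ler_normB _ _))// mulr2n mulrDl mul1r lerD.
    have h2 : `|th * (e d' i x - y d' x)| <= th * (2 * A).
      by rewrite normrM ger0_norm// ler_wpM2l.
    rewrite (le_trans (expR_le1Dx2 _))//.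
      by rewrite (le_trans (ler_norm _))// (le_trans h2)// mulrC.
    rewrite lerD2l -real_normK ?num_real// (_ : 8 * _ * _ = 2 * (th * (2 * A)) ^+ 2); last by ring.
    by rewrite ler_wpM2l// lerXn2r// ?nnegrE// mulr_ge0// mulr_ge0.
  under eq_bigr do rewrite 2!mulrDr mulr1 mulrCA mulrBr.
  rewrite !big_split/= -mulr_suml q1 mul1r -mulr_sumr big_split/= sumrN -mulr_suml q1 mul1r.
  by rewrite -/(y d' x) subrr mulr0 addr0.
elim=> [|k [w IHw]].
  exists [tuple]; rewrite expr0 mulr1.
  under eq_fun do under eq_bigr do rewrite big_nil mulr0 expR0.
  under eq_fun do rewrite sumr_const -mulr_natr mul1r -[_%:R]mulr1.
  by rewrite (poslinZ HL) ?L1 ?mulr1//; exact: bm_cst.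
pose G i x := \sum_d F (i :: w) d x.
have mG i : bm (G i) by apply: bm_sum => d' _; exact: mF.
have GE x : \sum_i q i * G i x <= (1 + 8 * th ^+ 2 * A ^+ 2) * \sum_d F w d x.
  rewrite /G; under eq_bigr do rewrite mulr_sumr.
  rewrite exchange_big/= mulr_sumr; apply: ler_sum => d' _.
  rewrite (eq_bigr (fun i => (q i * expR (th * (e d' i x - y d' x))) * F w d' x)).
    by rewrite -mulr_suml ler_wpM2r ?expR_ge0// step.
  by move=> i _; rewrite /F big_cons mulrDr expRD mulrA.
suff [i Hi] : exists i, L (G i) <= (1 + 8 * th ^+ 2 * A ^+ 2) * L (fun x => \sum_d F w d x).
  exists [tuple of i :: w]; apply: (le_trans Hi).
  set X := 1 + _ in Hi *; rewrite [X ^+ _]exprS [X in _ <= X]mulrCA ler_wpM2l//.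
  by rewrite /X addr_ge0// mulr_ge0 ?sqr_ge0// mulr_ge0 ?sqr_ge0.
(* If every choice of the next term exceeded the bound, so would the [q]-average, against [GE]. *)
apply/not_existsP => Hn.
have mS : bm (fun x => \sum_d F w d x) by apply: bm_sum => d' _; exact: mF.
set c := (1 + _) * _ in Hn.
have : \sum_i q i * L (G i) <= c.
  rewrite (eq_bigr (fun i => L (fun x => q i * G i x))); last first.
    by move=> i _; rewrite (poslinZ HL).
  rewrite -(poslin_sum HL); last by move=> i _; exact: bmZ.
  rewrite /c -(poslinZ HL)//; apply: (poslin_le HL) => //; last exact: bmZ.
  by apply: bm_sum => i _; exact: bmZ.
apply/negP; rewrite -ltNge -[c]mul1r -q1 mulr_suml.
have [i qi] : exists i, 0 < q i.
  apply/not_existsP => qn; have : \sum_i q i <= 0.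
    by apply: sumr_le0 => i _; rewrite leNgt; apply/negP; exact: qn.
  by rewrite q1 ler10.
have Hlt j : c < L (G j) by rewrite ltNge; apply/negP; exact: Hn.
rewrite (bigD1 i)//= [ltRHS](bigD1 i)//= ltr_leD ?ltr_pM2l//.
by apply: ler_sum => j _; rewrite ler_wpM2l// ltW.
Qed.

End Maurey.

Lemma sum_option (R : nmodType) (I : finType) (F : option I -> R) :
  \sum_o F o = F None + \sum_i F (Some i).
Proof.
rewrite (bigD1 None)//=; congr (_ + _).
rewrite (reindex_omap Some id) => [|[]//]; apply: eq_bigl => i.
by rewrite /= eqxx.
Qed.

(** Cauchy-Schwarz, read off from the nonnegativity of the variance of [x] over [P]. *)
Lemma sqr_sum_le (R : realFieldType) (I : finType) (P : pred I) (x : I -> R) :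
  (\sum_(i | P i) x i) ^+ 2 <= #|P|%:R * \sum_(i | P i) x i ^+ 2.
Proof.
have [P0|P0] := posnP #|P|.
  by have P0' := card0_eq P0; rewrite !big_pred0// expr0n/= mulr0.
set S := \sum_(i | P i) x i; set n : R := #|P|%:R.
have n0 : 0 < n by rewrite ltr0n.
have : 0 <= \sum_(i | P i) (x i - S / n) ^+ 2 by apply: sumr_ge0 => i _; exact: sqr_ge0.
under eq_bigr do rewrite sqrrB.
rewrite big_split/= sumrB -/S.
under [X in _ - X]eq_bigr do rewrite -mulrnAl.
rewrite -mulr_suml sumrMnl -/S sumr_const -[X in _ <= _ + X]mulr_natl -/n.
have -> : n * (S / n) ^+ 2 = S ^+ 2 / n by field; rewrite gt_eqF.
have -> : (S *+ 2) * (S / n) = 2 * (S ^+ 2 / n) by rewrite -[S *+ 2]mulr_natl; field; rewrite gt_eqF.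
move=> h; rewrite mulrC -ler_pdivrMr//; lra.
Qed.

Lemma l1_support_le (R : realType) (N v : nat) (a : 'I_N -> R[i]) :
  (#|[pred j | a j != 0%R]| <= v)%N ->
  (\sum_j cmod (a j)) ^+ 2 <= v%:R * \sum_j cmod (a j) ^+ 2.
Proof.
move=> av; rewrite (bigID [pred j | a j != 0])/= [X in _ + X]big1 ?addr0; last first.
  by move=> j /negbNE/eqP ->; rewrite cmod0.
rewrite (le_trans (sqr_sum_le _ _))//.
apply: (@le_trans _ _ (v%:R * \sum_(j | a j != 0) cmod (a j) ^+ 2)).
  by rewrite ler_wpM2r ?ler_nat//; apply: sumr_ge0 => j _; exact: sqr_ge0.
rewrite ler_wpM2l// [leRHS](bigID [pred j | a j != 0])/= lerDl.
by apply: sumr_ge0 => j _; exact: sqr_ge0.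
Qed.

Lemma lin_comb_le (R : realType) (T : Type) (N : nat) (phi : 'I_N -> T -> R[i])
    (a : 'I_N -> R[i]) x :
  (forall j x, cmod (phi j x) <= 1) -> cmod (lin_comb phi a x) <= \sum_j cmod (a j).
Proof.
move=> phi1; rewrite (le_trans (cmod_sum _ _ _))//; apply: ler_sum => j _.
by rewrite cmodM ler_piMr ?cmod_ge0.
Qed.

(** * Linear combinations as convex combinations of atoms *)

Section atoms.
Context (R : realType) (T : Type) (N : nat) (phi : 'I_N -> T -> R[i]) (A : R).

(* [Some (j, c, s)] encodes the atom [(-1)^s * A * phi j], multiplied by ['i] if [c]. *)
Definition atom (o : option ('I_N * bool * bool)) (x : T) : R[i] :=
  if o is Some (j, c, s) then
    ((-1) ^+ s * A)%:C%C * (if c then 'i%C else 1) * phi j x else 0.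

Definition atom_avg k (w : k.-tuple (option ('I_N * bool * bool))) (x : T) : R[i] :=
  (k%:R^-1)%:C%C * \sum_(o <- w) atom o x.

Definition cpart (c : bool) (z : R[i]) := if c then complex.Im z else complex.Re z.

(** Real and imaginary part, each with either sign. These four real functionals replace the modulus
    in exponential moments, at the cost of the factor 2 in [cdir_large]. *)
Definition cdir (e : bool * bool) (z : R[i]) : R := (-1) ^+ e.1 * cpart e.2 z.

Lemma cpart_le c z : `|cpart c z| <= cmod z.
Proof. by case: c; rewrite ?normIm_le ?normRe_le. Qed.

Lemma cdir_le e z : `|cdir e z| <= cmod z.
Proof. by rewrite /cdir normrMsign cpart_le. Qed.

Lemma cdir_sum e (I : Type) (r : seq I) (F : I -> R[i]) :
  cdir e (\sum_(i <- r) F i) = \sum_(i <- r) cdir e (F i).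
Proof.
by rewrite /cdir /cpart; case: e.2; rewrite ?Re_sum ?Im_sum mulr_sumr.
Qed.

Lemma cdirZ e (u : R) z : cdir e (u%:C%C * z) = u * cdir e z.
Proof.
by rewrite /cdir /cpart; case: e.2; rewrite ?ReM ?ImM/= mul0r ?subr0 ?addr0 mulrCA.
Qed.

Lemma cdirB e z w : cdir e (z - w) = cdir e z - cdir e w.
Proof.
by rewrite /cdir /cpart; case: e.2; rewrite ?ReD ?ImD ?ReN ?ImN mulrBr.
Qed.

Lemma cdir_large z (t : R) : t < cmod z -> exists e, t / 2 < cdir e z.
Proof.
move=> tz; have := lt_le_trans tz (cmod_le z).
have H (u : R) : t / 2 < `|u| -> exists s : bool, t / 2 < (-1) ^+ s * u.
  have [u0|u0] := leP 0 u.
    by rewrite ger0_norm// => ?; exists false; rewrite mul1r.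
  by rewrite ltr0_norm// => ?; exists true; rewrite expr1 mulN1r.
have [/H[s ?] _|h1] := ltP (t / 2) `|complex.Re z|; first by exists (s, false).
have [/H[s ?] _|h2] := ltP (t / 2) `|complex.Im z|; first by exists (s, true).
lra.
Qed.

Lemma cmod_atom o x : 0 <= A -> (forall j x, cmod (phi j x) <= 1) -> cmod (atom o x) <= A.
Proof.
move=> A0 phi1; case: o => [[[j c] s]|]; last by rewrite cmod0.
rewrite /atom !cmodM cmod_real normrMsign ger0_norm// -mulrA ler_piMr// mulr_ile1 ?cmod_ge0//.
by case: c; rewrite cmodE/= ?expr0n/= ?expr1n ?addr0 ?add0r ?sqrtr1.
Qed.

(** Positive and negative parts of the real and imaginary parts of [b], in units of [A]: the
    barycentric coordinates of [lin_comb phi b] with respect to the atoms. The mass missing to 1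
    will go to the zero atom [None]. *)
Definition atom_weight (b : 'I_N -> R[i]) (t : 'I_N * bool * bool) : R :=
  Num.max 0 ((-1) ^+ t.2 * cpart t.1.2 (b t.1.1)) / A.

Lemma sum_triple (V : nmodType) (F : 'I_N * bool * bool -> V) :
  \sum_t F t = \sum_j ((F (j, true, true) + F (j, true, false)) +
                       (F (j, false, true) + F (j, false, false))).
Proof.
rewrite (eq_bigr (fun t => F (t.1, t.2))) => [|[]//].
rewrite -(pair_bigA _ (fun u s => F (u, s)))/=.
rewrite (eq_bigr (fun u => \sum_s F (u.1, u.2, s))) => [|[]//].
rewrite -(pair_bigA _ (fun j c => \sum_s F (j, c, s)))/=.
by apply: eq_bigr => j _; rewrite !big_bool.
Qed.

Lemma max_signs (u : R) :
  Num.max 0 ((-1) ^+ true * u) + Num.max 0 ((-1) ^+ false * u) = `|u| /\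
  Num.max 0 ((-1) ^+ false * u) - Num.max 0 ((-1) ^+ true * u) = u.
Proof.
rewrite expr1 mulN1r expr0 mul1r !maxEle.
by have [u0|u0] := ler0P u; have [u1|u1] := leP 0 (- u); have [u2|u2] := leP 0 u; split; lra.
Qed.

Lemma sum_atom_weight b : 0 < A ->
  \sum_t atom_weight b t = (\sum_j (`|complex.Re (b j)| + `|complex.Im (b j)|)) / A.
Proof.
move=> A0; rewrite sum_triple mulr_suml; apply: eq_bigr => j _.
rewrite /atom_weight /cpart -!mulrDl; congr (_ / _).
by rewrite (max_signs _).1 (max_signs _).1 addrC.
Qed.

Lemma sum_atom_weight_atom b x : 0 < A ->
  \sum_t (atom_weight b t)%:C%C * atom (Some t) x = lin_comb phi b x.
Proof.
move=> A0; rewrite sum_triple /lin_comb; apply: eq_bigr => j _.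
rewrite /atom !mulrA -!mulrDl; congr (_ * _).
have H c : ((atom_weight b (j, c, true))%:C * ((-1) ^+ true * A)%:C +
            (atom_weight b (j, c, false))%:C * ((-1) ^+ false * A)%:C)%C = (cpart c (b j))%:C%C.
  rewrite -!rmorphM -rmorphD; congr (_%:C)%C.
  rewrite /atom_weight/= -[RHS](max_signs _).2 expr1 expr0 mulN1r !mul1r mulN1r.
  by rewrite mulrN !divfK ?gt_eqF// addrC.
rewrite (H true) (H false) /cpart mulr1; case: (b j) => u v /=.
by apply/eqP; rewrite eq_complex/=; apply/andP; split; apply/eqP; ring.
Qed.

End atoms.

(** * Approximation by averages of few atoms *)

Section sparse_approximation.
Context (R : realType) d (T : measurableType d) (N : nat) (phi : 'I_N -> T -> R[i]).
Hypothesis mphi : forall j, cbm (phi j).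
Hypothesis phi1 : forall j x, cmod (phi j x) <= 1.

Lemma cbm_atom A o : cbm (atom phi A o).
Proof. by case: o => [[[j c] s]|]; [exact: cbmZ|exact: cbm_cst]. Qed.

Lemma cbm_atom_avg A k (w : k.-tuple _) : cbm (atom_avg phi A w).
Proof. by apply: cbmZ; apply: cbm_sum => o _; exact: cbm_atom. Qed.

Lemma cbm_lin_comb a : cbm (lin_comb phi a).
Proof. by apply: cbm_sum => j _; exact: cbmZ. Qed.

Lemma bm_cdir (f : T -> R[i]) e : cbm f -> bm (fun x => cdir e (f x)).
Proof. by move=> [? ?]; rewrite /cdir /cpart; case: e.2; exact: bmZ. Qed.

(** [Maurey] in the four directions, followed by Markov's inequality. A modulus above [t] makes one
    of the signed sums of [k] terms exceed [k * t / 2], so its exponential exceeds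
    [expR (th * k * t / 2)], while the total moment is at most
    [4 * expR (8 * k * th ^+ 2 * A ^+ 2)]. The factor 2 before the [l1] norm comes from
    [|Re| + |Im|]. *)
Lemma sparse_approx (L : (T -> R) -> R) (b : 'I_N -> R[i]) (A t : R) (k : nat) :
  poslin L -> L (fun=> 1) = 1 ->
  0 < A -> 2 * \sum_j cmod (b j) <= A -> 0 < t <= 16 * A -> (0 < k)%N ->
  exists w : k.-tuple (option ('I_N * bool * bool)),
    L (fun x => (t < cmod (lin_comb phi b x - atom_avg phi A w x))%R%:R)
      <= 4 * expR (- (k%:R * t ^+ 2 / (128 * A ^+ 2))).
Proof.
move=> HL L1 A0 bA /andP[t0 tA] k0.
pose q o := if o is Some u then atom_weight A b u
            else 1 - \sum_u atom_weight A b u.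
have q1 : \sum_o q o = 1 by rewrite sum_option/= subrK.
have q0 o : 0 <= q o.
  case: o => [u|]/=; first by rewrite /atom_weight divr_ge0 ?le_max ?lexx// ltW.
  rewrite subr_ge0 sum_atom_weight// ler_pdivrMr// mul1r (le_trans _ bA)//.
  rewrite mulr_sumr; apply: ler_sum => j _.
  by rewrite mulr2n mulrDl mul1r lerD ?normRe_le ?normIm_le.
pose e (dd : bool * bool) o x := cdir dd (atom phi A o x).
have me dd o : bm (e dd o) by apply: bm_cdir; exact: cbm_atom.
have eA dd o x : `|e dd o x| <= A by rewrite (le_trans (cdir_le _ _))// cmod_atom// ltW.
(* The minimizer of [8 * th ^+ 2 * A ^+ 2 - th * t / 2]; the hypothesis [t <= 16 * A] is exactly
   [2 * A * th <= 1]. *)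
pose th := t / (32 * A ^+ 2).
have A2 : 0 < A ^+ 2 by rewrite exprn_gt0.
have th0 : 0 <= th by rewrite divr_ge0 ?ltW// mulr_gt0.
have Ath : 2 * A * th <= 1.
  rewrite /th mulrA ler_pdivrMr ?mulr_gt0// mul1r expr2.
  rewrite (_ : 32 * (A * A) = 2 * A * (16 * A)); last by ring.
  by rewrite ler_pM2l// mulr_gt0.
have [w Hw] := Maurey HL L1 me eA q0 q1 th0 Ath k.
exists w; set f := fun x => lin_comb phi b x - atom_avg phi A w x.
have mf : cbm f by apply: cbmB; [exact: cbm_lin_comb|exact: cbm_atom_avg].
pose Phi x := \sum_dd expR (th * \sum_(i <- w) (e dd i x - \sum_j q j * e dd j x)).
have mPhi : bm Phi.
  apply: bm_sum => dd _; apply/bm_expR/bmZ; apply: bm_sum => i _; apply: bmB => //.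
  by apply: bm_sum => j _; exact: bmZ.
have kR : 0 < k%:R :> R by rewrite ltr0n.
have y_lin dd x : \sum_j q j * e dd j x = cdir dd (lin_comb phi b x).
  rewrite sum_option/= [e dd None x]/e/=.
  have -> : cdir dd (0 : R[i]) = 0 by rewrite /cdir /cpart; case: dd.2; rewrite mulr0.
  rewrite mulr0 add0r -(sum_atom_weight_atom phi b x A0) cdir_sum.
  by apply: eq_bigr => u _; rewrite cdirZ.
have D_lin dd x : \sum_(i <- w) (e dd i x - \sum_j q j * e dd j x) = - (k%:R * cdir dd (f x)).
  rewrite y_lin /f cdirB /atom_avg cdirZ mulrBr mulVKf ?gt_eqF// opprB cdir_sum.
  rewrite sumrB; congr (_ - _).
  by rewrite big_const_seq count_predT size_tuple iter_addr_0 mulr_natl.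
apply: (@le_trans _ _ (L (fun x => expR (- (th * k%:R * t / 2)) * Phi x))).
  apply: (poslin_le HL); [exact: bm_cmod_gt|exact: bmZ|move=> x].
  have [tf|_] := ltP t (cmod (f x)); last first.
    by rewrite mulr_ge0 ?expR_ge0//; apply: sumr_ge0 => dd _; exact: expR_ge0.
  rewrite -cmodN in tf; have [dd ddf] := cdir_large tf.
  set c := th * k%:R * t / 2.
  have E1 : expR (- c) * expR c = 1 by rewrite -expRD addNr expR0.
  rewrite mulr1n -[leLHS]E1 ler_wpM2l ?expR_ge0// /Phi (bigD1 dd)//= -[leLHS]addr0 lerD//; last first.
    by apply: sumr_ge0 => ? _; exact: expR_ge0.
  have cN : cdir dd (- f x) = - cdir dd (f x).
    by rewrite /cdir /cpart; case: dd.2; rewrite ?ReN ?ImN mulrN.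
  have -> : c = th * (k%:R * (t / 2)) by rewrite /c; ring.
  by rewrite ler_expR D_lin -mulrN -cN !ler_wpM2l// ltW.
rewrite (poslinZ HL)//; apply: le_trans (ler_wpM2l (expR_ge0 _) Hw) _.
rewrite card_prod card_bool mulrCA ler_pM2l//.
have -> : 8 * th ^+ 2 * A ^+ 2 = t ^+ 2 / (128 * A ^+ 2).
  by rewrite /th; field; rewrite gt_eqF.
apply: (@le_trans _ _ (expR (- (th * k%:R * t / 2)) * expR (t ^+ 2 / (128 * A ^+ 2)) ^+ k)).
  rewrite ler_wpM2l ?expR_ge0// lerXn2r ?nnegrE ?expR_ge0 ?expR_ge1Dx//.
  by rewrite addr_ge0// divr_ge0 ?sqr_ge0// mulr_ge0// ltW.
rewrite -expRM_natl -expRD ler_expR /th le_eqVlt; apply/orP; left; apply/eqP.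
by field; rewrite gt_eqF.
Qed.

End sparse_approximation.

(** * Powers with exponent between 1 and 2 *)

Section powR_facts.
Context (R : realType) (p : R) (hp : 1 <= p <= 2).

(** Interpolation: for functions bounded by [B], the second moment is controlled by the [p]-th
    one. *)
Lemma sqr_le_powR (B y : R) : 0 <= y <= B -> y ^+ 2 <= B `^ (2 - p) * y `^ p.
Proof.
case/andP: hp => p1 p2 /andP[y0 yB].
rewrite -powR_mulrn// -[2%:R](subrK p) powRD ?subrK ?pnatr_eq0//.
by rewrite ler_wpM2r ?powR_ge0// ge0_ler_powR ?nnegrE ?subr_ge0// (le_trans y0).
Qed.

Lemma powRD_le (x y : R) : 0 <= x -> 0 <= y -> (x + y) `^ p <= 4 * (x `^ p + y `^ p).
Proof.
case/andP: hp => p1 p2; have p0 : 0 <= p by exact: le_trans p1.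
have H (u v : R) : 0 <= u -> u <= v -> (u + v) `^ p <= 4 * (u `^ p + v `^ p).
  move=> u0 uv; have v0 : 0 <= v by exact: le_trans uv.
  apply: (@le_trans _ _ ((2 * v) `^ p)).
    rewrite ge0_ler_powR ?nnegrE ?addr_ge0 ?mulr_ge0//.
    by rewrite mulr2n mulrDl mul1r lerD2r.
  rewrite powRM// ler_pM ?powR_ge0//; last by rewrite lerDr powR_ge0.
  have -> : 4 = 2 `^ 2 :> R by rewrite powR_mulrn//; ring.
  by rewrite ler_powR// ler1n.
move=> x0 y0; have [xy|/ltW yx] := leP x y; first exact: H.
by rewrite addrC [x `^ p + _]addrC; exact: H.
Qed.

Lemma le_of_powR (x B : R) : 1 <= B -> 0 <= x -> x `^ p <= B -> x <= B.
Proof.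
case/andP: hp => p1 p2 B1 x0 xB; have [x1|x1] := leP x 1; first exact: le_trans B1.
by rewrite (le_trans _ xB)// le1r_powR// ltW.
Qed.

Lemma powR_le_powR (x y : R) : 0 <= x -> 0 <= y -> (x `^ p <= y `^ p) = (x <= y).
Proof.
case/andP: hp => p1 p2 x0 y0; have p0 : 0 < p by exact: lt_le_trans p1.
apply/idP/idP => [|xy]; last by rewrite ge0_ler_powR// ltW.
apply: contraTT; rewrite -!ltNge => yx.
by rewrite gt0_ltr_powR ?nnegrE.
Qed.

End powR_facts.

Lemma poslin_avg (R : realType) d (T : measurableType d) (L1 L2 : (T -> R) -> R) :
  poslin L1 -> poslin L2 -> poslin (fun f => (L1 f + L2 f) / 2).
Proof.
move=> H1 H2; split => [f g mf mg|c f mf|f g mf mg fg].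
- by rewrite (poslinD H1)// (poslinD H2)//; ring.
- by rewrite (poslinZ H1)// (poslinZ H2)//; ring.
- by rewrite ler_pM2r ?invr_gt0// lerD ?(poslin_le H1)// (poslin_le H2).
Qed.

(** * Dyadic levels *)

Section levels.
Context (R : realType) (p : R) (hp : 1 <= p <= 2) (Q : R) (Q1 : 1 <= Q).

Definition lev (i : nat) : R := (Q / 2 ^+ i) `^ p^-1.

Let Q0 : 0 < Q. Proof. exact: lt_le_trans Q1. Qed.

Lemma lev_powR i : lev i `^ p = Q / 2 ^+ i.
Proof.
rewrite /lev -powRrM mulVf ?powRr1 ?divr_ge0 ?exprn_ge0 ?(ltW Q0)//.
by rewrite gt_eqF// (lt_le_trans _ (proj1 (andP hp))).
Qed.

Lemma lev_gt0 i : 0 < lev i.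
Proof. by rewrite powR_gt0// divr_gt0// exprn_gt0. Qed.

Lemma levS_le i : lev i.+1 <= lev i.
Proof.
have h : Q / 2 ^+ i.+1 <= Q / 2 ^+ i.
  rewrite exprS invfM mulrA ler_pM2r ?invr_gt0 ?exprn_gt0//.
  by rewrite ler_pdivrMr// ler_peMr ?(ltW Q0)// ler1n.
have pp : 0 <= p by exact: le_trans (proj1 (andP hp)).
by apply: ge0_ler_powR; rewrite ?nnegrE ?invr_ge0 ?divr_ge0 ?exprn_ge0 ?(ltW Q0).
Qed.

Lemma levS_ge i : lev i / 2 <= lev i.+1.
Proof.
case/andP: (hp) => p1 p2.
rewrite -(powR_le_powR hp) ?divr_ge0 ?(ltW (lev_gt0 _))// powRM ?(ltW (lev_gt0 _))//.
rewrite !lev_powR exprS invfM mulrCA mulrC ler_wpM2r ?divr_ge0 ?exprn_ge0 ?(ltW Q0)//.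
rewrite -[leRHS]powRr1// ger_powR// invr_gt0 ltr0n/=.
by rewrite invf_le1// ler1n.
Qed.

Lemma lev_ge1 i : 2 ^+ i <= Q -> 1 <= lev i.
Proof.
move=> iQ; rewrite -(powR_le_powR hp) ?(ltW (lev_gt0 _))// lev_powR powR1.
by rewrite ler_pdivlMr ?exprn_gt0// mul1r.
Qed.

(** The ratio is [2 ^ (- 1 / p) <= 2 ^ (- 1 / 2) < 3 / 4]. A fixed ratio below 1 makes the levels
    summable, as [sum_incr_dist] requires. *)
Lemma levS_le34 i : lev i.+1 <= 3 / 4 * lev i.
Proof.
have l0 j := lev_gt0 j; case/andP: (hp) => p1 p2.
rewrite -(powR_le_powR hp) ?mulr_ge0 ?(ltW (l0 _))//.
rewrite powRM ?(ltW (l0 _))// !lev_powR exprS invfM mulrCA.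
rewrite ler_wpM2r ?divr_ge0 ?exprn_ge0 ?(ltW Q0)//.
apply: (@le_trans _ _ ((3 / 4) ^+ 2)); first by rewrite expr2; lra.
by rewrite -powR_mulrn// ger_powR//; apply/andP; split; lra.
Qed.

Lemma lev_powR_le i : lev i `^ p <= Q.
Proof.
rewrite lev_powR ler_pdivrMr ?exprn_gt0// ler_peMr ?(ltW Q0)//.
by rewrite exprn_ege1// ler1n.
Qed.

End levels.

(** * Coverings of the unit ball *)

Section nets.
Context (R : realType) (p : R) (hp : 1 <= p <= 2).
Context d (T : measurableType d) (mu : probability T R).
Context (N s : nat) (phi : 'I_N -> T -> R[i]) (K : R).
Hypothesis mphi : forall j, cbm (phi j).
Hypothesis phi1 : forall j x, cmod (phi j x) <= 1.
Hypothesis K1 : 1 <= K.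
Hypothesis s0 : (0 < s)%N.
Hypothesis riesz : forall a : 'I_N -> R[i], (#|[pred j | a j != 0%R]| <= 4 * s)%N ->
  \sum_j cmod (a j) ^+ 2 <= K * mean mu (fun x => cmod (lin_comb phi a x) ^+ 2).

Let p0 : 0 <= p. Proof. by case/andP: hp => h _; exact: le_trans h. Qed.
Let Hmu := poslin_mean mu.
Context (Q : R).
Hypothesis QE : Q = K * s%:R.

Let Q1 : 1 <= Q.
Proof. by rewrite QE mulr_ege1// ler1n. Qed.

Definition pmean (f : T -> R[i]) := mean mu (fun x => cmod (f x) `^ p).

Lemma bm_cmod_sqr (f : T -> R[i]) : cbm f -> bm (fun x => cmod (f x) ^+ 2).
Proof. by move=> mf; under eq_fun do rewrite expr2; apply: bmM; exact: bm_cmod. Qed.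

Lemma l1_sqr_le (v : nat) (a : 'I_N -> R[i]) : (v <= 4 * s)%N ->
  (#|[pred j | a j != 0%R]| <= v)%N ->
  (\sum_j cmod (a j)) ^+ 2 <= K * v%:R * mean mu (fun x => cmod (lin_comb phi a x) ^+ 2).
Proof.
move=> vs av; rewrite (le_trans (l1_support_le av))// [K * _]mulrC -mulrA.
by rewrite ler_wpM2l// riesz// (leq_trans av).
Qed.

(** The [l1] norm [B] of the coefficients also bounds the sup norm of the function. The Riesz
    condition bounds [B ^ 2] by [K * v] times the second moment, interpolation bounds the latter by
    [B ^ (2 - p)] times the [p]-th moment, and [B ^ (2 - p)] cancels. *)
Lemma l1_powR_le (v : nat) (a : 'I_N -> R[i]) : (v <= 4 * s)%N ->
  (#|[pred j | a j != 0%R]| <= v)%N ->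
  (\sum_j cmod (a j)) `^ p <= K * v%:R * pmean (lin_comb phi a).
Proof.
case/andP: (hp) => p1 p2 vs av; set B := \sum_j _.
have B0 : 0 <= B by apply: sumr_ge0 => j _; exact: cmod_ge0.
have mf : cbm (lin_comb phi a) by exact: cbm_lin_comb.
have Kv0 : 0 <= K * v%:R by rewrite mulr_ge0// (le_trans _ K1).
have [->|Bn0] := eqVneq B 0.
  rewrite powR0 ?gt_eqF ?(lt_le_trans _ p1)// mulr_ge0//.
  by apply: (poslin_ge0 Hmu); [exact: bm_cmod_powR|move=> x; exact: powR_ge0].
have {}Bn0 : 0 < B by rewrite lt_def Bn0.
have := l1_sqr_le vs av; rewrite -/B => HB.
suff : B ^+ 2 <= K * v%:R * (B `^ (2 - p) * pmean (lin_comb phi a)).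
  have -> : B ^+ 2 = B `^ (2 - p) * B `^ p.
    by rewrite -powR_mulrn// -[2%:R in LHS](subrK p) powRD// subrK pnatr_eq0.
  by rewrite mulrCA ler_pM2l ?powR_gt0.
rewrite (le_trans HB)// ler_wpM2l// /pmean -(poslinZ Hmu); last exact: bm_cmod_powR.
apply: (poslin_le Hmu) => [||x]; [exact: bm_cmod_sqr|exact/bmZ/bm_cmod_powR|].
by apply: sqr_le_powR => //; rewrite cmod_ge0 lin_comb_le.
Qed.

Definition unit_ball (a : 'I_N -> R[i]) : Prop :=
  (#|[pred j | a j != 0%R]| <= s)%N /\ pmean (lin_comb phi a) <= 1.

Lemma unit_ball_l1 a : unit_ball a -> (\sum_j cmod (a j)) `^ p <= Q.
Proof.
move=> [sa fa]; rewrite (le_trans (l1_powR_le _ sa)) ?leq_pmull// -QE -[leRHS]mulr1 ler_wpM2l//.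
exact: le_trans Q1.
Qed.

Lemma unit_ball_sup a x : unit_ball a -> cmod (lin_comb phi a x) `^ p <= Q.
Proof.
move=> /unit_ball_l1; apply: le_trans; rewrite ge0_ler_powR ?nnegrE ?cmod_ge0//.
  by apply: sumr_ge0 => j _; exact: cmod_ge0.
exact: lin_comb_le.
Qed.

Lemma unit_ball_sup1 a x : unit_ball a -> cmod (lin_comb phi a x) <= Q.
Proof. by move=> ba; apply: (le_of_powR hp) => //; [exact: cmod_ge0|exact: unit_ball_sup]. Qed.

Context (eta : R).
Hypothesis eta0 : 0 <= eta.

(* The cover works for every probability mean [L], so that one family of functions
   approximates both under [mu] and under all empirical measures. *)
Definition covered (n : nat) (t : R) : Prop :=
  exists (U : finType) (c : U -> T -> R[i]),
    [/\ (#|U| <= n)%N, forall u, cbm (c u) &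
      forall a, unit_ball a -> forall L : (T -> R) -> R, poslin L -> L (fun=> 1) = 1 ->
      exists u, L (fun x => (t < cmod (lin_comb phi a x - c u x))%R%:R) <= eta].

Lemma covered1 t : 0 <= t -> Q <= t `^ p -> covered 1 t.
Proof.
move=> t0 tQ; exists unit, (fun _ _ => 0); split => //; first by rewrite card_unit.
  by move=> _; exact: cbm_cst.
move=> a ba L HL L1; exists tt.
rewrite (_ : (fun _ => _) = fun=> 0) ?poslin0//; apply/funext => x.
rewrite subr0 ltNge -(powR_le_powR hp) ?cmod_ge0//.
by rewrite (le_trans (unit_ball_sup _ ba)).
Qed.

(** Off the two exceptional sets [|f - g| <= 2 * t], and interpolation bounds the square by
    [8 * t ^ (2 - p) * (|f| ^ p + |g| ^ p)], of integral at most [16 * t ^ (2 - p)]. On them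
    [|f - g| <= 2 * Q], which costs at most [16 * Q ^+ 2 * eta <= 1 <= t ^ (2 - p)]. *)
Lemma sqr_mean_dist_le a b (c : T -> R[i]) (t : R) : 1 <= t -> 16 * Q ^+ 2 * eta <= 1 ->
  cbm c -> unit_ball a -> unit_ball b ->
  mean mu (fun x => (t < cmod (lin_comb phi a x - c x))%R%:R) <= 2 * eta ->
  mean mu (fun x => (t < cmod (lin_comb phi b x - c x))%R%:R) <= 2 * eta ->
  mean mu (fun x => cmod (lin_comb phi a x - lin_comb phi b x) ^+ 2) <= 17 * t `^ (2 - p).
Proof.
case/andP: (hp) => p1 p2 t1 Qeta mc ba bb Ma Mb.
set f := lin_comb phi a; set g := lin_comb phi b.
have t0 : 0 <= t by exact: le_trans t1.
have mf : cbm f by exact: cbm_lin_comb.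
have mg : cbm g by exact: cbm_lin_comb.
have mfg : cbm (fun x => f x - g x) by exact: cbmB.
set bf := fun x => (t < cmod (f x - c x))%R%:R : R.
set bg := fun x => (t < cmod (g x - c x))%R%:R : R.
have mbf : bm bf by apply: bm_cmod_gt; exact: cbmB.
have mbg : bm bg by apply: bm_cmod_gt; exact: cbmB.
have mfp : bm (fun x => cmod (f x) `^ p) by exact: bm_cmod_powR.
have mgp : bm (fun x => cmod (g x) `^ p) by exact: bm_cmod_powR.
have pt x : cmod (f x - g x) ^+ 2 <= 8 * t `^ (2 - p) * (cmod (f x) `^ p + cmod (g x) `^ p)
    + 4 * Q ^+ 2 * (bf x + bg x).
  have fg : cmod (f x - g x) <= cmod (f x) + cmod (g x) by rewrite -(cmodN (g x)) cmodD.
  have rest : 0 <= 8 * t `^ (2 - p) * (cmod (f x) `^ p + cmod (g x) `^ p).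
    by rewrite mulr_ge0 ?addr_ge0 ?powR_ge0// mulr_ge0 ?powR_ge0.
  have [small|large] := leP (cmod (f x - g x)) (2 * t).
    apply: (@le_trans _ _ (8 * t `^ (2 - p) * (cmod (f x) `^ p + cmod (g x) `^ p))); last first.
      by rewrite lerDl mulr_ge0 ?addr_ge0// mulr_ge0// sqr_ge0.
    apply: le_trans (sqr_le_powR hp (B := 2 * t) _) _; first by rewrite cmod_ge0.
    rewrite (_ : 8 * _ * _ = (2 * t `^ (2 - p)) * (4 * (cmod (f x) `^ p + cmod (g x) `^ p)));
      last by ring.
    rewrite powRM// ler_pM ?mulr_ge0 ?powR_ge0//.
      rewrite ler_wpM2r ?powR_ge0// -[leRHS]powRr1// ler_powR ?ler1n//; lra.
    rewrite (le_trans _ (powRD_le hp _ _)) ?cmod_ge0//.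
    by rewrite ge0_ler_powR ?nnegrE ?addr_ge0 ?cmod_ge0.
  have bad1 : 1 <= bf x + bg x.
    rewrite /bf /bg; have [h1|h1] := ltP t (cmod (f x - c x)); first by rewrite lerDl.
    have [h2|h2] := ltP t (cmod (g x - c x)); first by rewrite lerDr.
    have : cmod (f x - g x) <= 2 * t.
      rewrite (_ : f x - g x = (f x - c x) - (g x - c x)); last by ring.
      by rewrite (le_trans (cmodD _ _))// cmodN mulr2n mulrDl mul1r lerD.
    by rewrite leNgt large.
  apply: (@le_trans _ _ (4 * Q ^+ 2 * (bf x + bg x))); last by rewrite lerDr.
  rewrite (@le_trans _ _ (4 * Q ^+ 2))//; last by rewrite ler_peMr// mulr_ge0// sqr_ge0.
  have -> : 4 * Q ^+ 2 = (2 * Q) ^+ 2 by ring.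
  have Q20 : 0 <= 2 * Q by apply: mulr_ge0 => //; exact: le_trans Q1.
  apply: lerXn2r; rewrite ?nnegrE ?cmod_ge0//.
  by rewrite (le_trans fg)// mulr2n mulrDl mul1r lerD// unit_ball_sup1.
apply: le_trans (poslin_le Hmu _ _ pt) _; first exact: bm_cmod_sqr.
  by apply: bmD; apply: bmZ; exact: bmD.
rewrite (poslinD Hmu) ?(poslinZ Hmu) ?(poslinD Hmu)//; try by [exact: bmD|apply: bmZ; exact: bmD].
apply: (@le_trans _ _ (8 * t `^ (2 - p) * (1 + 1) + 4 * Q ^+ 2 * (2 * eta + 2 * eta))).
  apply: lerD; apply: ler_wpM2l; rewrite ?mulr_ge0 ?powR_ge0 ?(le_trans _ Q1)//.
    by apply: lerD; [exact: ba.2|exact: bb.2].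
  exact: lerD.
have : 1 <= t `^ (2 - p) by rewrite -[leLHS](powRr0 t) ler_powR// subr_ge0.
move: Qeta; set X := Q ^+ 2 * eta => h; have : 16 * X <= 1 by rewrite mulrA.
rewrite (_ : 4 * Q ^+ 2 * (2 * eta + 2 * eta) = 16 * X); last by rewrite /X; ring.
lra.
Qed.

(* [b u] is an element of the unit ball close to [c u] under mu.  If [c u] is close to [a] under the
   average of [L] and mu, then [a - b u] is small in L_2(mu), hence has a small l1 norm, and
   [sparse_approx] applies to it under [L].
   The constant is [272 * 256 = 128 * 136 * 4], from [A ^+ 2 = 136 * Q * t `^ (2 - p)] and
   [t / 2 <= t']. *)
Lemma covered_step (n k : nat) (t t' : R) : covered n t -> 1 <= t -> t `^ p <= Q ->
  t / 2 <= t' <= t -> 16 * Q ^+ 2 * eta <= 1 -> (0 < k)%N ->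
  4 * expR (- (k%:R * t `^ p / (272 * 256 * Q))) <= eta ->
  covered (n * (4 * N).+1 ^ k) t'.
Proof.
case/andP: (hp) => p1 p2 [U [c [Un mc Hc]]] t1 tQ /andP[t't tt'] Qeta k0 keta.
have t0 : 0 < t by exact: lt_le_trans t1.
have Q0 : 0 < Q by exact: lt_le_trans Q1.
(* The factor 2 appears because [eta] bounds the average of two functionals, hence each of them only
   up to [2 * eta]. *)
pose close a u := unit_ball a /\
  mean mu (fun x => (t < cmod (lin_comb phi a x - c u x))%R%:R) <= 2 * eta.
(* The centre [b u] depends on [u] alone, neither on [a] nor on [L]; [fun=> 0] is a default for
   those [u] that are close to no element. *)
have /choice[b Hb] u : exists b, (exists a, close a u) -> close b u.
  by have [[a ha]|h] := pselect (exists a, close a u); [exists a|exists (fun=> 0)].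
(* Twice the bound on the [l1] norm of [a - b u]: this vector is [2 * s]-sparse, and by
   [sqr_mean_dist_le] the square of its [l1] norm is at most [2 * Q * 17 * t ^ (2 - p)]. *)
pose A : R := 2 * Num.sqrt (34 * Q * t `^ (2 - p)).
have tp0 : 0 < t `^ (2 - p) by rewrite powR_gt0.
have X0 : 0 < 34 * Q * t `^ (2 - p) by do 2! apply: mulr_gt0 => //.
have A0 : 0 < A by rewrite mulr_gt0// sqrtr_gt0.
have A2 : A ^+ 2 = 136 * Q * t `^ (2 - p).
  by rewrite /A exprMn sqr_sqrtr ?(ltW X0)//; ring.
have t2 : t ^+ 2 = t `^ (2 - p) * t `^ p.
  by rewrite -powR_mulrn ?ltW// -[2%:R in LHS](subrK p) powRD// subrK pnatr_eq0.
have t'0 : 0 < t' by rewrite (lt_le_trans _ t't)// divr_gt0.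
have t'A : t' <= 16 * A.
  apply: (@le_trans _ _ A); last by rewrite ler_peMl ?(ltW A0)// ler1n.
  rewrite (le_trans tt')// -[leRHS]gtr0_norm// -[leLHS]gtr0_norm// -!sqrtr_sqr ler_wsqrtr//.
  rewrite A2 t2 mulrC ler_wpM2r ?(ltW tp0)// (le_trans tQ)//.
  by rewrite ler_peMl ?(ltW Q0)// ler1n.
exists (U * k.-tuple (option ('I_N * bool * bool)))%type.
exists (fun uw x => lin_comb phi (b uw.1) x + atom_avg phi A uw.2 x).
split.
- rewrite card_prod card_tuple card_option !card_prod card_ord card_bool.
  by rewrite leq_mul// leq_exp2r// -mulnA mulnC.
- by move=> uw; apply: cbmD; [exact: cbm_lin_comb|exact: cbm_atom_avg].
move=> a ba L HL L1.
have [||u Hu] := Hc a ba (fun f => (L f + mean mu f) / 2).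
- exact: poslin_avg.
- by rewrite L1 mean1; field.
have mbad : bm (fun x => (t < cmod (lin_comb phi a x - c u x))%R%:R : R).
  by apply: bm_cmod_gt; apply: cbmB => //; exact: cbm_lin_comb.
have au : close a u.
  split => //; rewrite -ler_pdivrMl// (le_trans _ Hu)// mulrC ler_pM2r ?invr_gt0//.
  by rewrite lerDr; apply: (poslin_ge0 HL).
have [bb Hbu] := Hb u (ex_intro _ a au).
pose e j := a j - b u j.
have eE x : lin_comb phi e x = lin_comb phi a x - lin_comb phi (b u) x.
  by rewrite /lin_comb -sumrB; apply: eq_bigr => j _; rewrite /e mulrBl.
have se : (#|[pred j | e j != 0%R]| <= 2 * s)%N.
  rewrite mul2n -addnn (leq_trans _ (leq_add ba.1 bb.1))// -cardUI.
  apply: leq_trans (leq_addr _ _); apply: subset_leq_card; apply/fintype.subsetP => j.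
  rewrite !inE /e -negb_and; apply: contra => /andP[/eqP -> /eqP ->].
  by rewrite subrr.
have l1e : 2 * \sum_j cmod (e j) <= A.
  rewrite /A ler_pM2l// -[leLHS]ger0_norm; last first.
    by apply: sumr_ge0 => j _; exact: cmod_ge0.
  rewrite -sqrtr_sqr ler_wsqrtr// (le_trans (l1_sqr_le _ se)) ?leq_mul2r ?orbT//.
  have -> : 34 * Q * t `^ (2 - p) = K * (2 * s)%:R * (17 * t `^ (2 - p)).
    by rewrite QE natrM; ring.
  rewrite ler_wpM2l// ?mulr_ge0// ?(le_trans _ K1)//.
  under eq_fun do rewrite eE.
  exact: (sqr_mean_dist_le t1 Qeta (mc u) ba bb au.2 Hbu).
have [|w Hw] := sparse_approx mphi phi1 HL L1 A0 l1e (t := t') _ k0.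
  by rewrite t'0.
exists (u, w); move: Hw; under eq_fun do rewrite eE -addrA -opprD.
move=> /le_trans; apply; apply: (le_trans _ keta).
rewrite ler_pM2l// ler_expR lerN2 A2 -[leLHS]mulrA -[leRHS]mulrA ler_wpM2l//.
rewrite ler_pdivlMr; last by do ?apply: mulr_gt0.
rewrite [leLHS](_ : _ = t ^+ 2 / 4); last by rewrite t2; field; rewrite gt_eqF.
have -> : t ^+ 2 / 4 = (t / 2) ^+ 2 by field.
by apply: lerXn2r; rewrite // nnegrE ltW// divr_gt0.
Qed.

Let Q0 : 0 < Q. Proof. exact: lt_le_trans Q1. Qed.

Local Notation lev := (lev p Q).

(** The step from level [i] uses [k * 2 ^ i] atoms. As [Q / lev i ^ p = 2 ^ i], the exponent in
    [covered_step] is then the same at all levels, and the powers of 2 add up to [(2 ^ i).-1]. *)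
Lemma covered_lev (k i : nat) : (0 < k)%N -> 2 ^+ i <= 2 * Q -> 16 * Q ^+ 2 * eta <= 1 ->
  4 * expR (- (k%:R / (272 * 256))) <= eta ->
  covered ((4 * N).+1 ^ (k * (2 ^ i).-1)) (lev i).
Proof.
move=> k0 iQ Qeta keta; elim: i iQ => [|i IHi] iQ.
  by rewrite muln0; apply: covered1; rewrite ?(ltW (lev_gt0 p Q1 _))// (lev_powR hp Q1) expr0 divr1.
have iQ' : 2 ^+ i <= Q by rewrite -(ler_pM2l (ltr0n _ 2)) -exprS.
have -> : (k * (2 ^ i.+1).-1 = k * (2 ^ i).-1 + k * 2 ^ i)%N.
  rewrite -mulnDr expnS mul2n -addnn; congr (_ * _)%N.
  by have /prednK <- : (0 < 2 ^ i)%N by rewrite expn_gt0.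
rewrite expnD; apply: (covered_step (t := lev i)).
- by apply: IHi; rewrite (le_trans iQ')// ler_peMl ?(ltW Q0)// ler1n.
- exact: (lev_ge1 hp Q1).
- exact: lev_powR_le.
- by rewrite (levS_le hp Q1) (levS_ge hp Q1).
- by [].
- by rewrite muln_gt0 k0 expn_gt0.
rewrite (lev_powR hp Q1) natrM natrX (le_trans _ keta)// ler_pM2l// ler_expR lerN2.
rewrite le_eqVlt; apply/orP; left; apply/eqP.
by field; rewrite gt_eqF//= gt_eqF// exprn_gt0.
Qed.

Lemma round_grid (n H : nat) (r : R) : (0 < H)%N -> `|r| <= Q -> Q * H%:R <= n%:R ->
  exists i : 'I_(2 * n).+1, `|r - (i%:R - n%:R) / H%:R| <= H%:R^-1.
Proof.
move=> H0 rQ Qn; have HR : 0 < H%:R :> R by rewrite ltr0n.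
have rH : `|r * H%:R| <= n%:R.
  by rewrite normrM [`|H%:R|]ger0_norm// (le_trans _ Qn)// ler_wpM2r.
move: rH; rewrite ler_norml => /andP[rH1 rH2].
have y0 : 0 <= r * H%:R + n%:R by rewrite -lerBlDr sub0r.
have /andP[t1 t2] := truncn_itv y0; set i := Num.truncn _ in t1 t2.
have i2n : (i < (2 * n).+1)%N.
  rewrite ltnS -(ler_nat R) (le_trans t1)// natrM mulr2n mulrDl mul1r lerD2r.
  exact: rH2.
exists (Ordinal i2n) => /=.
have -> : r - (i%:R - n%:R) / H%:R = (r * H%:R + n%:R - i%:R) / H%:R.
  by field; rewrite gt_eqF.
rewrite normrM [`|H%:R^-1|]ger0_norm ?invr_ge0// ler_piMl ?invr_ge0//.
by rewrite ger0_norm ?subr_ge0// lerBlDl natr1 ltW.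
Qed.

Definition grid_point (n H : nat) (z : 'I_(2 * n).+1 * 'I_(2 * n).+1) : R[i] :=
  Complex ((z.1%:R - n%:R) / H%:R) ((z.2%:R - n%:R) / H%:R).

(** Rounding the coefficients approximates uniformly, so no exceptional set arises. An index lists
    [s] positions with rounded values; a smaller support is padded at the position [j0] with a grid
    value close to 0. *)
Lemma covered_grid (n H : nat) (t : R) : (0 < H)%N -> (0 < N)%N -> Q * H%:R <= n%:R ->
  s%:R * (2 / H%:R) <= t -> covered ((N * ((2 * n).+1 * (2 * n).+1)) ^ s) t.
Proof.
move=> H0 N0 Qn st.
exists {ffun 'I_s -> 'I_N * ('I_(2 * n).+1 * 'I_(2 * n).+1)}.
exists (fun (u : {ffun 'I_s -> 'I_N * ('I_(2 * n).+1 * 'I_(2 * n).+1)}) x =>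
  \sum_(l < s) grid_point H (u l).2 * phi (u l).1 x); split.
- by rewrite card_ffun !card_prod !card_ord.
- by move=> u; apply: cbm_sum => l _; exact: cbmZ.
move=> a ba L HL L1.
have aQ j : cmod (a j) <= Q.
  apply: (@le_trans _ _ (\sum_j cmod (a j))).
    by rewrite (bigD1 j)//= lerDl; apply: sumr_ge0 => i _; exact: cmod_ge0.
  apply: (le_of_powR hp) => //; last exact: unit_ball_l1.
  by apply: sumr_ge0 => i _; exact: cmod_ge0.
have grid (z : R[i]) : cmod z <= Q -> exists g : 'I_(2 * n).+1 * 'I_(2 * n).+1,
    cmod (z - grid_point H g) <= 2 / H%:R.
  move=> zQ.
  have [i Hi] := round_grid H0 (le_trans (normRe_le z) zQ) Qn.
  have [j Hj] := round_grid H0 (le_trans (normIm_le z) zQ) Qn.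
  exists (i, j); rewrite (le_trans (cmod_le _))// ReD ReN ImD ImN/=.
  by rewrite (le_trans (lerD Hi Hj))// le_eqVlt; apply/orP; left; apply/eqP; ring.
pose S := enum [pred j | a j != 0].
have Ss : (size S <= s)%N by rewrite -cardE; exact: ba.1.
pose j0 := Ordinal N0.
pose v l : R[i] := if (l < size S)%N then a (nth j0 S l) else 0.
have vQ l : cmod (v l) <= Q by rewrite /v; case: ifP; rewrite // cmod0 (le_trans _ Q1).
have /choice[g Hg] l := grid (v l) (vQ l).
exists [ffun l : 'I_s => (nth j0 S l, g l)].
have fE x : lin_comb phi a x = \sum_(l < s) v l * phi (nth j0 S l) x.
  rewrite /lin_comb (bigID [pred j | a j != 0])/= [X in _ + X]big1 ?addr0; last first.
    by move=> j /negbNE/eqP ->; rewrite mul0r.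
  transitivity (\sum_(j <- S) a j * phi j x); first by rewrite /S big_enum.
  rewrite (big_nth j0) big_mkord (big_ord_widen s (fun l => a (nth j0 S l) * phi (nth j0 S l) x)
    Ss) big_mkcond/=.
  by apply: eq_bigr => l _; rewrite /v; case: ifP => //; rewrite mul0r.
rewrite (_ : (fun _ => _) = fun=> 0) ?poslin0//; apply/funext => x.
rewrite ltNge (le_trans _ st)// fE -sumrB (le_trans (cmod_sum _ _ _))//.
apply: (@le_trans _ _ (\sum_(l < s) 2 / H%:R)).
  apply: ler_sum => l _; rewrite ffunE/= -mulrBl cmodM.
  by rewrite -[leRHS]mulr1 ler_pM ?cmod_ge0.
by rewrite sumr_const card_ord [leRHS]mulr_natl.
Qed.

End nets.

Lemma ln2_ge_half (R : realType) : 2^-1 <= ln 2 :> R.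
Proof.
have h : ln (1 + - 2^-1) <= - 2^-1 :> R by apply: le_ln1Dx; lra.
move: h; rewrite (_ : 1 + - 2^-1 = 2^-1 :> R); last by field.
by rewrite lnV ?posrE// lerN2.
Qed.

(** * Chaining at a single point *)

Section pointwise_chaining.
Context (R : realType) (p : R) (hp : 1 <= p <= 2).

Let p1 : 1 <= p. Proof. by case/andP: hp. Qed.
Let p2 : p <= 2. Proof. by case/andP: hp. Qed.
Let p0 : 0 < p. Proof. exact: lt_le_trans p1. Qed.

(** After division by [b ^ p] it follows from [1 - r ^ p <= 1 - r ^ 2 <= 2 * (1 - r)] for
    [0 <= r <= 1]. *)
Lemma powR_diff_le (a b : R) : 0 <= a <= b -> b `^ p - a `^ p <= 2 * b `^ (p - 1) * (b - a).
Proof.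
move=> /andP[a0 ab]; have b0 : 0 <= b by exact: le_trans ab.
have [bz|bn] := eqVneq b 0.
  have -> : a = 0 by apply/eqP; rewrite eq_le a0 -bz ab.
  by rewrite bz !subrr mulr0.
have bp : 0 < b by rewrite lt_def bn.
have -> : 2 * b `^ (p - 1) * (b - a) = b `^ p * (2 - 2 * (a / b)).
  by rewrite -(mulr_powRB1 b0 p0); field.
set r := a / b; have r0 : 0 <= r by rewrite divr_ge0.
have r1 : r <= 1 by rewrite ler_pdivrMr// mul1r.
have -> : a = b * r by rewrite /r; field.
rewrite powRM// -[X in X - _]mulr1 -mulrBr ler_wpM2l ?powR_ge0//.
have : r ^+ 2 <= r `^ p.
  have [->|rn] := eqVneq r 0; first by rewrite expr0n/= powR_ge0.
  by rewrite -powR_mulrn// ger_powR// lt_def rn r0 r1.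
have := sqr_ge0 (r - 1); nra.
Qed.

Lemma powR_dist_le (a b B : R) : 0 <= a <= B -> 0 <= b <= B ->
  `|b `^ p - a `^ p| <= 2 * B `^ (p - 1) * `|b - a|.
Proof.
have H (u v : R) : 0 <= u <= v -> v <= B ->
    v `^ p - u `^ p <= 2 * B `^ (p - 1) * (v - u).
  move=> uv vB; have /andP[u0 uv'] := uv; have v0 : 0 <= v by exact: le_trans uv'.
  rewrite (le_trans (powR_diff_le uv))// ler_wpM2r ?subr_ge0// ler_wpM2l//.
  by rewrite ge0_ler_powR ?nnegrE ?subr_ge0// (le_trans v0).
move=> /andP[a0 aB] /andP[b0 bB]; have [ab|/ltW ba] := leP a b.
  by rewrite ![`|_|]ger0_norm ?subr_ge0 ?(powR_le_powR hp)// H ?a0.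
by rewrite distrC [`|b - a|]distrC ![`|_|]ger0_norm ?subr_ge0 ?(powR_le_powR hp)// H ?b0.
Qed.

(* Cut off where a value exceeds [M * t]: such levels contribute little, and the cut makes the
   increment bounded by a multiple of [t `^ p]. *)
Definition incr (M t y z : R) : R :=
  if [&& y <= M * t, z <= M * t & `|z - y| <= 2 * t] then z `^ p - y `^ p else 0.

Lemma incr_le (M t y z : R) : 1 <= M -> 0 < t -> 0 <= y -> 0 <= z ->
  `|incr M t y z| <= 4 * M * t `^ p.
Proof.
move=> M1 t0 y0 z0; have M0 : 0 <= M by exact: le_trans M1.
rewrite /incr; case: ifPn => [/and3P[yM zM yz]|_]; last first.
  by rewrite normr0 !mulr_ge0 ?powR_ge0.
rewrite (le_trans (powR_dist_le (B := M * t) _ _)) ?y0 ?z0//.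
apply: (@le_trans _ _ (2 * (M * t) `^ (p - 1) * (2 * t))).
  by rewrite ler_wpM2l// mulr_ge0 ?powR_ge0.
have -> : 2 * (M * t) `^ (p - 1) * (2 * t) = 4 * M `^ (p - 1) * (t * t `^ (p - 1)).
  by rewrite powRM// ?(ltW t0)//; ring.
rewrite mulr_powRB1 ?(ltW t0)// ler_wpM2r ?powR_ge0// ler_wpM2l//.
by rewrite -[leRHS]powRr1// ler_powR// lerBlDr (le_trans p2).
Qed.

(** [v] stands for [F ^ p / t ^ p], which doubles from one level to the next. Below 1 the function
    is small against the level; above [D] the increment has been cut to 0. *)
Definition dyadic_weight (D v : R) : R := if v <= D then Num.min 1 v else 0.

(** The weights with [v * 2 ^+ i <= 1] form a geometric series, and only about [log2 D] doublings
    fit between 1 and [D]; hence a bound free of [n]. *)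
Lemma sum_dyadic_weight_le (D v : R) (n : nat) : 1 <= D -> 0 <= v ->
  \sum_(i < n) dyadic_weight D (v * 2 ^+ i) <= 1 + 2 * ln (2 * D).
Proof.
move=> D1 v0.
have ln2 : 1 <= 2 * ln 2 :> R by have := ln2_ge_half R; lra.
(* A bounded potential whose increment along a doubling dominates the weight. *)
pose psi u := if u <= 1 then u else 1 + 2 * ln (Num.min u (2 * D)).
have psi_top u : psi u <= 1 + 2 * ln (2 * D).
  rewrite /psi; case: ifPn => [u1|].
    by rewrite (le_trans u1)// lerDl mulr_ge0// ln_ge0//; lra.
  rewrite -ltNge => u1; rewrite lerD2l ler_wpM2l// ler_ln ?posrE ?lt_min ?ge_min ?lexx ?orbT//.
    by apply/andP; split; lra.
  lra.
have step u : 0 <= u -> dyadic_weight D u <= psi (2 * u) - psi u.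
  move=> u0; rewrite /dyadic_weight /psi.
  have [u1|u1] := leP u 1.
    have -> : u <= D by lra.
    have [u2|u2] := leP (2 * u) 1; first lra.
    (* With [y = 2 * u] between 1 and 2 and [ln y >= 1 - 1 / y], the claim becomes
       [(y - 1) * (2 - y) >= 0]. *)
    have -> : Num.min (2 * u) (2 * D) = 2 * u by apply/min_idPl; lra.
    have q0 : 0 < 2 * u by lra.
    have : ln (1 + ((2 * u)^-1 - 1)) <= (2 * u)^-1 - 1.
      by apply: le_ln1Dx; rewrite ltrBrDl subrr invr_gt0.
    rewrite addrC subrK lnV ?posrE// => h.
    have qV : (2 * u) * (2 * u)^-1 = 1 by rewrite mulfV// gt_eqF.
    set y := 2 * u in q0 u2 qV h *; set z := y^-1 in qV h.
    have z0 : 0 < z by rewrite invr_gt0.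
    have uy : u = y / 2 by rewrite /y; field.
    have y2 : y <= 2 by lra.
    have : 0 <= z * ((y - 1) * (2 - y)) by rewrite mulr_ge0 ?(ltW z0)// mulr_ge0; lra.
    have -> : z * ((y - 1) * (2 - y)) = 3 * (y * z) - y * (y * z) - 2 * z by ring.
    rewrite qV; lra.
  have -> : (2 * u <= 1) = false by apply/negbTE; rewrite -ltNge; lra.
  have [uD|uD] := leP u D.
    have -> : Num.min (2 * u) (2 * D) = 2 * u by apply/min_idPl; lra.
    have -> : Num.min u (2 * D) = u by apply/min_idPl; lra.
    by rewrite lnM ?posrE//; lra.
  rewrite subr_ge0 lerD2l ler_wpM2l// ler_ln ?posrE ?lt_min; try by apply/andP; split; lra.
  by rewrite le_min !ge_min lexx orbT andbT; apply/orP; left; lra.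
have psi0 : 0 <= psi v.
  rewrite /psi; have [//|v1] := leP v 1.
  rewrite addr_ge0// mulr_ge0// ln_ge0// le_min; apply/andP; split; lra.
apply: (@le_trans _ _ (psi (v * 2 ^+ n) - psi v)); last first.
  by have := psi_top (v * 2 ^+ n); lra.
elim: n => [|n IHn]; first by rewrite big_ord0 expr0 mulr1 subrr.
rewrite big_ord_recr/= (le_trans (lerD IHn (step _ _)))// ?mulr_ge0 ?exprn_ge0//.
by rewrite exprS (mulrCA v); lra.
Qed.

Context (n : nat) (t e z : nat -> R) (F M T : R).
Hypothesis t0 : forall i, 0 < t i.
Hypothesis tp : forall i, (i < n)%N -> t i `^ p = t 0%N `^ p / 2 ^+ i.
Hypothesis t34 : forall i, (i < n)%N -> t i.+1 <= 3 / 4 * t i.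
Hypothesis M1 : 1 <= M.
Hypothesis et : forall i, (i < n)%N -> e i <= t i /\ e i.+1 <= t i.
Hypothesis F0 : 0 <= F.
Hypothesis z0 : forall i, (i <= n)%N -> 0 <= z i.
Hypothesis zF : forall i, (i <= n)%N -> F - 2 * e i <= z i <= F.
Hypothesis T1 : n%:R <= T \/ 1 + 2 * ln (2 * (M + 2) ^+ 2) <= T.

Let h i := incr M (t i) (z i) (z i.+1).

Let dz i : (i < n)%N -> `|z i.+1 - z i| <= 2 * t i.
Proof.
move=> lin; have /andP[a1 a2] := zF (ltnW lin); have /andP[b1 b2] := zF lin.
have [e1 e2] := et lin; rewrite ler_norml; apply/andP; split; lra.
Qed.

(** An increment that is not cut forces [F <= (M + 2) * t i], since [z i <= M * t i] and
    [F <= z i + 2 * e i]. If [F <= t i], both powers lie between 0 and [F ^ p], which bounds the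
    square. Otherwise [|h i| <= 4 * F ^ (p - 1) * t i], and [t i ^ 2 <= F ^ (2 - p) * t i ^ p]
    concludes. *)
Lemma incr_sqr_le i : (i < n)%N ->
  h i ^+ 2 / t i `^ p <= 16 * F `^ p * dyadic_weight ((M + 2) ^+ 2) (F `^ p / t i `^ p).
Proof.
move=> lin; have /andP[a1 a2] := zF (ltnW lin); have /andP[b1 b2] := zF lin.
have [e1 e2] := et lin; have tt := t0 i; have M0 : 0 <= M by exact: le_trans M1.
have tip : 0 < t i `^ p by rewrite powR_gt0.
have w0 : 0 <= dyadic_weight ((M + 2) ^+ 2) (F `^ p / t i `^ p).
  by rewrite /dyadic_weight; case: ifP => // _; rewrite le_min ler01 divr_ge0 ?powR_ge0.
have rhs0 : 0 <= 16 * F `^ p * dyadic_weight ((M + 2) ^+ 2) (F `^ p / t i `^ p).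
  by rewrite mulr_ge0// mulr_ge0// powR_ge0.
rewrite /h /incr; case: ifPn => [/and3P[yM zM _]|_]; last by rewrite expr0n/= mul0r.
have FM : F <= (M + 2) * t i by rewrite mulrDl; lra.
have FD : F `^ p / t i `^ p <= (M + 2) ^+ 2.
  rewrite ler_pdivrMr//; apply: (@le_trans _ _ (((M + 2) * t i) `^ p)).
    by rewrite (powR_le_powR hp)// mulr_ge0 ?addr_ge0// ltW.
  rewrite powRM ?addr_ge0 ?(ltW tt)// ler_wpM2r ?powR_ge0// -powR_mulrn ?addr_ge0//.
  by rewrite ler_powR//; lra.
rewrite /dyadic_weight FD; set G := F `^ p.
have G0 : 0 <= G by exact: powR_ge0.
have zle (k : nat) : (k <= n)%N -> 0 <= z k `^ p <= G.
  by move=> kn; rewrite powR_ge0/= (powR_le_powR hp) ?z0// (andP (zF kn)).2.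
have dG : `|z i.+1 `^ p - z i `^ p| <= G.
  have /andP[? ?] := zle _ (ltnW lin); have /andP[? ?] := zle _ lin.
  by rewrite ler_norml; apply/andP; split; lra.
rewrite ler_pdivrMr// -real_normK ?num_real//.
have [Ft|tF] := leP F (t i).
  have Gt : G <= t i `^ p by rewrite (powR_le_powR hp)// ltW.
  have -> : Num.min 1 (G / t i `^ p) = G / t i `^ p.
    by apply/min_idPr; rewrite ler_pdivrMr// mul1r.
  have -> : 16 * G * (G / t i `^ p) * t i `^ p = 16 * G ^+ 2 by field; rewrite gt_eqF.
  apply: (@le_trans _ _ (G ^+ 2)); last by rewrite ler_peMl ?sqr_ge0// ler1n.
  by apply: lerXn2r; rewrite ?nnegrE.
have Gt : t i `^ p <= G by rewrite (powR_le_powR hp)// ltW.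
have -> : Num.min 1 (G / t i `^ p) = 1 by apply/min_idPl; rewrite ler_pdivlMr// mul1r.
have d2 : `|z i.+1 `^ p - z i `^ p| <= 4 * (F `^ (p - 1) * t i).
  rewrite (le_trans (powR_dist_le (B := F) _ _)) ?z0 ?(ltnW lin)//.
  rewrite (_ : 4 * _ = 2 * F `^ (p - 1) * (2 * t i)); last by ring.
  by rewrite ler_wpM2l ?mulr_ge0 ?powR_ge0// dz.
apply: (@le_trans _ _ ((4 * (F `^ (p - 1) * t i)) ^+ 2)).
  by apply: lerXn2r; rewrite ?nnegrE// !mulr_ge0 ?powR_ge0 ?(ltW tt).
have Fp : 0 < F by exact: lt_trans tF.
have -> : (4 * (F `^ (p - 1) * t i)) ^+ 2 = 16 * (F `^ (p - 1) ^+ 2 * t i ^+ 2) by ring.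
rewrite mulr1 -[leRHS]mulrA ler_pM2l//.
apply: (@le_trans _ _ (F `^ (p - 1) ^+ 2 * (F `^ (2 - p) * t i `^ p))).
  by rewrite ler_wpM2l ?sqr_ge0// (sqr_le_powR hp)// (ltW tt) ltW.
rewrite mulrA ler_wpM2r ?powR_ge0// -powR_mulrn ?powR_ge0// -powRrM -powRD.
  by rewrite (_ : (p - 1) * 2 + (2 - p) = p)//; ring.
by rewrite (gt_eqF Fp) implybT.
Qed.

(** Each weight is at most 1, whence the bound by the number of levels; [sum_dyadic_weight_le] gives
    the other alternative. The freedom to use either produces the minimum of the two logarithms. *)
Lemma sum_incr_sqr_le : \sum_(i < n) h i ^+ 2 / t i `^ p <= 16 * T * F `^ p.
Proof.
apply: (@le_trans _ _ (16 * F `^ p * \sum_(i < n) dyadic_weight ((M + 2) ^+ 2) (F `^ p / t i `^ p))).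
  by rewrite mulr_sumr; apply: ler_sum => i _; exact: incr_sqr_le.
rewrite -mulrA [F `^ p * _]mulrC mulrA ler_wpM2r ?powR_ge0// ler_wpM2l//.
have M0 : 0 <= M by exact: le_trans M1.
case: T1 => [nT|h2]; [apply: le_trans nT|apply: le_trans h2].
  rewrite -[n in leRHS]card_ord -sum1_card natr_sum; apply: ler_sum => i _.
  by rewrite /dyadic_weight; case: ifP => // _; rewrite ge_min lexx.
have D1 : 1 <= (M + 2) ^+ 2 by rewrite exprn_ege1//; lra.
have v0 : 0 <= F `^ p / t 0%N `^ p by rewrite divr_ge0 ?powR_ge0.
apply: le_trans (sum_dyadic_weight_le n D1 v0).
apply: ler_sum => i _; rewrite tp// invfM invrK mulrA.
by rewrite lexx.
Qed.

(** Without the cut the increments telescope to [z n ^ p], within [4 * F ^ (p - 1) * e n] of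
    [F ^ p]. The cut acts only where [t i < F / M], and these levels sum to at most [4 * F / M]. *)
Lemma sum_incr_dist : z 0%N = 0 ->
  `|\sum_(i < n) h i - F `^ p| <= 16 / M * F `^ p + 4 * F `^ (p - 1) * e n.
Proof.
move=> zz; have M0 : 0 < M by exact: lt_le_trans M1.
have skip i : (i < n)%N -> `|h i - (z i.+1 `^ p - z i `^ p)| <=
    4 * F `^ (p - 1) * (if t i < F / M then t i else 0).
  move=> lin; rewrite /h /incr.
  have /andP[a1 a2] := zF (ltnW lin); have /andP[b1 b2] := zF lin.
  have R0 : 0 <= 4 * F `^ (p - 1) * (if t i < F / M then t i else 0).
    by rewrite mulr_ge0// ?mulr_ge0 ?powR_ge0//; case: ifP => // _; rewrite ltW.
  case: ifPn => [_|]; first by rewrite subrr normr0.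
  rewrite dz// andbT => Hn.
  have tF : t i < F / M.
    rewrite ltr_pdivlMr// mulrC ltNge; apply: contra Hn => FM.
    by rewrite (le_trans a2)//= (le_trans b2).
  rewrite tF sub0r normrN (le_trans (powR_dist_le (B := F) _ _)) ?z0 ?(ltnW lin)//.
  rewrite (_ : 4 * _ * _ = 2 * F `^ (p - 1) * (2 * t i)); last by ring.
  by rewrite ler_wpM2l ?mulr_ge0 ?powR_ge0// dz.
have tele : \sum_(i < n) (z i.+1 `^ p - z i `^ p) = z n `^ p.
  rewrite -(big_mkord xpredT (fun i => z i.+1 `^ p - z i `^ p)) telescope_sumr//.
  by rewrite zz powR0 ?subr0// gt_eqF.
(* The right side is a potential: since [t m.+1 <= 3 / 4 * t m], it grows by at least [t m] at every
   level below [F / M]. *)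
have geo m : (m <= n)%N -> \sum_(i < m) (if t i < F / M then t i else 0) <=
    4 * (F / M - Num.min (t m) (F / M)).
  elim: m => [|m IHm] mn.
    by rewrite big_ord0 mulr_ge0// subr_ge0 ge_min lexx orbT.
  rewrite big_ord_recr/= (le_trans (lerD (IHm (ltnW mn)) (lexx _)))//.
  have := t34 mn; have := t0 m; case: ifPn => [tF|].
    by rewrite (min_idPl (ltW tF)) minEle; case: ifPn => // h1; lra.
  rewrite -leNgt => Ft; rewrite (min_idPr Ft) minEle; case: ifPn => ?; lra.
have -> : \sum_(i < n) h i - F `^ p =
   \sum_(i < n) (h i - (z i.+1 `^ p - z i `^ p)) + (z n `^ p - F `^ p).
  by rewrite sumrB tele; ring.
rewrite (le_trans (ler_normD _ _))// lerD//.
  rewrite (le_trans (ler_norm_sum _ _ _))//.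
  apply: le_trans (ler_sum _ (fun (i : 'I_n) _ => skip i (ltn_ord i))) _.
  rewrite -mulr_sumr; apply: (@le_trans _ _ (4 * F `^ (p - 1) * (4 * (F / M)))).
    rewrite ler_wpM2l ?mulr_ge0 ?powR_ge0// (le_trans (geo _ (leqnn _)))// ler_pM2l//.
    by rewrite gerBl le_min (ltW (t0 _)) divr_ge0 ?(ltW M0).
  by rewrite -(mulr_powRB1 F0 p0) le_eqVlt; apply/orP; left; apply/eqP; ring.
have /andP[a1 a2] := zF (leqnn n).
rewrite (le_trans (powR_dist_le (B := F) _ _)) ?z0 ?F0 ?lexx//.
rewrite (_ : 4 * _ * _ = 2 * F `^ (p - 1) * (2 * e n)); last by ring.
rewrite ler_wpM2l ?mulr_ge0 ?powR_ge0//.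
by rewrite ler_norml; apply/andP; split; lra.
Qed.

End pointwise_chaining.

(** * Error of the chain for a fixed sample *)

Section deterministic.
Context (R : realType) (p : R) (hp : 1 <= p <= 2).
Context d (T : measurableType d) (mu : probability T R).
Context (N s : nat) (phi : 'I_N -> T -> R[i]) (K : R).
Hypothesis mphi : forall j, cbm (phi j).
Hypothesis phi1 : forall j x, cmod (phi j x) <= 1.
Hypothesis K1 : 1 <= K.
Hypothesis s0 : (0 < s)%N.
Hypothesis riesz : forall a : 'I_N -> R[i], (#|[pred j | a j != 0%R]| <= 4 * s)%N ->
  \sum_j cmod (a j) ^+ 2 <= K * mean mu (fun x => cmod (lin_comb phi a x) ^+ 2).
Context (Q : R).
Hypothesis QE : Q = K * s%:R.

Let p0 : 0 <= p. Proof. by case/andP: hp => h _; exact: le_trans h. Qed.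
Let Hmu := poslin_mean mu.
Let Q1 : 1 <= Q. Proof. by rewrite QE mulr_ege1// ler1n. Qed.
Let Q0 : 0 < Q. Proof. exact: lt_le_trans Q1. Qed.

Local Notation lev := (lev p Q).
Local Notation unit_ball := (unit_ball p mu s phi).

(** Lowering [|g|] by [e] keeps the approximation below [|f|] wherever [g] is within [e] of [f].
    Otherwise an increment at a level far above [|f|] could not be bounded by [|f| ^ p]. *)
Definition soft (e : R) (g : T -> R[i]) (x : T) : R := Num.max 0 (cmod (g x) - e).

Lemma soft_bounds (e : R) (f g : T -> R[i]) x : cmod (f x - g x) <= e ->
  cmod (f x) - 2 * e <= soft e g x <= cmod (f x).
Proof.
move=> fg; have := le_trans (cmod_dist (f x) (g x)) fg; rewrite ler_norml => /andP[h1 h2].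
have f0 := cmod_ge0 (f x); rewrite /soft maxEle; case: ifPn => [|]; rewrite -?ltNge => ?;
  apply/andP; split; lra.
Qed.

Lemma bm_soft e g : cbm g -> bm (soft e g).
Proof.
by move=> mg; apply: bm_max; [exact: bm_cst|apply: bmB; [exact: bm_cmod|exact: bm_cst]].
Qed.

Context (n : nat) (e : nat -> R) (U : nat -> finType) (c : forall i, U i -> T -> R[i]).
Context (eta M Tb : R).
Hypothesis eta0 : 0 <= eta.
Hypothesis M1 : 1 <= M.
Hypothesis Tb1 : n%:R <= Tb \/ 1 + 2 * ln (2 * (M + 2) ^+ 2) <= Tb.
Hypothesis elev : forall i, (i < n)%N -> e i <= lev i /\ e i.+1 <= lev i.
Hypothesis n0 : (0 < n)%N.
Hypothesis e0 : e 0%N = lev 0%N.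
Hypothesis en0 : 0 <= e n.
Hypothesis mc : forall i (u : U i), cbm (c u).
Hypothesis covc : forall i a, unit_ball a -> forall L : (T -> R) -> R,
  poslin L -> L (fun=> 1) = 1 ->
  exists u : U i, L (fun x => (e i < cmod (lin_comb phi a x - c u x))%R%:R) <= eta.

(* At the coarsest level 0 is a good approximation, because [cmod (f x) <= lev 0]. *)
Definition clev i (u : U i) (x : T) : R := if i == 0%N then 0 else soft (e i) (c u) x.

(** Determined by two net points, without reference to [a] or to the sample: the finite family for
    the union bound. *)
Definition link i (u : U i) (v : U i.+1) (x : T) : R :=
  incr p M (lev i) (clev u x) (clev v x).

Lemma clev_ge0 i (u : U i) x : 0 <= clev u x.
Proof. by rewrite /clev; case: ifP => // _; rewrite /soft le_max lexx. Qed.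

Lemma bm_clev i (u : U i) : bm (clev u).
Proof. by rewrite /clev; case: (i == 0%N); [exact: bm_cst|exact: bm_soft]. Qed.

Lemma link_le i (u : U i) (v : U i.+1) x : `|link u v x| <= 4 * M * lev i `^ p.
Proof. by apply: incr_le => //; [exact: (lev_gt0 p Q1)|exact: clev_ge0..]. Qed.

Lemma bm_link i (u : U i) (v : U i.+1) : bm (link u v).
Proof.
split; last by exists (4 * M * lev i `^ p); exact: link_le.
have mu1 := bm_clev u; have mv := bm_clev v.
have mcst (r : R) : measurable_fun setT (cst r : T -> R) by exact: measurable_cst.
apply: measurable_fun_ifT; last exact: mcst.
- apply: measurable_and; first by apply: measurable_fun_ler; [exact: mu1.1|exact: mcst].
  apply: measurable_and; first by apply: measurable_fun_ler; [exact: mv.1|exact: mcst].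
  apply: measurable_fun_ler; last exact: mcst.
  exact: (bm_norm (bmB mv mu1)).1.
- have H j (w : U j) : bm (fun x => clev w x `^ p).
    by apply: bm_powR => //; [exact: bm_clev|exact: clev_ge0].
  exact: (bmB (H _ v) (H _ u)).1.
Qed.

Context (L : (T -> R) -> R) (HL : poslin L) (L1 : L (fun=> 1) = 1).
Context (kap w : R).
Hypothesis kap0 : 0 <= kap.
Hypothesis conc : forall i, (i < n)%N -> forall (u : U i) (v : U i.+1),
  `|L (link u v) - mean mu (link u v)| <=
  2 * (kap / lev i `^ p) * mean mu (fun x => link u v x ^+ 2) + w.

(** Crude bounds for [|S - F|] and for the weighted sum of squares on the exceptional set, where
    they are multiplied by its small measure. *)
Let Bs := n%:R * (4 * M * Q) + Q.
Let Bq := n%:R * (16 * M ^+ 2 * Q).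

(** The net points [u i] are chosen for the average of [L] and [mu], so the same sum [S] of links
    replaces [F] under both functionals. The remaining difference [L S - mean mu S] is controlled
    link by link through [conc], and the variance terms add up by [sum_incr_sqr_le]. The unknown
    [L F] stays on the right, to be absorbed by [near_one]. *)
Lemma chaining_error a : unit_ball a ->
  let F x := cmod (lin_comb phi a x) `^ p in
  (`|L F - mean mu F| <= 16 / M * (L F + mean mu F) + 8 * Q * e n
    + 4 * n.+1%:R * eta * Bs + 2 * kap * (16 * Tb + 2 * n.+1%:R * eta * Bq) + n%:R * w)%R.
Proof.
move=> ba /=; set F := fun x => _; case/andP: (hp) => p1 p2.
have l0 j := lev_gt0 p Q1 j.
have M0 : 0 < M by exact: lt_le_trans M1.
have mf : cbm (lin_comb phi a) by exact: cbm_lin_comb.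
have mF : bm F by exact: bm_cmod_powR.
have F0 x : 0 <= F x by exact: powR_ge0.
have IF1 : mean mu F <= 1 by exact: ba.2.
have avg1 : (L (fun=> 1) + mean mu (fun=> 1)) / 2 = 1 by rewrite L1 mean1; field.
pose u i : U i := projT1 (cid (covc i ba (poslin_avg HL Hmu) avg1)).
pose badi i x : R := (e i < cmod (lin_comb phi a x - c (u i) x))%R%:R.
have mbadi i : bm (badi i) by apply: bm_cmod_gt; exact: cbmB.
have badi0 i x : 0 <= badi i x by rewrite /badi.
have Hbad i : L (badi i) <= 2 * eta /\ mean mu (badi i) <= 2 * eta.
  have := projT2 (cid (covc i ba (poslin_avg HL Hmu) avg1)); rewrite -/(u i) -/(badi i).
  have := poslin_ge0 HL (mbadi i) (badi0 i).
  have := poslin_ge0 Hmu (mbadi i) (badi0 i).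
  by move=> *; split; lra.
(* Counts the levels at which [x] is exceptional: below 1 there are none. *)
pose bad x := \sum_(i < n.+1) badi i x.
have mbad : bm bad by apply: bm_sum => i _.
have bad0 x : 0 <= bad x by apply: sumr_ge0 => i _.
have sum_eta : \sum_(i < n.+1) 2 * eta = 2 * n.+1%:R * eta.
  by rewrite sumr_const card_ord -mulr_natr; ring.
have Lbad : L bad <= 2 * n.+1%:R * eta.
  by rewrite (poslin_sum HL)// -sum_eta; apply: ler_sum => i _; exact: (Hbad i).1.
have Ibad : mean mu bad <= 2 * n.+1%:R * eta.
  by rewrite (poslin_sum Hmu)// -sum_eta; apply: ler_sum => i _; exact: (Hbad i).2.
have good_or_bad x : (forall i, (i <= n)%N ->
    cmod (lin_comb phi a x - c (u i) x) <= e i) \/ 1 <= bad x.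
  have [h|] := pselect (exists i, (i <= n)%N /\ e i < cmod (lin_comb phi a x - c (u i) x)).
    right; have [i [lin hi]] := h; have lin' : (i < n.+1)%N by [].
    rewrite /bad (bigD1 (Ordinal lin'))//= {1}/badi hi lerDl.
    by apply: sumr_ge0 => j _.
  move=> h; left=> i lin; rewrite leNgt; apply/negP => hi; apply: h; by exists i.
pose hh i := link (u i) (u i.+1).
have mhh i : bm (hh i) by exact: bm_link.
have mhh2 i : bm (fun x => hh i x ^+ 2) by under eq_fun do rewrite expr2; exact: bmM.
pose S x := \sum_(i < n) hh i x.
have mS : bm S by apply: bm_sum.
have hQ i x : `|hh i x| <= 4 * M * Q.
  by rewrite (le_trans (link_le _ _ _))// ler_wpM2l ?(lev_powR_le hp Q1)// ?mulr_ge0// ltW.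
have Bs0 : 0 <= Bs by rewrite addr_ge0 ?mulr_ge0 ?(ltW M0) ?(ltW Q0).
have Bq0 : 0 <= Bq by rewrite !mulr_ge0 ?exprn_ge0 ?(ltW M0) ?(ltW Q0).
have FQ x : F x <= Q by exact: (unit_ball_sup hp mphi phi1 K1 s0 riesz QE).
have Tb0 : 0 <= Tb.
  case: Tb1 => h; first exact: le_trans h.
  apply: le_trans h; rewrite addr_ge0// mulr_ge0// ln_ge0//.
  have : 1 <= (M + 2) ^+ 2 by rewrite exprn_ege1//; lra.
  lra.
have zF x (Hg : forall i, (i <= n)%N -> cmod (lin_comb phi a x - c (u i) x) <= e i) i :
    (i <= n)%N -> cmod (lin_comb phi a x) - 2 * e i <= clev (u i) x <= cmod (lin_comb phi a x).
  move=> lin; rewrite /clev; case: eqP => [i0|_]; last exact: soft_bounds (Hg i lin).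
  subst i; rewrite cmod_ge0 andbT e0.
  have : cmod (lin_comb phi a x) <= lev 0.
    rewrite -(powR_le_powR hp) ?cmod_ge0 ?(ltW (l0 _))// (lev_powR hp Q1) expr0 divr1.
    exact: FQ.
  by have := l0 0%N; lra.
have cF0 x : 0 <= cmod (lin_comb phi a x) by exact: cmod_ge0.
have tp i : (i < n)%N -> lev i `^ p = lev 0 `^ p / 2 ^+ i.
  by move=> _; rewrite !(lev_powR hp Q1) expr0 divr1.
have pt1 x : `|S x - F x| <= 16 / M * F x + 4 * Q * e n + bad x * Bs.
  have r0 : 0 <= 16 / M * F x + 4 * Q * e n.
    by rewrite addr_ge0// mulr_ge0 ?divr_ge0 ?(ltW M0)// mulr_ge0// ltW.
  have [Hg|bad1] := good_or_bad x.
    apply: (@le_trans _ _ (16 / M * F x + 4 * Q * e n)); last by rewrite lerDl mulr_ge0.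
    apply: le_trans (sum_incr_dist hp l0 (fun i _ => levS_le34 hp Q1 i) M1 elev (cF0 x)
      (fun i _ => clev_ge0 (u i) x) (zF x Hg) _) _ => //.
    rewrite lerD2l ler_wpM2r// ler_wpM2l//.
    apply: (@le_trans _ _ (Q `^ (p - 1))).
      rewrite ge0_ler_powR ?nnegrE ?subr_ge0 ?(ltW Q0)//.
      exact: (unit_ball_sup1 hp mphi phi1 K1 s0 riesz QE).
    by rewrite -[leRHS]powRr1 ?(ltW Q0)// ler_powR// lerBlDr (le_trans p2).
  apply: (@le_trans _ _ Bs); last by rewrite -[leLHS]add0r lerD// ler_peMl.
  rewrite (le_trans (ler_normB _ _))// lerD//; last by rewrite ger0_norm.
  rewrite (le_trans (ler_norm_sum _ _ _))//.
  apply: le_trans (ler_sum _ (fun (i : 'I_n) _ => hQ i x)) _.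
  by rewrite sumr_const card_ord [leRHS]mulr_natl.
have pt2 x : \sum_(i < n) hh i x ^+ 2 / lev i `^ p <= 16 * Tb * F x + bad x * Bq.
  have r0 : 0 <= 16 * Tb * F x by rewrite mulr_ge0// mulr_ge0.
  have [Hg|bad1] := good_or_bad x.
    apply: (@le_trans _ _ (16 * Tb * F x)); last by rewrite lerDl mulr_ge0.
    exact: (sum_incr_sqr_le hp l0 tp M1 elev (cF0 x) (fun i _ => clev_ge0 (u i) x) (zF x Hg) Tb1).
  apply: (@le_trans _ _ Bq); last by rewrite -[leLHS]add0r lerD// ler_peMl.
  apply: (@le_trans _ _ (\sum_(i < n) 16 * M ^+ 2 * Q)); last first.
    by rewrite sumr_const card_ord [leRHS]mulr_natl.
  apply: ler_sum => i _; have tip : 0 < lev i `^ p by rewrite powR_gt0// l0.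
  rewrite ler_pdivrMr// -real_normK ?num_real//.
  apply: (@le_trans _ _ ((4 * M * lev i `^ p) ^+ 2)).
    by apply: lerXn2r; rewrite ?nnegrE ?link_le// !mulr_ge0 ?(ltW M0) ?(ltW tip).
  have -> : (4 * M * lev i `^ p) ^+ 2 = 16 * M ^+ 2 * lev i `^ p * lev i `^ p by ring.
  rewrite ler_wpM2r ?(ltW tip)// ler_wpM2l ?(lev_powR_le hp Q1)//.
  by rewrite mulr_ge0 ?exprn_ge0// ltW.
have approxS (L' : (T -> R) -> R) : poslin L' -> L' (fun=> 1) = 1 -> L' bad <= 2 * n.+1%:R * eta ->
    `|L' S - L' F| <= 16 / M * L' F + 4 * Q * e n + 2 * n.+1%:R * eta * Bs.
  move=> HL' L'1 L'bad; rewrite -(poslinB HL')//.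
  have m1 := bm_cst T (1 : R).
  apply: (@le_trans _ _ (L' (fun x => 16 / M * F x + 4 * Q * e n * 1 + Bs * bad x))).
    apply: (poslin_norm HL'); [exact: bmB|by do ?[apply: bmD|apply: bmZ]|].
    by move=> x; rewrite mulr1 [Bs * _]mulrC.
  rewrite !(poslinD HL') ?(poslinZ HL') ?L'1//; try by do ?[apply: bmD|apply: bmZ].
  by rewrite mulr1 lerD2l mulrC ler_wpM2r.
have mid : `|L S - mean mu S| <= 2 * kap * (16 * Tb + 2 * n.+1%:R * eta * Bq) + n%:R * w.
  rewrite (poslin_sum HL)// (poslin_sum Hmu)// -sumrB.
  rewrite (le_trans (ler_norm_sum _ _ _))//.
  apply: le_trans (ler_sum _ (fun (i : 'I_n) _ => conc (ltn_ord i) (u i) (u i.+1))) _.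
  rewrite big_split/= sumr_const card_ord [n%:R * w]mulr_natl lerD2r.
  have mq (i : 'I_n) : bm (fun x => (lev i `^ p)^-1 * hh i x ^+ 2) by exact: bmZ.
  rewrite (eq_bigr (fun i : 'I_n => 2 * kap * mean mu (fun x => (lev i `^ p)^-1 * hh i x ^+ 2)));
    last first.
    by move=> i _; rewrite (poslinZ Hmu)//; ring.
  rewrite -mulr_sumr ler_wpM2l ?mulr_ge0//.
  rewrite -(poslin_sum Hmu)//.
  apply: (@le_trans _ _ (mean mu (fun x => 16 * Tb * F x + Bq * bad x))).
    apply: (poslin_le Hmu); [exact: bm_sum|by do ?[apply: bmD|apply: bmZ]|move=> x].
    by rewrite [Bq * _]mulrC (le_trans _ (pt2 x))//; apply: ler_sum => i _; rewrite mulrC.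
  rewrite (poslinD Hmu) ?(poslinZ Hmu)//; try by apply: bmZ.
  rewrite lerD//; first by rewrite -[leRHS]mulr1 ler_wpM2l// mulr_ge0.
  by rewrite mulrC ler_wpM2r.
have aL := approxS L HL L1 Lbad.
have aI := approxS (mean mu) Hmu (mean1 mu) Ibad.
move: aL aI mid; rewrite !ler_norml => /andP[? ?] /andP[? ?] /andP[? ?].
by apply/andP; split; lra.
Qed.

End deterministic.

(** * Empirical mean and union bound *)

Section empirical_mean.
Context (R : realType) d (T : measurableType d) (m : nat) (x : 'I_m -> T).

Definition emean (g : T -> R) : R := m%:R^-1 * \sum_(j < m) g (x j).

Lemma poslin_emean : poslin emean.
Proof.
split => [f g _ _|c f _|f g _ _ fg]; rewrite /emean.
- by rewrite big_split/= mulrDr.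
- by rewrite -mulr_sumr mulrCA.
- by rewrite ler_wpM2l ?invr_ge0//; apply: ler_sum.
Qed.

Lemma emean1 : (0 < m)%N -> emean (fun=> 1) = 1.
Proof. by move=> m0; rewrite /emean sumr_const card_ord mulVf// pnatr_eq0 -lt0n. Qed.

End empirical_mean.

Section union_bound.
Context (R : realType) d d' (T : measurableType d) (mu : probability T R)
  (W : measurableType d') (P : probability W R) (m : nat) (xi : 'I_m -> {RV P >-> T}).
Hypothesis m0 : (0 < m)%N.
Hypothesis indxi : mutually_independent xi.
Hypothesis muxi : forall E : set T, measurable E ->
  mu E = ((m%:R^-1)%:E * \sum_(j < m) P (xi j @^-1` E))%E.

(** [Bernstein] for [h] and [- h]. The union bound is the pointwise inequality [1 - bad <= \1_G],
    where [bad] counts the failures, integrated against [P]. *)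
Lemma concentration_union_bound (n : nat) (X : 'I_n -> finType) (h : forall i, X i -> T -> R)
    (k t : 'I_n -> R) (G : set W) : measurable G ->
  (forall i x, bm (h i x)) -> (forall i, 0 < k i) ->
  (forall i x y, k i * `|h i x y| <= 1) ->
  (forall w, (forall i x, `|emean (fun j => xi j w) (h i x) - mean mu (h i x)| <=
      2 * k i * mean mu (fun y => h i x y ^+ 2) + t i / (k i * m%:R)) -> G w) ->
  ((1 - \sum_(i < n) 2 * #|X i|%:R * expR (- t i))%:E <= P G)%E.
Proof.
move=> mG mh k0 kh HG; have HP := poslin_mean P.
have mR : 0 < m%:R :> R by rewrite ltr0n.
pose sg (b : bool) i x y : R := (-1) ^+ b * h i x y.
have msg b i x : bm (sg b i x) by exact: bmZ.
have ksg b i x y : k i * sg b i x y <= 1.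
  rewrite (le_trans _ (kh i x y))// ler_wpM2l ?(ltW (k0 i))// (le_trans (ler_norm _))//.
  by rewrite /sg normrMsign.
pose A b i x := [set w | m%:R * mean mu (sg b i x)
     + 2 * k i * (m%:R * mean mu (fun y => sg b i x y ^+ 2)) + t i / k i
     < \sum_(j < m) sg b i x (xi j w)].
have HA b i x : measurable (A b i x) /\ (P (A b i x) <= (expR (- t i))%:E)%E.
  exact: (Bernstein m0 indxi muxi (t i) (msg b i x) (k0 i) (ksg b i x)).
have bmA b i x : bm (\1_(A b i x) : W -> R) by apply: bm_indic; exact: (HA b i x).1.
pose bad w := \sum_(i < n) \sum_(x : X i) (\1_(A false i x) w + \1_(A true i x) w) : R.
have mbad : bm bad.
  by apply: bm_sum => i _; apply: bm_sum => x _; exact: bmD.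
have bad0 w : 0 <= bad w.
  by apply: sumr_ge0 => i _; apply: sumr_ge0 => x _; rewrite addr_ge0.
rewrite -mean_indic// lee_fin.
apply: (@le_trans _ _ (mean P (fun w => 1 - bad w))); last first.
  apply: (poslin_le HP); [apply: bmB => //; exact: bm_cst|exact: bm_indic|move=> w].
  rewrite indicE; case: (boolP (w \in G)) => [_|wG]; first by rewrite gerBl.
  rewrite subr_le0 leNgt; apply/negP => bad1; move/negP: wG; apply; rewrite inE.
  apply: HG => i x.
  have notA b : ~ A b i x w.
    move=> Aw; have : 1 <= bad w; last by rewrite leNgt bad1.
    rewrite /bad (bigD1 i)//= (bigD1 x)//=.
    have h1 : 0 <= \sum_(i0 < n | i0 != i) \sum_(x0 : X i0)
        (\1_(A false i0 x0) w + \1_(A true i0 x0) w) :> R.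
      by apply: sumr_ge0 => ? _; apply: sumr_ge0 => ? _; rewrite addr_ge0.
    have h2 : 0 <= \sum_(x0 | x0 != x) (\1_(A false i x0) w + \1_(A true i x0) w) :> R.
      by apply: sumr_ge0 => ? _; rewrite addr_ge0.
    have Eb : \1_(A b i x) w = 1 :> R by rewrite indicE mem_set.
    have h3 b' : 0 <= \1_(A b' i x) w :> R by rewrite indicE.
    have := h3 true; have := h3 false; move: Eb; case: b {Aw} => ->; lra.
  have sgI b : mean mu (sg b i x) = (-1) ^+ b * mean mu (h i x).
    by rewrite (poslinZ (poslin_mean mu)).
  have sg2 b : mean mu (fun y => sg b i x y ^+ 2) = mean mu (fun y => h i x y ^+ 2).
    by congr (mean mu _); apply/funext => y; rewrite /sg exprMn sqrr_sign mul1r.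
  have sgS b : \sum_(j < m) sg b i x (xi j w) = (-1) ^+ b * (m%:R * emean (fun j => xi j w) (h i x)).
    by rewrite /emean mulVKf ?gt_eqF// mulr_sumr.
  have HH (b : bool) : (-1) ^+ b * (emean (fun j => xi j w) (h i x) - mean mu (h i x)) <=
      2 * k i * mean mu (fun y => h i x y ^+ 2) + t i / (k i * m%:R).
    have /negP := notA b; rewrite /A/= -leNgt sgI sg2 sgS => H.
    rewrite -(ler_pM2l mR) !mulrDr.
    have -> : m%:R * (t i / (k i * m%:R)) = t i / k i by field; rewrite !gt_eqF.
    lra.
  rewrite ler_norml; have := HH false; have := HH true.
  rewrite expr1 expr0 mulN1r mul1r => ? ?; apply/andP; split; lra.
rewrite (poslinB HP)//; last exact: bm_cst.
rewrite (mean1 P) lerD2l lerN2 (poslin_sum HP) => [|i _]; last first.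
  by apply: bm_sum => x _; exact: bmD.
apply: ler_sum => i _; rewrite (poslin_sum HP) => [|x _]; last exact: bmD.
apply: (@le_trans _ _ (\sum_(x : X i) 2 * expR (- t i))).
  apply: ler_sum => x _; rewrite (poslinD HP)//.
  have HPA b : mean P (\1_(A b i x)) <= expR (- t i).
    by rewrite -lee_fin mean_indic ?(HA b i x).2//; exact: (HA b i x).1.
  by have := HPA true; have := HPA false; lra.
by rewrite sumr_const -mulr_natr le_eqVlt; apply/orP; left; apply/eqP; ring.
Qed.

End union_bound.

(** * Measurability of the event, and normalization *)

Section sigma_sparse.
Context (R : realType) (p : R) (hp : 1 <= p <= 2).
Context d (T : measurableType d) (mu : probability T R).
Context (N s : nat) (phi : 'I_N -> T -> R[i]).
Hypothesis mphi : forall j, cbm (phi j).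
Hypothesis phi1 : forall j x, cmod (phi j x) <= 1.

Let p1 : 1 <= p. Proof. by case/andP: hp. Qed.
Let p0 : 0 < p. Proof. exact: lt_le_trans p1. Qed.

Definition span_elt (J : {set 'I_N}) (a : 'I_N -> R[i]) (x : T) : R[i] :=
  \sum_(j in J) a j * phi j x.

Lemma cbm_span_elt J a : cbm (span_elt J a).
Proof. by apply: cbm_sum => j _; exact: cbmZ. Qed.

Lemma span_elt_lin_comb J a :
  span_elt J a = lin_comb phi (fun j => if j \in J then a j else 0).
Proof.
apply/funext => x; rewrite /span_elt /lin_comb big_mkcond/=; apply: eq_bigr => j _.
by case: ifP => // _; rewrite mul0r.
Qed.

Lemma span_elt_support (J : {set 'I_N}) (a : 'I_N -> R[i]) :
  (#|[pred j | (if j \in J then a j else 0%R) != 0%R]| <= #|J|)%N.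
Proof.
apply: subset_leq_card; apply/fintype.subsetP => j; rewrite !inE.
by case: ifP => //; rewrite eqxx.
Qed.

Definition discretizes1 (eps : R) (m : nat) (x : 'I_m -> T) (f : T -> R[i]) : bool :=
  (1 - eps) * pmean p mu f <= emean x (fun y => cmod (f y) `^ p) <= (1 + eps) * pmean p mu f.

Lemma discretizesE eps m (x : 'I_m -> T) : discretizes mu p eps x (Sigma_sparse phi s) <->
  forall (J : {set 'I_N}) a, #|J| = s -> discretizes1 eps x (span_elt J a).
Proof.
have E J a : ((1 - eps)%:E * cLnorm mu p (span_elt J a) `^ p
       <= (m%:R^-1 * \sum_(j < m) cmod (span_elt J a (x j)) `^ p)%:E
       <= (1 + eps)%:E * cLnorm mu p (span_elt J a) `^ p)%E = discretizes1 eps x (span_elt J a).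
  by rewrite cLnorm_powR//; exact: cbm_span_elt.
split => [H J a Js|H f [J Js [a ->]]].
  by rewrite -E; apply: H; exists J => //; exists a.
by have := H J a Js; rewrite -E.
Qed.

Definition rat_coef (q : {ffun 'I_N -> rat * rat}) (j : 'I_N) : R[i] :=
  Complex (ratr (q j).1) (ratr (q j).2).

(** [B] bounds both moduli, its summand 1 leaving room for the error; [powR_dist_le] then turns the
    uniform error [N * r] into one of at most [tau] between [p]-th powers. *)
Lemma rat_coef_dense (J : {set 'I_N}) (a : 'I_N -> R[i]) (tau : R) : 0 < tau ->
  exists q, forall y, `|cmod (span_elt J (rat_coef q) y) `^ p - cmod (span_elt J a y) `^ p| <= tau.
Proof.
move=> tau0; pose B : R := 1 + \sum_j cmod (a j).
have B1 : 1 <= B by rewrite lerDl; apply: sumr_ge0 => j _; exact: cmod_ge0.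
have B0 : 0 < B by exact: lt_le_trans B1.
have Bp : 0 < B `^ (p - 1) by exact: powR_gt0.
pose r := Num.min 1 (tau / (2 * B `^ (p - 1))) / N.+1%:R.
have r0 : 0 < r by rewrite divr_gt0// lt_min ltr01/= divr_gt0// mulr_gt0.
have Nr : N%:R * r <= Num.min 1 (tau / (2 * B `^ (p - 1))).
  rewrite /r mulrCA ler_piMr//; first by rewrite le_min ler01/= divr_ge0 ?(ltW tau0)// mulr_ge0// ltW.
  by rewrite ler_pdivrMr// mul1r ler_nat.
have near (u : R) : exists q : rat, `|ratr q - u| <= r / 2.
  have [|q] := @rat_in_itvoo R (u - r / 2) (u + r / 2); first lra.
  rewrite in_itv/= => /andP[h1 h2]; exists q; rewrite ler_norml; apply/andP; split; lra.
have /choice[q Hq] j : exists q : rat * rat, cmod (Complex (ratr q.1) (ratr q.2) - a j) <= r.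
  have [q1 h1] := near (complex.Re (a j)); have [q2 h2] := near (complex.Im (a j)).
  exists (q1, q2); rewrite (le_trans (cmod_le _))// ReD ReN ImD ImN/=; lra.
exists [ffun j => q j] => y; set f := span_elt J _; set g := span_elt J a.
have fg : cmod (f y - g y) <= N%:R * r.
  rewrite /f /g /span_elt -sumrB (le_trans (cmod_sum _ _ _))//.
  apply: (@le_trans _ _ (\sum_(j in J) r)).
    apply: ler_sum => j _; rewrite -mulrBl cmodM -[leRHS]mulr1 ler_pM ?cmod_ge0//.
    by rewrite /rat_coef ffunE; exact: Hq.
  rewrite sumr_const -[leLHS]mulr_natl ler_wpM2r ?(ltW r0)// ler_nat.
  by rewrite (leq_trans (max_card _))// card_ord.
have gB : cmod (g y) <= \sum_j cmod (a j).
  rewrite /g span_elt_lin_comb (le_trans (lin_comb_le _ _ phi1))//.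
  by apply: ler_sum => j _; case: ifP => // _; rewrite cmod0 cmod_ge0.
have [Nr1 Nr2] : N%:R * r <= 1 /\ N%:R * r <= tau / (2 * B `^ (p - 1)).
  by move: Nr; rewrite le_min => /andP[].
have fgB : `|cmod (f y) - cmod (g y)| <= N%:R * r by exact: le_trans (cmod_dist _ _) fg.
rewrite (le_trans (powR_dist_le hp (B := B) _ _))//.
- by rewrite cmod_ge0/= /B; lra.
- rewrite cmod_ge0/= /B; move: fgB; rewrite ler_norml => /andP[_ ?]; lra.
rewrite -ler_pdivlMl ?mulr_gt0// mulrC.
exact: le_trans Nr2.
Qed.

(** The condition ranges over uncountably many functions. Rational coefficients reduce it to a
    countable intersection, and the two closed inequalities pass to the limit because the
    approximation is uniform in the point, hence good for the integral and for the empirical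
    mean. *)
Lemma measurable_discretizes d' (W : measurableType d') (P : probability W R) (m : nat)
    (xi : 'I_m -> {RV P >-> T}) (eps : R) :
  measurable [set w | discretizes mu p eps (fun j => xi j w) (Sigma_sparse phi s)].
Proof.
pose E (z : {set 'I_N} * {ffun 'I_N -> rat * rat}) : set W :=
  [set w | #|z.1| = s -> discretizes1 eps (fun j => xi j w) (span_elt z.1 (rat_coef z.2))].
have mE z : measurable (E z).
  have [zs|zs] := pselect (#|z.1| = s); last first.
    by have -> : E z = setT by apply/seteqP; split => w //= _ /zs.
  set f := span_elt z.1 (rat_coef z.2).
  have mf : cbm f by exact: cbm_span_elt.
  have mg : bm (fun w => emean (fun j => xi j w) (fun y => cmod (f y) `^ p)).
    apply: bmZ; apply: bm_sum => j _.
    by apply: (@bm_RV _ _ _ _ _ _ _ (fun y => cmod (f y) `^ p)); apply: bm_cmod_powR => //; exact: ltW.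
  rewrite (_ : E z = setT `&` (fun w => emean (fun j => xi j w) (fun y => cmod (f y) `^ p)) @^-1`
     `[(1 - eps) * pmean p mu f, (1 + eps) * pmean p mu f]).
    by apply: mg.1 => //; exact: measurable_itv.
  apply/seteqP; split => w /=; rewrite /E/= in_itv/=.
    by move=> /(_ zs).
  by case.
rewrite (_ : [set w | _] = \bigcap_(k : nat) (if unpickle k is Some z then E z else setT)).
  by apply: bigcapT_measurable => k; case: (unpickle k).
apply/seteqP; split => w /=.
  move=> /discretizesE H k _; case: (unpickle k) => // z zs; exact: H.
move=> H; apply/discretizesE => J a Js.
have Hq q : discretizes1 eps (fun j => xi j w) (span_elt J (rat_coef q)).
  by have := H (pickle (J, q)) I; rewrite pickleK; apply.
set f := span_elt J a; have mf : cbm f by exact: cbm_span_elt.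
have p0' := ltW p0.
have mF : bm (fun y => cmod (f y) `^ p) by exact: bm_cmod_powR.
have close tau : 0 < tau -> exists I' E' : R, [/\ (1 - eps) * I' <= E' <= (1 + eps) * I',
    `|I' - pmean p mu f| <= tau &
    `|E' - emean (fun j => xi j w) (fun y => cmod (f y) `^ p)| <= tau].
  move=> tau0; have [q q_close] := rat_coef_dense J a tau0.
  set g := span_elt J (rat_coef q) in q_close.
  have mg : cbm g by exact: cbm_span_elt.
  have mG : bm (fun y => cmod (g y) `^ p) by exact: bm_cmod_powR.
  have L_close (L : (T -> R) -> R) : poslin L -> L (fun=> 1) <= 1 ->
      `|L (fun y => cmod (g y) `^ p) - L (fun y => cmod (f y) `^ p)| <= tau.
    move=> HL L1; rewrite -(poslinB HL)//.
    apply: (@le_trans _ _ (L (fun y => tau * 1))).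
      apply: (poslin_norm HL) => [||y]; [exact: bmB|exact: bm_cst|].
      by rewrite mulr1; exact: q_close.
    by rewrite (poslinZ HL) ?ler_piMr// ?(ltW tau0)//; exact: bm_cst.
  exists (pmean p mu g), (emean (fun j => xi j w) (fun y => cmod (g y) `^ p)); split.
  - exact: Hq.
  - by apply: L_close; [exact: poslin_mean|rewrite mean1].
  - apply: L_close; first exact: poslin_emean.
    rewrite /emean sumr_const card_ord.
    by have [->|m0] := eqVneq (m%:R : R) 0; rewrite ?mulr0 ?ler01// mulVf.
rewrite /discretizes1; set I0 := pmean _ _ _ in close *; set E0 := emean _ _ in close *.
have e1 : 0 < 1 + `|1 - eps| + `|1 + eps| by rewrite ltr_wpDr// ltr_wpDr.
apply/andP; split; apply/ler_addgt0Pr => tau tau0.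
  have [|I' [E' [/andP[h1 _] h2 h3]]] := close (tau / (1 + `|1 - eps| + `|1 + eps|)).
    exact: divr_gt0.
  set r := tau / _ in h2 h3.
  have rE : r * (1 + `|1 - eps| + `|1 + eps|) = tau by rewrite /r divfK// gt_eqF.
  have : `|(1 - eps) * (I0 - I')| <= `|1 - eps| * r by rewrite normrM (distrC I0) ler_wpM2l.
  have r0 : 0 <= `|1 + eps| * r by rewrite mulr_ge0// divr_ge0 ?(ltW tau0) ?(ltW e1).
  move: h3; rewrite !ler_norml => /andP[? ?] /andP[? ?].
  by rewrite -rE; lra.
have [|I' [E' [/andP[_ h1] h2 h3]]] := close (tau / (1 + `|1 - eps| + `|1 + eps|)).
  exact: divr_gt0.
set r := tau / _ in h2 h3.
have rE : r * (1 + `|1 - eps| + `|1 + eps|) = tau by rewrite /r divfK// gt_eqF.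
have : `|(1 + eps) * (I0 - I')| <= `|1 + eps| * r by rewrite normrM (distrC I0) ler_wpM2l.
have r0 : 0 <= `|1 - eps| * r by rewrite mulr_ge0// divr_ge0 ?(ltW tau0) ?(ltW e1).
move: h3; rewrite !ler_norml => /andP[? ?] /andP[? ?].
by rewrite -rE; lra.
Qed.

Context (K Q : R).
Hypothesis K1 : 1 <= K.
Hypothesis s0 : (0 < s)%N.
Hypothesis riesz : forall a : 'I_N -> R[i], (#|[pred j | a j != 0%R]| <= 4 * s)%N ->
  \sum_j cmod (a j) ^+ 2 <= K * mean mu (fun x => cmod (lin_comb phi a x) ^+ 2).
Hypothesis QE : Q = K * s%:R.

(** Both sides are homogeneous of degree [p], so a function of nonzero norm is rescaled to norm
    1. *)
Lemma discretizes_unit_ball (eps : R) (m : nat) (x : 'I_m -> T) :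
  (forall a, unit_ball p mu s phi a -> pmean p mu (lin_comb phi a) = 1 ->
     `|emean x (fun y => cmod (lin_comb phi a y) `^ p) - 1| <= eps) ->
  discretizes mu p eps x (Sigma_sparse phi s).
Proof.
move=> H; apply/discretizesE => J a Js; rewrite span_elt_lin_comb.
have := span_elt_support J a; rewrite Js.
set b := fun j => if j \in J then a j else 0 => sb.
have HP := poslin_mean mu; have HE := poslin_emean R x.
have mf : cbm (lin_comb phi b) by exact: cbm_lin_comb.
have mF : bm (fun y => cmod (lin_comb phi b y) `^ p) by exact: bm_cmod_powR (ltW p0) mf.
rewrite /discretizes1; set v := pmean _ _ _.
have v0 : 0 <= v by apply: (poslin_ge0 HP) => // y; exact: powR_ge0.
(* Norm 0 must mean vanishing at every point, not only almost everywhere, for the empirical sum to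
   be 0; the [l1] bound gives this. *)
have [vz|vn] := eqVneq v 0.
  have s4 : (s <= 4 * s)%N by rewrite leq_pmull.
  have := l1_powR_le hp mphi phi1 K1 riesz s4 sb.
  rewrite -/v vz mulr0 => h.
  have fz y : cmod (lin_comb phi b y) `^ p = 0.
    apply/eqP; rewrite eq_le powR_ge0 andbT (le_trans _ h)//.
    rewrite (powR_le_powR hp) ?cmod_ge0 ?lin_comb_le//.
    by apply: sumr_ge0 => j _; exact: cmod_ge0.
  by under [X in emean _ X]eq_fun do rewrite fz; rewrite !mulr0 (poslin0 HE) lexx.
have {}vn : 0 < v by rewrite lt_def vn.
pose r : R := v^-1 `^ p^-1.
have r0 : 0 <= r by exact: powR_ge0.
have rp : r `^ p = v^-1.
  by rewrite /r -powRrM mulVf ?gt_eqF// powRr1// invr_ge0.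
pose b' j := (r%:C)%C * b j.
have b'E y : cmod (lin_comb phi b' y) `^ p = v^-1 * cmod (lin_comb phi b y) `^ p.
  have -> : lin_comb phi b' y = (r%:C)%C * lin_comb phi b y.
    by rewrite /lin_comb mulr_sumr; apply: eq_bigr => j _; rewrite mulrA.
  by rewrite cmodM cmod_real ger0_norm// powRM ?cmod_ge0// rp.
have v1 : pmean p mu (lin_comb phi b') = 1.
  rewrite /pmean; under eq_fun do rewrite b'E.
  by rewrite (poslinZ HP)// mulVf// gt_eqF.
have sb' : (#|[pred j | b' j != 0%R]| <= s)%N.
  apply: leq_trans sb; apply: subset_leq_card; apply/fintype.subsetP => j.
  by rewrite !inE; apply: contra => /eqP h; rewrite /b' /b h mulr0.
have := H b'; rewrite /unit_ball v1 => /(_ (conj sb' (lexx _)) erefl).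
under [X in emean _ X]eq_fun do rewrite b'E.
rewrite (poslinZ HE)//; set E := emean _ _ => HEv.
have -> : E = v * (v^-1 * E) by rewrite mulVKf// gt_eqF.
move: HEv; rewrite ler_norml => /andP[h1 h2].
by rewrite ![_ * v]mulrC !ler_pM2l//; apply/andP; split; lra.
Qed.

End sigma_sparse.

Lemma Riesz_real (R : realType) d (T : measurableType d) (mu : probability T R)
    (N : nat) (phi : 'I_N -> T -> R[i]) (v : nat) (K : R) :
  one_sided_sparse_Riesz mu phi v K ->
  [/\ forall j, cbm (phi j), forall j x, cmod (phi j x) <= 1 &
    forall a : 'I_N -> R[i], (#|[pred j | a j != 0%R]| <= v)%N ->
    \sum_j cmod (a j) ^+ 2 <= K * mean mu (fun x => cmod (lin_comb phi a x) ^+ 2)].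
Proof.
move=> [m b s1 H]; have mphi j : cbm (phi j) by exact: cbmP.
split => // [j x|a av].
  by rewrite -lee_fin (le_trans _ (s1 j))//; apply: ereal_sup_ubound; exists x.
have := H a av; rewrite cLnorm2_sqr; last exact: cbm_lin_comb.
by rewrite -EFinM lee_fin.
Qed.

(** As [2 ^ i >= i + 1], a geometric series of ratio [expR (- l) <= 1 / 2] dominates. *)
Lemma sum_expR_dyadic_le (R : realType) (l : R) (n : nat) : 2 <= expR l ->
  \sum_(i < n) expR (- (l * 2 ^+ i)) <= 2 * expR (- l).
Proof.
move=> l2; suff : \sum_(i < n) expR (- (l * 2 ^+ i)) <= expR (- l) * (2 - 2 / 2 ^+ n).
  move=> /le_trans; apply; rewrite mulrC ler_wpM2r ?expR_ge0// gerBl.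
  by rewrite divr_ge0// exprn_ge0.
have l0 : 0 <= l.
  by rewrite -(ler_expR 0) expR0 (le_trans _ l2)// ler1n.
have half : expR (- l) <= 2^-1 by rewrite expRN lef_pV2// posrE ?expR_gt0.
elim: n => [|n IHn]; first by rewrite big_ord0 expr0 divr1 subrr mulr0.
rewrite big_ord_recr/= (le_trans (lerD IHn (lexx _)))//.
have : expR (- (l * 2 ^+ n)) <= expR (- l) * (2^-1) ^+ n.
  apply: (@le_trans _ _ (expR (- l) * expR (- l) ^+ n)); last first.
    by rewrite ler_wpM2l ?expR_ge0// lerXn2r ?nnegrE ?expR_ge0.
  rewrite -expRM_natl -expRD ler_expR -lerN2 opprD !opprK mulrN opprK.
  rewrite -[X in X + _]mulr1 [n%:R * l]mulrC -mulrDr ler_wpM2l// -natrX addrC natr1 ler_nat.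
  exact: ltn_expl.
have -> : expR (- l) * (2 - 2 / 2 ^+ n.+1) =
    expR (- l) * (2 - 2 / 2 ^+ n) + expR (- l) * (2^-1) ^+ n.
  by rewrite exprS exprVn; field; rewrite expf_neq0.
by rewrite lerD2l.
Qed.

(** [x] stands on both sides. Since [A <= 1 / 20], the inequality first yields [x <= 2], and then an
    error of at most [(3 + 4) * eps / 10]. *)
Lemma near_one (R : realFieldType) (eps x A B : R) : 0 < eps <= 2^-1 -> 0 <= x ->
  A <= eps / 10 -> B <= 4 * (eps / 10) -> `|x - 1| <= A * (x + 1) + B -> `|x - 1| <= eps.
Proof.
move=> /andP[e0 e1] x0 Ae Be h.
have h1 : `|x - 1| <= eps / 10 * (x + 1) + 4 * (eps / 10).
  by rewrite (le_trans h)// lerD// ler_wpM2r// addr_ge0.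
have x2 : x <= 2.
  rewrite leNgt; apply/negP => x2.
  have := le_trans (ler_norm _) h1.
  have : eps / 10 * (x + 1) <= 2^-1 / 10 * (x + 1) by rewrite ler_wpM2r ?addr_ge0// ler_pM2r.
  lra.
apply: (le_trans h1).
have : eps / 10 * (x + 1) <= eps / 10 * 3 by rewrite ler_wpM2l ?divr_ge0 ?(ltW e0)//; lra.
lra.
Qed.

(** * Probability bound for given parameters *)

Section assembly.
Context (R : realType) (p : R) (hp : 1 <= p <= 2).
Context d d' (T : measurableType d) (mu : probability T R)
  (W : measurableType d') (P : probability W R) (m : nat) (xi : 'I_m -> {RV P >-> T}).
Hypothesis m0 : (0 < m)%N.
Hypothesis indxi : mutually_independent xi.
Hypothesis muxi : forall E : set T, measurable E ->
  mu E = ((m%:R^-1)%:E * \sum_(j < m) P (xi j @^-1` E))%E.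
Context (N s : nat) (phi : 'I_N -> T -> R[i]) (K Q : R).
Hypothesis mphi : forall j, cbm (phi j).
Hypothesis phi1 : forall j x, cmod (phi j x) <= 1.
Hypothesis K1 : 1 <= K.
Hypothesis s0 : (0 < s)%N.
Hypothesis N0 : (0 < N)%N.
Hypothesis riesz : forall a : 'I_N -> R[i], (#|[pred j | a j != 0%R]| <= 4 * s)%N ->
  \sum_j cmod (a j) ^+ 2 <= K * mean mu (fun x => cmod (lin_comb phi a x) ^+ 2).
Hypothesis QE : Q = K * s%:R.

Let Q1 : 1 <= Q. Proof. by rewrite QE mulr_ege1// ler1n. Qed.
Let Q0 : 0 < Q. Proof. exact: lt_le_trans Q1. Qed.

Context (eps M Tb eta kap V l : R) (I k H g : nat).
Hypothesis eps12 : 0 < eps <= 2^-1.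
Hypothesis M1 : 1 <= M.
Hypothesis Meps : 16 / M <= eps / 10.
Hypothesis Tb1 : I.+1%:R <= Tb \/ 1 + 2 * ln (2 * (M + 2) ^+ 2) <= Tb.
Hypothesis eta0 : 0 <= eta.
Hypothesis eta1 : 16 * Q ^+ 2 * eta <= 1.
Hypothesis k0 : (0 < k)%N.
Hypothesis keta : 4 * expR (- (k%:R / (272 * 256))) <= eta.
Hypothesis I2Q : 2 ^+ I <= Q.
Hypothesis sI : (s <= 2 ^ I)%N.
Hypothesis H0 : (0 < H)%N.
Hypothesis Hg : Q * H%:R <= g%:R.
Hypothesis tau1 : s%:R * (2 / H%:R) <= 1 :> R.
Hypothesis taueps : 8 * Q * (s%:R * (2 / H%:R)) <= eps / 10.
Hypothesis kap0 : 0 < kap.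
Hypothesis kapM : 4 * M * kap <= 1.
Hypothesis err1 : 4 * I.+2%:R * eta * (I.+1%:R * (4 * M * Q) + Q) <= eps / 10.
Hypothesis err2 : 2 * kap * (16 * Tb + 2 * I.+2%:R * eta * (I.+1%:R * (16 * M ^+ 2 * Q)))
  <= eps / 10.
Hypothesis err3 : I.+1%:R * (V * Q / (kap * m%:R)) <= eps / 10.
Hypothesis l2 : 2 <= expR l.
Hypothesis VE : 3 * k%:R * ln (4 * N).+1%:R + ln N%:R + 2 * ln (2 * g).+1%:R + l <= V.

(** Levels 0 to [I] come from [covered_lev], and index [I.+1] is the coefficient grid; the chain
    thus has [I.+1] links. *)
Let e i : R := if (i < I.+1)%N then lev p Q i else s%:R * (2 / H%:R).
Let sz i : nat := if (i < I.+1)%N then ((4 * N).+1 ^ (k * (2 ^ i).-1))%N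
  else ((N * ((2 * g).+1 * (2 * g).+1)) ^ s)%N.

Let cov i : covered p mu s phi eta (sz i) (e i).
Proof.
rewrite /sz /e; case: ltnP => iI; last first.
  exact: (covered_grid hp mphi phi1 K1 s0 riesz QE eta0 H0 N0 Hg (lexx _)).
apply: (covered_lev hp mphi phi1 K1 s0 riesz QE) => //.
apply: (@le_trans _ _ Q); last by rewrite ler_peMl ?(ltW Q0)// ler1n.
by rewrite (le_trans _ I2Q)// ler_weXn2l// ler1n.
Qed.

Let lN : R := ln (4 * N).+1%:R.

Let expR_ln_nat (j : nat) : (0 < j)%N -> expR (ln j%:R) = j%:R :> R.
Proof. by move=> j0; rewrite lnK// posrE ltr0n. Qed.

Let pow_expR (j q : nat) : (0 < j)%N -> (j ^ q)%:R = expR (q%:R * ln j%:R) :> R.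
Proof. by move=> j0; rewrite expRM_natl expR_ln_nat// natrX. Qed.

(** Two consecutive nets have at most [k * 2 ^ i + k * 2 ^ i.+1 = 3 * k * 2 ^ i] atoms to choose. In
    the last pair the grid adds [s] times [ln N + 2 * ln (2 * g).+1], and [s <= 2 ^ I]. *)
Let sz_le i : (i <= I)%N -> (sz i)%:R * (sz i.+1)%:R <= expR ((V - l) * 2 ^+ i).
Proof.
move=> iI; rewrite /sz ltnS iI pow_expR//.
have lN0 : 0 <= lN by rewrite ln_ge0// ler1n.
have klN0 : 0 <= k%:R * lN by rewrite mulr_ge0.
have lnN0 : 0 <= ln N%:R :> R by rewrite ln_ge0// ler1n.
have lg0 : 0 <= ln (2 * g).+1%:R :> R by rewrite ln_ge0// ler1n.
have predle (j : nat) : (k * (2 ^ j).-1)%:R * lN <= k%:R * lN * 2 ^+ j.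
  rewrite natrM -mulrA -[leRHS]mulrA ler_wpM2l// mulrC ler_wpM2l//.
  by rewrite -natrX ler_nat leq_pred.
have twoi : 0 <= 2 ^+ i :> R by exact: exprn_ge0.
have V3 : 3 * (k%:R * lN) + ln N%:R + 2 * ln (2 * g).+1%:R <= V - l.
  by rewrite lerBrDr mulrA.
case: ltnP => iI1.
  rewrite pow_expR// -expRD ler_expR (le_trans (lerD (predle i) (predle i.+1)))//.
  rewrite exprS (_ : _ + _ = 3 * (k%:R * lN) * 2 ^+ i); last by ring.
  by rewrite ler_wpM2r//; lra.
have -> : i = I by apply/eqP; rewrite eqn_leq iI.
rewrite pow_expR; last by rewrite muln_gt0 N0.
rewrite -expRD ler_expR !natrM !lnM ?posrE ?mulr_gt0 ?ltr0n//.
set L := ln N%:R + _.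
have L0 : 0 <= L by rewrite /L; lra.
have sL : s%:R * L <= 2 ^+ I * L.
  by rewrite ler_wpM2r// -natrX ler_nat.
rewrite -natrM (le_trans (lerD (predle I) sL))// [2 ^+ I * L]mulrC -mulrDl.
by rewrite ler_wpM2r ?exprn_ge0// /L; lra.
Qed.

Lemma discretizes_prob :
  ((1 - 4 * expR (- l))%:E <=
   P [set w | discretizes mu p eps (fun j => xi j w) (Sigma_sparse phi s)])%E.
Proof.
pose U i : finType := projT1 (cid (cov i)).
pose c i : U i -> T -> R[i] := projT1 (cid (projT2 (cid (cov i)))).
have Uc i : [/\ (#|U i| <= sz i)%N, forall u, cbm (c i u) &
    forall a, unit_ball p mu s phi a -> forall L : (T -> R) -> R, poslin L -> L (fun=> 1) = 1 ->
      exists u, L (fun x => (e i < cmod (lin_comb phi a x - c i u x))%R%:R) <= eta].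
  exact: projT2 (cid (projT2 (cid (cov i)))).
have mc i (u : U i) : cbm (c i u) by case: (Uc i).
have covc i := let: And3 _ _ h := Uc i in h.
have card_U i : (#|U i| <= sz i)%N by case: (Uc i).
have lp i : 0 < lev p Q i `^ p by rewrite powR_gt0// lev_gt0.
have mR : 0 < m%:R :> R by rewrite ltr0n.
have M0 : 0 < M by exact: lt_le_trans M1.
have tau0 : 0 <= s%:R * (2 / H%:R) :> R by rewrite mulr_ge0// divr_ge0.
have en : e I.+1 = s%:R * (2 / H%:R) by rewrite /e ltnn.
have e0 : e 0%N = lev p Q 0 by [].
have elev i : (i < I.+1)%N -> e i <= lev p Q i /\ e i.+1 <= lev p Q i.
  move=> iI; rewrite /e iI; split => //; case: ifPn => [_|]; first exact: levS_le.
  by move=> _; rewrite (le_trans tau1)// lev_ge1// (le_trans _ I2Q)// ler_weXn2l// ler1n.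
have V0 : l <= V.
  apply: le_trans VE; rewrite lerDr !addr_ge0 ?mulr_ge0 ?ln_ge0// ler1n//.
have mlink i (uv : U i * U i.+1) : bm (link p Q e c M uv.1 uv.2) by exact: (bm_link hp K1 s0 QE e M1 mc).
(* The exponent [V * 2 ^ i] pays for the entropy [(V - l) * 2 ^ i] and leaves [l * 2 ^ i]. The 4 is
   the 2 for both signs times the 2 of [sum_expR_dyadic_le]. *)
have sum_le : 1 - 4 * expR (- l) <= 1 - \sum_(i < I.+1) 2 *
    #|(U i * U i.+1)%type : finType|%:R * expR (- (V * 2 ^+ i)).
  rewrite lerD2l lerN2.
  apply: (@le_trans _ _ (\sum_(i < I.+1) 2 * expR (- (l * 2 ^+ i)))); last first.
    rewrite -mulr_sumr (_ : 4 = 2 * 2) -?mulrA ?ler_pM2l//; last by ring.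
    exact: sum_expR_dyadic_le.
  apply: ler_sum => i _; rewrite -mulrA ler_pM2l//.
  apply: (@le_trans _ _ (expR ((V - l) * 2 ^+ i) * expR (- (V * 2 ^+ i)))).
    rewrite ler_wpM2r ?expR_ge0// card_prod natrM (le_trans _ (sz_le (ltn_ord i : (i <= I)%N)))//.
    by rewrite ler_pM// ler_nat.
  by rewrite -expRD ler_expR; lra.
rewrite -lee_fin in sum_le; apply: (le_trans sum_le).
apply: (concentration_union_bound m0 indxi muxi (X := fun i => (U i * U i.+1)%type)
  (h := fun i uv => link p Q e c M uv.1 uv.2) (k := fun i => kap / lev p Q i `^ p)
  (t := fun i => V * 2 ^+ i)).
- exact: measurable_discretizes.
- by move=> i uv; exact: mlink.
- by move=> i; rewrite divr_gt0.
- move=> i uv y; rewrite mulrAC ler_pdivrMr// mul1r.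
  have := link_le hp K1 s0 QE e c M1 uv.1 uv.2 y.
  move=> /(ler_wpM2l (ltW kap0)) /le_trans; apply.
  rewrite mulrA [kap * _]mulrC -[leRHS]mul1r ler_wpM2r//.
  exact: ltW.
move=> w conc; apply: (discretizes_unit_ball hp mphi phi1 K1 riesz) => a ba a1.
have HE := poslin_emean R (fun j => xi j w).
have := chaining_error hp mphi phi1 K1 s0 riesz QE M1 Tb1 elev e0 _ mc covc HE (emean1 _ _ m0)
  (ltW kap0) (w := V * Q / (kap * m%:R)) _ ba.
rewrite en => /(_ tau0).
have cc i : (i < I.+1)%N -> forall (u : U i) (v : U i.+1),
  `|emean (fun j => xi j w) (link p Q e c M u v) - mean mu (link p Q e c M u v)| <=
  2 * (kap / lev p Q i `^ p) * mean mu (fun x => link p Q e c M u v x ^+ 2) + V * Q / (kap * m%:R).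
  move=> iI u v; have := conc (Ordinal iI) (u, v).
  rewrite /= (_ : V * 2 ^+ i / _ = V * Q / (kap * m%:R))//.
  rewrite (lev_powR hp Q1); field.
  by rewrite !gt_eqF//= exprn_gt0.
move=> /(_ cc); rewrite /pmean in a1; cbv zeta; rewrite a1; set L := emean _ _.
have L0 : 0 <= L.
  apply: (poslin_ge0 HE) => [|x]; last exact: powR_ge0.
  by apply: bm_cmod_powR; [case/andP: hp => h _; exact: le_trans h|exact: cbm_lin_comb].
move=> h; apply: (near_one eps12 L0 Meps _ (B := _ + (_ + (_ + _)))); last first.
  by rewrite !addrA; exact: h.
have -> : 4 * (eps / 10) = eps / 10 + (eps / 10 + (eps / 10 + eps / 10)) by ring.
exact: lerD taueps (lerD err1 (lerD err2 err3)).
Qed.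

End assembly.

(** * Numerical estimates *)

Section constants.
Context (R : realType).

Lemma ln_nat_ge1 (j : nat) : (4 <= j)%N -> 1 <= ln j%:R :> R.
Proof.
move=> j4; apply: (@le_trans _ _ (ln 4)).
  have -> : 4 = 2 * 2 :> R by ring.
  by rewrite lnM ?posrE//; have := ln2_ge_half R; lra.
by rewrite ler_ln ?posrE ?ltr0n ?ler_nat// (leq_trans _ j4).
Qed.

Lemma up_log_facts (s : nat) : (4 <= s)%N -> let I := up_log 2 s in
  [/\ (s <= 2 ^ I)%N, (2 ^ I <= 2 * s)%N, (I.+2 <= 2 * s)%N &
      I.+1%:R <= 4 * ln s%:R :> R].
Proof.
move=> s4 I; have s1 : (1 < s)%N by exact: leq_trans s4.
have /andP[h1 h2] := up_log_bounds (isT : (1 < 2)%N) s1; rewrite -/I in h1 h2.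
have I0 : (0 < I)%N by rewrite lt0n; apply: contraL s1 => /eqP I0; rewrite I0 in h2; rewrite -leqNgt.
have IE : I = I.-1.+1 by rewrite prednK.
have II : (I <= s)%N.
  by rewrite IE; apply: leq_trans h1; rewrite ltnS; exact/ltnW/ltn_expl.
split => //.
- by rewrite {1}IE expnS leq_mul2l ltnW.
- by rewrite mul2n -addnn -addn2 leq_add// (leq_trans _ s4).
have ls := ln_nat_ge1 s4.
have : I.-1%:R * ln 2 <= ln s%:R :> R.
  rewrite mulr_natl -lnXn// ler_ln ?posrE ?exprn_gt0 ?ltr0n ?(leq_trans _ s4)//.
  by rewrite -natrX ler_nat ltnW.
have : I.-1%:R * 2^-1 <= I.-1%:R * ln 2 :> R by rewrite ler_wpM2l// ln2_ge_half.
have -> : I.+1%:R = I.-1%:R + 2%:R :> R by rewrite -natrD addn2 prednK.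
lra.
Qed.

(** [H] lies just above [160 * Q * s / eps], as the error [16 * Q * s / H] demands, and [g] just
    above [Q * H]. Then [2 * g + 1] is at most of order [Q ^+ 3 / eps], and two more powers of
    [Q >= 64] absorb the constants. *)
Lemma grid_size (Q eps : R) (s : nat) : 64 <= Q -> s%:R <= Q -> (0 < s)%N ->
  0 < eps <= 2^-1 -> exists H g : nat,
  [/\ (0 < H)%N, Q * H%:R <= g%:R, 8 * Q * (s%:R * (2 / H%:R)) <= eps / 10 &
      ln (2 * g).+1%:R <= 5 * ln Q + ln eps^-1].
Proof.
move=> Q64 sQ s0 /andP[e0 e1].
have sR : 1 <= s%:R :> R by rewrite ler1n.
have Q0 : 0 < Q by lra.
pose h := 160 * Q * s%:R / eps.
have h0 : 0 <= h by apply: divr_ge0 (ltW e0); apply: mulr_ge0 (ler0n _ _);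
  apply: mulr_ge0 (ler0n _ _) (ltW Q0).
pose H := (Num.truncn h).+1; have H0 : 0 < H%:R :> R by rewrite ltr0n.
have /andP[t1 t2] := truncn_itv h0; rewrite -/H in t2.
have H1 : H%:R <= h + 1 by rewrite /H -natr1 lerD2r.
have QH0 : 0 <= Q * H%:R by rewrite mulr_ge0 ?ltW.
pose g := (Num.truncn (Q * H%:R)).+1.
have /andP[u1 u2] := truncn_itv QH0; rewrite -/g in u2.
have g1 : g%:R <= Q * H%:R + 1 by rewrite /g -natr1 lerD2r.
exists H, g; split => //; first exact: ltW.
  rewrite (_ : 8 * Q * _ = (16 * Q * s%:R) / H%:R); last by field; rewrite gt_eqF.
  rewrite ler_pdivrMr// (_ : 16 * Q * s%:R = eps / 10 * h); last first.
    by rewrite /h; field; rewrite gt_eqF.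
  by rewrite ler_wpM2l ?divr_ge0 ?(ltW e0)// ltW.
have -> : 5 * ln Q + ln eps^-1 = ln (Q ^+ 5 / eps).
  rewrite lnM ?posrE ?invr_gt0 ?exprn_gt0// lnXn// -[ln Q *+ 5]mulr_natl.
  by [].
rewrite ler_ln ?posrE ?ltr0n ?divr_gt0 ?exprn_gt0//.
rewrite -natr1 natrM ler_pdivlMr//.
have E1 : h * eps = 160 * Q * s%:R by rewrite /h divfK// gt_eqF.
have Q2 : 64 * Q <= Q ^+ 2 by rewrite expr2 ler_wpM2r// ltW.
have QQ : Q * s%:R <= Q ^+ 2 by rewrite expr2 ler_wpM2l// ltW.
have g2 : (2 * g%:R + 1) * eps <= (2 * (Q * (h + 1)) + 3) * eps.
  rewrite ler_wpM2r ?(ltW e0)//.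
  have : Q * H%:R <= Q * (h + 1) by rewrite ler_wpM2l ?(ltW Q0).
  lra.
apply: (le_trans g2).
have -> : (2 * (Q * (h + 1)) + 3) * eps = 2 * Q * (h * eps) + (2 * Q + 3) * eps by ring.
rewrite E1.
have : (2 * Q + 3) * eps <= (2 * Q + 3) * 1 by rewrite ler_wpM2l//; lra.
have : 2 * Q * (160 * Q * s%:R) <= 2 * Q * (160 * Q ^+ 2).
  by rewrite -[160 * Q * _]mulrA ler_wpM2l ?mulr_ge0 ?(ltW Q0)// ler_wpM2l.
have Q3 : 64 * Q ^+ 2 <= Q ^+ 3 by rewrite [Q ^+ 3]exprS ler_wpM2r ?exprn_ge0 ?(ltW Q0).
have Q4 : 64 * Q ^+ 3 <= Q ^+ 4 by rewrite [Q ^+ 4]exprS ler_wpM2r ?exprn_ge0 ?(ltW Q0).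
have Q5 : 64 * Q ^+ 4 <= Q ^+ 5 by rewrite [Q ^+ 5]exprS ler_wpM2r ?exprn_ge0 ?(ltW Q0).
have -> : 2 * Q * (160 * Q ^+ 2) = 320 * Q ^+ 3 by ring.
lra.
Qed.

(** The left side is [eta * Q ^+ 3 * 64 ^+ 5] for the chosen [eta]; [eta_error1] and [eta_error2]
    need this product to be at most [eps ^+ 2]. *)
Lemma eta_small (Q eps : R) : 64 <= Q -> 0 < eps <= 2^-1 ->
  (eps / Q) ^+ 8 * Q ^+ 3 * 64 ^+ 5 <= eps ^+ 2.
Proof.
move=> Q64 /andP[e0 e1]; have Q0 : 0 < Q by lra.
have -> : (eps / Q) ^+ 8 * Q ^+ 3 * 64 ^+ 5 = eps ^+ 2 * (eps ^+ 6 * (64 / Q) ^+ 5).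
  by field; rewrite gt_eqF.
rewrite ler_piMr ?exprn_ge0 ?(ltW e0)//.
have e1' : eps <= 1 by lra.
apply: mulr_ile1; rewrite ?exprn_ge0 ?divr_ge0 ?(ltW e0) ?(ltW Q0)// exprn_ile1 ?divr_ge0 ?(ltW
  Q0) ?(ltW e0)//.
by rewrite ler_pdivrMr// mul1r.
Qed.

(** [x] will be [ln (Q / eps)], so that [expR (- (8 * x))] is [eta]. The exponent is aimed at
    [10 * x], and [expR x >= 4] absorbs the factor 4. *)
Lemma sample_count (x : R) : 3 <= x -> exists k : nat, [/\ (0 < k)%N,
  4 * expR (- (k%:R / (272 * 256))) <= expR (- (8 * x)) &
  k%:R <= (272 * 256 * 10 + 1) * x].
Proof.
move=> x3; pose c : R := 272 * 256.
have c0 : 0 < c by rewrite /c; apply: mulr_gt0; rewrite ltr0n.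
rewrite -/c; move: c c0 => c c0.
have cx0 : 0 <= c * 10 * x by rewrite mulr_ge0 ?mulr_ge0 ?(ltW c0)//; lra.
have /andP[k1 k2] := truncn_itv cx0.
exists (Num.truncn (c * 10 * x)).+1; split => //; last first.
  by rewrite -natr1 mulrDl mul1r lerD//; lra.
apply: (@le_trans _ _ (expR x * expR (- (10 * x)))); last first.
  by rewrite -expRD ler_expR; lra.
rewrite ler_pM ?expR_ge0//.
  by apply: le_trans (expR_ge1Dx _); lra.
by rewrite ler_expR lerN2 ler_pdivlMr// mulrC mulrA ltW.
Qed.

Lemma ln_4NS (N : nat) : (4 <= N)%N -> ln (4 * N).+1%:R <= 3 * ln N%:R :> R.
Proof.
move=> N4; have N0 : (0 < N)%N by exact: leq_trans N4.
rewrite mulr_natl -lnXn ?ltr0n// ler_ln ?posrE ?exprn_gt0 ?ltr0n//.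
rewrite -natrX ler_nat !expnS expn0 muln1.
apply: (@leq_trans (4 * N + N)); first by rewrite -addn1 leq_add2l.
have : (4 * 4 * N <= N * N * N)%N by rewrite !leq_mul.
rewrite mulnA; apply: leq_trans.
by rewrite -mulSnr leq_mul2r orbT.
Qed.

(** [160 / eps] is the future [M]. One has [160 / eps + 2 <= 2 ^+ 8 / eps], and each [ln 2] is
    charged to [a >= ln 2]. *)
Lemma log_count (eps a : R) : 0 < eps <= 2^-1 -> a = ln eps^-1 ->
  1 + 2 * ln (2 * (160 / eps + 2) ^+ 2) <= 40 * a.
Proof.
move=> /andP[e0 e1] aE; have ln2 := ln2_ge_half R.
have a2 : ln 2 <= a.
  by rewrite aE ler_ln ?posrE ?invr_gt0// -[2]invrK lef_pV2 ?posrE ?invr_gt0.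
have M2 : 0 < 160 / eps + 2 by rewrite addr_gt0 ?divr_gt0.
have lnM2 : ln (160 / eps + 2) <= 8 * ln 2 + a.
  have -> : 8 * ln 2 + a = ln (2 ^+ 8 / eps).
    by rewrite lnM ?posrE ?invr_gt0 ?exprn_gt0// lnXn// -[ln 2 *+ 8]mulr_natl aE.
  rewrite ler_ln ?posrE ?divr_gt0 ?exprn_gt0//.
  rewrite ler_pdivlMr// mulrDl divfK ?gt_eqF//.
  have -> : 2 ^+ 8 = 256 :> R by ring.
  lra.
rewrite lnM ?posrE ?exprn_gt0// lnXn// -[ln (160 / eps + 2) *+ 2]mulr_natl; lra.
Qed.

Lemma eta_error1 (Q eps eta i1 i2 : R) : 64 <= Q -> 0 < eps <= 2^-1 -> 0 <= eta ->
  eta * Q ^+ 3 * 64 ^+ 5 <= eps ^+ 2 -> 0 <= i1 <= Q -> 0 <= i2 <= Q ->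
  4 * i2 * eta * (i1 * (4 * (160 / eps) * Q) + Q) <= eps / 10.
Proof.
move=> Q64 /andP[e0 e1] eta0 Xe /andP[i10 i1Q] /andP[i20 i2Q].
have Q0 : 0 < Q by lra.
pose X := eta * Q ^+ 3; have X0 : 0 <= X by rewrite mulr_ge0// exprn_ge0// ltW.
apply: (@le_trans _ _ (4 * Q * eta * (Q * (4 * (160 / eps) * Q) + Q * (Q / eps)))).
  have QM : 0 <= 4 * (160 / eps) * Q by rewrite !mulr_ge0 ?invr_ge0 ?(ltW e0) ?(ltW Q0).
  apply: ler_pM; first by rewrite !mulr_ge0.
  - by rewrite addr_ge0 ?(ltW Q0)// mulr_ge0.
  - by rewrite ler_wpM2r// ler_pM2l.
  rewrite lerD//; first by rewrite ler_wpM2r.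
  by rewrite ler_peMr ?(ltW Q0)// ler_pdivlMr// mul1r; lra.
have -> : 4 * Q * eta * (Q * (4 * (160 / eps) * Q) + Q * (Q / eps)) = 4 * 641 * X / eps.
  by rewrite /X; field; rewrite gt_eqF.
rewrite ler_pdivrMr// (_ : eps / 10 * eps = eps ^+ 2 / 10); last by field.
have : X * (4 * 641 * 10) <= X * 64 ^+ 5.
  rewrite ler_wpM2l// !exprS expr0; lra.
rewrite -/X in Xe; lra.
Qed.

Lemma eta_error2 (Q eps eta i1 i2 : R) : 64 <= Q -> 0 < eps <= 2^-1 -> 0 <= eta ->
  eta * Q ^+ 3 * 64 ^+ 5 <= eps ^+ 2 -> 0 <= i1 <= Q -> 0 <= i2 <= Q ->
  2 * i2 * eta * (i1 * (16 * (160 / eps) ^+ 2 * Q)) <= 1.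
Proof.
move=> Q64 /andP[e0 e1] eta0 Xe /andP[i10 i1Q] /andP[i20 i2Q].
have Q0 : 0 < Q by lra.
pose X := eta * Q ^+ 3; have X0 : 0 <= X by rewrite mulr_ge0// exprn_ge0// ltW.
apply: (@le_trans _ _ (2 * Q * eta * (Q * (16 * (160 / eps) ^+ 2 * Q)))).
  have QM : 0 <= 16 * (160 / eps) ^+ 2 * Q by rewrite mulr_ge0 ?(ltW Q0)// mulr_ge0// sqr_ge0.
  apply: ler_pM; [by rewrite !mulr_ge0|by rewrite mulr_ge0| |].
    by rewrite ler_wpM2r// ler_pM2l.
  by rewrite ler_wpM2r.
have -> : 2 * Q * eta * (Q * (16 * (160 / eps) ^+ 2 * Q)) = 32 * (160 * 160) * X / eps ^+ 2.
  by rewrite /X; field; rewrite gt_eqF.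
rewrite ler_pdivrMr ?exprn_gt0// mul1r (le_trans _ Xe)// -/X mulrC ler_wpM2l// !exprS expr0; lra.
Qed.

(** Here [a], [q], [b] are the logarithms of [1 / eps], [Q], [N]. All is charged to [(a + q) * b]:
    [9 * n] for [3 * k * L], 1 for [b] and 10 for [2 * G]. *)
Lemma entropy_bound (C n a q b k L G l : R) : C = 9 * n + 11 -> 0 <= a -> 1 <= q -> 1 <= b ->
  k <= n * (a + q) -> L <= 3 * b -> G <= 5 * q + a ->
  0 <= k -> 0 <= L -> 0 <= G -> 0 <= l ->
  0 <= 3 * k * L + b + 2 * G + l <= C * ((a + q) * b) + l.
Proof.
move=> CE a0 q1 b1 kn Lb Gq k0 L0 G0 l0.
have b0 : 0 <= b by exact: le_trans b1.
apply/andP; split.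
  by rewrite !addr_ge0// !mulr_ge0.
rewrite lerD2r.
have h1 : k * L <= n * (a + q) * (3 * b) by exact: ler_pM.
have h2 : (a + q) * 1 <= (a + q) * b by rewrite ler_wpM2l// addr_ge0// (le_trans ler01).
have h3 : 1 * b <= (a + q) * b by rewrite ler_wpM2r//; lra.
have -> : C * ((a + q) * b) = 3 * (n * (a + q) * (3 * b)) + 11 * ((a + q) * b).
  by rewrite CE; ring.
lra.
Qed.

(** The decisive inequality is [min (a, q) * (a + q) <= 2 * a * q]. [D] collects
    [4 * 10 * 340 * 40]. Of the available [lam ^+ 2 / 2], the choice of [l] spends one half, and
    [8 * D * C <= lam ^+ 2] leaves the other half for the entropy. *)
Lemma sample_bound (D C Q a q b f l lam eps i1 V m : R) :
  D = 3400 * 160 -> 0 <= C -> 0 < Q -> 0 <= a -> 1 <= q -> 1 <= b -> 0 <= f -> 0 <= l ->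
  0 < eps -> 0 < m -> 0 <= i1 <= 4 * f -> 2^-1 <= ln q ->
  l = lam ^+ 2 / (4 * D) -> 8 * D * C <= lam ^+ 2 ->
  0 <= V <= C * ((a + q) * b) + l -> 0 < Num.min a q ->
  (lam * eps^-1) ^+ 2 * a * Q * b * f * q * ln q <= m ->
  i1 * (V * Q / (eps / (340 * (40 * Num.min a q)) * m)) <= eps / 10.
Proof.
move=> DE C0 Q0 a0 q1 b1 f0 l0 e0 mR /andP[i10 i1f] lnq lE lamD /andP[V0 VC] min0 hm.
have -> : i1 * (V * Q / (eps / (340 * (40 * Num.min a q)) * m)) =
    i1 * (Q * (340 * 40) * (Num.min a q * V)) / (eps * m).
  by field; rewrite !gt_eqF.
rewrite ler_pdivrMr ?mulr_gt0//.
have -> : eps / 10 * (eps * m) = eps ^+ 2 * m / 10 by field.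
rewrite ler_pdivlMr//.
have b0 : 0 <= b by lra.
have q0 : 0 <= q by lra.
pose Y := Q * f * (a * q * b).
have Y0 : 0 <= Y by rewrite !mulr_ge0// ltW.
have mY : lam ^+ 2 * Y / 2 <= eps ^+ 2 * m.
  apply: le_trans (ler_wpM2l (sqr_ge0 eps) hm).
  rewrite [leRHS](_ : _ = lam ^+ 2 * Y * ln q); last first.
    by rewrite /Y; field; rewrite gt_eqF.
  by rewrite ler_wpM2l// mulr_ge0// sqr_ge0.
apply: le_trans mY.
have minV : Num.min a q * V <= a * q * b * (2 * C + l).
  apply: (le_trans (ler_wpM2l (ltW min0) VC)).
  have h1 : Num.min a q * (a + q) <= 2 * (a * q).
    have -> : 2 * (a * q) = a * q + q * a by ring.
    rewrite mulrDr; apply: lerD; rewrite mulrC ler_wpM2l//.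
      by rewrite ge_min lexx orbT.
    by rewrite ge_min lexx.
  have h2 : Num.min a q <= a * q * b.
    apply: (@le_trans _ _ a); first by rewrite ge_min lexx.
    by rewrite -mulrA ler_peMr// mulr_ege1.
  have -> : Num.min a q * (C * ((a + q) * b) + l) =
    C * b * (Num.min a q * (a + q)) + Num.min a q * l by ring.
  have -> : a * q * b * (2 * C + l) = C * b * (2 * (a * q)) + a * q * b * l by ring.
  by rewrite lerD// ?ler_wpM2r ?ler_wpM2l// mulr_ge0.
apply: (@le_trans _ _ (4 * f * (Q * (340 * 40) * (a * q * b * (2 * C + l))) * 10)).
  have [n nE] : exists n, n = 340 * 40 :> R by eexists.
  have n0 : 0 <= n by rewrite nE; lra.
  have k0 : 0 <= Q * n by exact: mulr_ge0 (ltW Q0) n0.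
  rewrite -nE; apply: ler_wpM2r; first exact: ler0n.
  apply: ler_pM => //; last exact: ler_wpM2l.
  by apply: mulr_ge0 k0 (mulr_ge0 (ltW min0) V0).
have -> : 4 * f * (Q * (340 * 40) * (a * q * b * (2 * C + l))) * 10 = Y * (D * (2 * C + l)).
  by rewrite /Y DE; ring.
rewrite (_ : lam ^+ 2 * Y / 2 = Y * (lam ^+ 2 / 2)); last by ring.
apply: ler_wpM2l => //.
have D0 : 0 < D by rewrite DE; apply: mulr_gt0; rewrite ltr0n.
have -> : D * (2 * C + l) = 2 * (D * C) + lam ^+ 2 / 4 by rewrite lE; field; rewrite gt_eqF.
rewrite -mulrA in lamD; lra.
Qed.

End constants.

(** * Choice of the parameters *)

Lemma discretizes_prob_large (R : realType) (p : R) (hp : 1 <= p <= 2)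
    (d d' : measure_display) (Omega : measurableType d) (mu : probability Omega R)
    (W : measurableType d') (P : probability W R) (m : nat) (xi : 'I_m -> {RV P >-> Omega})
    (N s : nat) (phi : 'I_N -> Omega -> R[i]) (K lambda eps D C : R) :
  D = 3400 * 160 -> C = 9 * (272 * 256 * 10 + 1) + 11 ->
  (0 < m)%N -> mutually_independent xi ->
  (forall E : set Omega, measurable E ->
     mu E = ((m%:R^-1)%:E * \sum_(j < m) P (xi j @^-1` E))%E) ->
  (4 <= N)%N -> (4 <= s <= N)%N -> 16 <= K ->
  one_sided_sparse_Riesz mu phi (4 * s) K ->
  8 * D * C <= lambda ^+ 2 -> 0 < eps <= 2^-1 ->
  (lambda * eps^-1) ^+ 2 * ln (eps^-1) * (K * s%:R) * ln N%:R * ln s%:R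
    * ln (K * s%:R) * ln (ln (K * s%:R)) <= m%:R ->
  ((1 - 4 * expR (- (lambda ^+ 2 / (4 * D))))%:E <=
   P [set w | discretizes mu p eps (fun j => xi j w) (Sigma_sparse phi s)])%E.
Proof.
move=> DE CE m0 indxi muxi N4 /andP[s4 sN] K16 /Riesz_real[mphi phi1 riesz] lamD eps12.
have [Q QE] : exists Q, Q = K * s%:R by exists (K * s%:R).
have [a aE] : exists a, a = ln eps^-1 by exists (ln eps^-1).
have [q qE] : exists q, q = ln Q by exists (ln Q).
rewrite -QE -aE -qE => hm.
have /andP[e0 e1] := eps12.
have s0 : (0 < s)%N by exact: leq_trans s4.
have N0 : (0 < N)%N by exact: leq_trans N4.
have K1 : 1 <= K by rewrite (le_trans _ K16)// ler1n.
have sR4 : 4 <= s%:R :> R by rewrite ler_nat.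
have Q64 : 64 <= Q by rewrite QE (_ : 64 = 16 * 4) ?ler_pM//; ring.
have Q0 : 0 < Q by exact: lt_le_trans Q64.
have sQ2 : 2 * s%:R <= Q by rewrite QE ler_wpM2r// (le_trans _ K16)// ler_nat.
have sQ : s%:R <= Q by rewrite (le_trans _ sQ2)// ler_peMl// ler1n.
have ln2 := ln2_ge_half R.
have a0 : 2^-1 <= a.
  rewrite (le_trans ln2)// aE ler_ln ?posrE ?invr_gt0//.
  by rewrite -[2]invrK lef_pV2 ?posrE ?invr_gt0.
have q3 : 3 <= q.
  apply: (@le_trans _ _ (6 * ln 2)); first by lra.
  rewrite mulr_natl -lnXn// qE ler_ln ?posrE ?exprn_gt0//.
  by rewrite (_ : 2 ^+ 6 = 64 :> R)//; ring.
have a00 : 0 <= a by exact: le_trans a0.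
have q1 : 1 <= q by rewrite (le_trans _ q3)// ler1n.
have lnq : 2^-1 <= ln q.
  by rewrite (le_trans ln2)// ler_ln ?posrE//; lra.
have lN := ln_nat_ge1 R N4; have ls := ln_nat_ge1 R s4.
have fq : ln s%:R <= q by rewrite qE ler_ln ?posrE// ltr0n.
have [sI I2s I2 I4] := up_log_facts R s4.
move: (up_log 2 s) sI I2s I2 I4 => I sI I2s I2 I4.
have [H [g [H0 Hg taueps lng]]] := grid_size Q64 sQ s0 eps12.
have [|k [k0 keta kC]] := @sample_count R (a + q); first by lra.
have minaq : 2^-1 <= Num.min a q by rewrite le_min a0/=; lra.
have min0 : 0 < Num.min a q by exact: lt_le_trans minaq.
have Z := eta_small Q64 eps12.
have eta0 : 0 <= (eps / Q) ^+ 8 by rewrite exprn_ge0// divr_ge0 ?(ltW e0) ?(ltW Q0).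
have IQ2 : 0 <= (I.+2%:R : R) <= Q by apply/andP; split;
  [exact: ler0n|rewrite (le_trans _ sQ2)// -natrM ler_nat].
have IQ1 : 0 <= (I.+1%:R : R) <= Q.
  by apply/andP; split; [exact: ler0n|rewrite (le_trans _ (andP IQ2).2)// ler_nat].
have C1 : 1 <= C by rewrite CE; lra.
have D0 : 0 < D by rewrite DE; apply: mulr_gt0; rewrite ltr0n.
have [l lE] : exists l, l = lambda ^+ 2 / (4 * D) by exists (lambda ^+ 2 / (4 * D)).
have l1 : 1 <= l.
  rewrite lE ler_pdivlMr ?mulr_gt0// mul1r (le_trans _ lamD)//.
  by rewrite -mulrA ler_pM ?mulr_ge0 ?(ltW D0) ?ler_nat// ler_peMr// ltW.
have lnN := ln_4NS R N4.
have [V VE] : exists V, V = 3 * k%:R * ln (4 * N).+1%:R + ln N%:R + 2 * ln (2 * g).+1%:R + l.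
  by eexists.
have VC : 0 <= V <= C * ((a + q) * ln N%:R) + l.
  rewrite -qE -aE in lng.
  have N1 : 0 <= ln (4 * N).+1%:R :> R by rewrite ln_ge0// ler1n.
  have g1 : 0 <= ln (2 * g).+1%:R :> R by rewrite ln_ge0// ler1n.
  rewrite VE.
  exact: entropy_bound CE a00 q1 lN kC lnN lng (ler0n _ k) N1 g1 (le_trans ler01 l1).
rewrite -lE.
(* [M] solves [16 / M = eps / 10]. [T] serves both alternatives: [40 * a] by [log_count], and
   [40 * q] exceeds the number of levels [I.+1 <= 4 * ln s]. [kap] solves
   [2 * kap * (17 * T) = eps / 10], the seventeenth [T], at least 20, being reserved for the
   exceptional set. *)
have [M ME] : exists M, M = 160 / eps by eexists.
have [T TE] : exists T, T = 40 * Num.min a q by eexists.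
have [kap kapE] : exists kap, kap = eps / (340 * T) by eexists.
have [eta etaE] : exists eta, eta = (eps / Q) ^+ 8 by eexists.
rewrite -etaE in eta0 Z.
have T0 : 0 < T by rewrite TE; apply: mulr_gt0 min0; rewrite ltr0n.
have e1' : eps <= 1 by rewrite (le_trans e1)// invf_le1 ?ler1n.
have e0' := ltW e0; have Q0' := ltW Q0; have T0' := ltW T0.
have kap0 : 0 < kap by rewrite kapE; apply: divr_gt0 e0 _; apply: mulr_gt0 T0; rewrite ltr0n.
apply: (discretizes_prob hp m0 indxi muxi mphi phi1 K1 s0 N0 riesz QE
  (M := M) (Tb := T) (eta := eta) (kap := kap) (V := V) (I := I) (k := k) (H := H) (g := g)) => //.
- by rewrite ME ler_pdivlMr// mul1r (le_trans e1')// ler1n.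
- by rewrite ME le_eqVlt; apply/orP; left; apply/eqP; field; rewrite gt_eqF.
- have [aq|qa] := leP a q.
    by right; rewrite TE ME min_l//; exact: log_count.
  left; apply: (le_trans I4); rewrite TE min_r; last exact: ltW.
  by apply: ler_pM => //; [exact: le_trans ls|rewrite ler_nat].
- have QX : 16 * Q ^+ 2 * eta <= eta * Q ^+ 3 * 1.
    rewrite mulr1 mulrC; apply: ler_wpM2l => //; rewrite [leRHS]exprS.
    by apply: ler_wpM2r; [exact: sqr_ge0|rewrite (le_trans _ Q64)// ler_nat].
  apply: (le_trans QX); apply: (@le_trans _ _ (eps ^+ 2)).
    rewrite (le_trans _ Z)//; apply: ler_wpM2l; first by rewrite mulr_ge0 ?exprn_ge0.
    by rewrite exprn_ege1// ler1n.
  exact: exprn_ile1.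
- apply: (le_trans keta); rewrite etaE le_eqVlt; apply/orP; left; apply/eqP.
  rewrite expRN expRM_natl aE qE expRD !lnK ?posrE ?invr_gt0//.
  by rewrite -exprVn invfM invrK.
- by rewrite (le_trans _ sQ2)// -natrX -natrM ler_nat.
- apply: (@le_trans _ _ (eps / 10)); last by rewrite ler_pdivrMr// mul1r (le_trans e1')// ler1n.
  apply: le_trans taueps; rewrite -[leLHS]mul1r; apply: ler_wpM2r.
    by rewrite !mulr_ge0 ?invr_ge0 ?ler0n.
  by rewrite mulr_ege1 ?ler1n// (le_trans _ Q64)// ler1n.
- rewrite (_ : _ * _ = 640 / (340 * T)).
    rewrite ler_pdivrMr ?mul1r; last by apply: mulr_gt0 T0; rewrite ltr0n.
    clear -TE minaq; move: minaq; rewrite TE => minaq; lra.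
  by rewrite ME kapE; field; rewrite !gt_eqF.
- rewrite ME; exact: eta_error1.
- have h := eta_error2 Q64 eps12 eta0 Z IQ1 IQ2.
  apply: (@le_trans _ _ (2 * kap * (17 * T))).
    rewrite ME; apply: ler_wpM2l; first exact: mulr_ge0 (ler0n _ 2) (ltW kap0).
    clear -h TE minaq; move: minaq; lra.
  by rewrite kapE le_eqVlt; apply/orP; left; apply/eqP; field; rewrite gt_eqF.
- have i1f : 0 <= (I.+1%:R : R) <= 4 * ln s%:R by rewrite ler0n.
  rewrite kapE TE.
  have C0 := le_trans ler01 C1; have f0 := le_trans ler01 ls; have l0 := le_trans ler01 l1.
  apply: (sample_bound DE C0 Q0 a00 q1 lN f0 l0 e0 _ i1f lnq lE lamD VC min0 hm).
  by rewrite ltr0n.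
- by apply: le_trans (expR_ge1Dx _); rewrite -[leLHS]/(1 + 1) lerD2l.
- by rewrite -VE.
Qed.

Theorem theorem1p2 (R : realType) (p : R) (hp : 1 <= p <= 2) :
  exists c : R, 0 < c /\
  forall (d d' : measure_display)
    (Omega : measurableType d) (mu : probability Omega R)
    (W : measurableType d') (P : probability W R)
    (m : nat) (xi : 'I_m -> {RV P >-> Omega})
    (N s : nat) (phi : 'I_N -> Omega -> R[i]) (K lambda eps : R),
  (0 < m)%N ->
  mutually_independent xi ->
  (forall E : set Omega, measurable E ->
     mu E = ((m%:R^-1)%:E * \sum_(j < m) P (xi j @^-1` E))%E) ->
  (4 <= N)%N -> (4 <= s <= N)%N ->
  16 <= K ->
  one_sided_sparse_Riesz mu phi (4 * s) K ->
  expR 1 <= lambda ->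
  0 < eps <= 2^-1 ->
  (lambda * eps^-1) ^+ 2 * ln (eps^-1) * (K * s%:R) * ln N%:R * ln s%:R
    * ln (K * s%:R) * ln (ln (K * s%:R)) <= m%:R ->
  let G := [set w | discretizes mu p eps (fun j => xi j w) (Sigma_sparse phi s)] in
  measurable G /\
  ((1 - 2 * expR (- (c * lambda * ln lambda `^ 2^-1)))%:E <= P G)%E.
Proof.
(* [D] is the constant of [sample_bound], and [C] that of [entropy_bound] with the factor of
   [sample_count] for [n]. *)
have [D DE] : exists D : R, D = 3400 * 160 by eexists.
have [C CE] : exists C : R, C = 9 * (272 * 256 * 10 + 1) + 11 by eexists.
have D1 : 1 <= D by rewrite DE; lra.
have C1 : 1 <= C by rewrite CE; lra.
have C0 : 0 < C by exact: lt_le_trans C1.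
have DC1 : 1 <= D * C by rewrite mulr_ege1.
have DC0 : 0 < 16 * (D * C) by lra.
exists (16 * (D * C))^-1; split; first by rewrite invr_gt0.
move=> d d' Omega mu W P m xi N s phi K lambda eps m0 indxi muxi N4 s4 K16 rz lam eps12 hm G.
have [mphi phi1 _] := Riesz_real rz.
split; first exact: measurable_discretizes.
have lam1 : 1 <= lambda.
  by rewrite (le_trans _ lam)// -expR0 ler_expR.
have lam0 : 0 < lambda by exact: lt_le_trans lam1.
(* Since [ln lambda >= 1], its square root is at most [ln lambda <= lambda]; the claimed exponent is
   thus dominated by a multiple of [lambda ^+ 2]. *)
have lnlam : ln lambda `^ 2^-1 <= lambda.
  have ln1 : 1 <= ln lambda by rewrite -[1]expRK ler_ln ?posrE ?expR_gt0.
  rewrite (le_trans (ler1_powR ln1 _)) ?invf_le1 ?ler1n//.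
  exact/ltW/ln_sublinear.
have x_le : (16 * (D * C))^-1 * lambda * ln lambda `^ 2^-1 <= lambda ^+ 2 / (16 * (D * C)).
  rewrite -mulrA mulrC ler_pM2r ?invr_gt0// expr2 ler_pM2l//.
move: (_ * _ * _) x_le => x x_le.
(* For small [lambda] the exponent [x] is at most 1/2, and [2 * expR (- x) >= 2 * (1 - x) >= 1]
   makes the claim trivial. *)
have [large|small] := leP (8 * D * C) (lambda ^+ 2); last first.
  rewrite (@le_trans _ _ 0%:E)// lee_fin subr_le0.
  have : lambda ^+ 2 / (16 * (D * C)) <= 2^-1.
    by rewrite ler_pdivrMr//; lra.
  have := expR_ge1Dx (- x); lra.
have := discretizes_prob_large hp DE CE m0 indxi muxi N4 s4 K16 rz large eps12 hm.
apply: le_trans; rewrite lee_fin lerD2l lerN2.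
have D0 : 0 < D by lra.
have half : expR (- 1) <= 2^-1 :> R.
  by rewrite expRN lef_pV2 ?posrE ?expR_gt0//; apply: le_trans (expR_ge1Dx _); lra.
(* Of the two copies of [lambda ^+ 2 / (8 * D)] in the exponent, one covers [x] and the other is at
   least 1, which turns the constant 4 into 2. *)
apply: (@le_trans _ _ (4 * (expR (- 1) * expR (- x)))).
  rewrite ler_pM2l// -expRD ler_expR -opprD lerN2.
  have h1 : lambda ^+ 2 / (16 * (D * C)) <= lambda ^+ 2 / (8 * D).
    rewrite ler_pM2l ?exprn_gt0// lef_pV2 ?posrE ?mulr_gt0//.
    have : D * 1 <= D * C by rewrite ler_pM2l.
    lra.
  have h2 : 1 <= lambda ^+ 2 / (8 * D).
    rewrite ler_pdivlMr ?mulr_gt0// mul1r (le_trans _ large)// ler_peMr// ?mulr_ge0//; lra.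
  have -> : lambda ^+ 2 / (4 * D) = lambda ^+ 2 / (8 * D) + lambda ^+ 2 / (8 * D).
    by field; rewrite gt_eqF.
  lra.
by have := ler_wpM2r (expR_ge0 (- x)) half; lra.
Qed.
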